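(* Let $m\ge 0$ be an integer, $1<p<2$, and $\omega\in W^{m,p}(\mathbb{R}^2_+)$. Let $$u(x)=\frac1{2\pi}\int_{\mathbb{R}^2_+}\Big(\frac{(x-y)^\perp}{|x-y|^2}-\frac{(x-\bar y)^\perp}{|x-\bar y|^2}\Big)\omega(y)\,dy,\qquad x\in\mathbb{R}^2_+.$$ Then $$\|u\|_{W^{m,\frac{2p}{2-p}}(\mathbb{R}^2_+)}\le C_{m,p}\,\|\omega\|_{W^{m,p}(\mathbb{R}^2_+)},$$ where the constant $C_{m,p}$ depends only on $m$ and $p$.
   Context: $\mathbb{R}^2_+=\{(x_1,x_2)\in\mathbb{R}^2: x_2>0\}$; for $z=(z_1,z_2)$, $z^\perp=(z_2,-z_1)$ and $\bar z=(z_1,-z_2)$. $W^{m,s}$ is the usual Sobolev space, with $W^{0,s}=L^s$. *)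

(* Defs.v *)
From HB Require Import structures.
From mathcomp Require Import all_boot all_order all_algebra.
From mathcomp Require Import all_classical all_reals all_analysis.

Set Implicit Arguments.
Unset Strict Implicit.
Unset Printing Implicit Defensive.
Import Order.TTheory GRing.Theory Num.Theory.
Import numFieldNormedType.Exports.

Local Open Scope classical_set_scope.
Local Open Scope ring_scope.

Definition lebesgue2 (R : realType) :
    {measure set (measurableTypeR R * measurableTypeR R) -> \bar R} :=
  (lebesgue_measure \x lebesgue_measure)%E.

Definition halfplane (R : realType) : set (R * R) := [set x | 0 < x.2].

Section Sobolev.
Context (R : realType).
Implicit Types (Omega : set (R * R)) (f g phi : R * R -> R) (p : R).

Definition basis_vec (i : bool) : R * R := if i then (0, 1) else (1, 0).

Definition partial (i : bool) f : R * R -> R :=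
  fun x => derive f x (basis_vec i).

(* All iterated partial derivatives, in any order, exist and are continuous. *)
Definition smooth f : Prop :=
  forall s : seq bool, let g := foldr partial f s in
    continuous g /\ forall x i, derivable g x (basis_vec i).

Definition test_function Omega phi : Prop :=
  let K := closure [set x | phi x != 0] in
  [/\ smooth phi, compact K & K `<=` Omega].

(* The classical derivative for the multi-index (a, b). *)
Definition multi_partial (a b : nat) f : R * R -> R :=
  iter a (partial false) (iter b (partial true) f).

Definition loc_integrable Omega f : Prop :=
  forall K : set (R * R), compact K -> K `<=` Omega ->
    (@lebesgue2 R).-integrable K (EFin \o f).

Definition is_weak_deriv Omega (a b : nat) f g : Prop :=
  [/\ loc_integrable Omega f, loc_integrable Omega g &
    forall phi, test_function Omega phi ->
      Rintegral (@lebesgue2 R) Omega (fun x => f x * multi_partial a b phi x) =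
      (-1) ^+ (a + b) *
        Rintegral (@lebesgue2 R) Omega (fun x => g x * phi x)].

(* Weak derivatives are unique almost everywhere, so the L^p norms of the
   function selected here do not depend on the selection. *)
Definition weak_deriv Omega (a b : nat) f : R * R -> R :=
  xget (fun=> 0) [set g | is_weak_deriv Omega a b f g].

Definition Lp_norm Omega p f : \bar R :=
  'N[@lebesgue2 R]_(p%:E)[(EFin \o f) \_ Omega]%E.

Definition in_Lp Omega p f : Prop :=
  measurable_fun (Omega : set (measurableTypeR R * measurableTypeR R)) f /\
  (Lp_norm Omega p f < +oo)%E.

Definition in_sobolev Omega (m : nat) p f : Prop :=
  in_Lp Omega p f /\
  forall a b, (a + b <= m)%N ->
    exists2 g, is_weak_deriv Omega a b f g & in_Lp Omega p g.

Definition sobolev_norm Omega (m : nat) p f : \bar R :=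
  ((\sum_(a < m.+1) \sum_(b < m.+1 | (a + b <= m)%N)
      Lp_norm Omega p (weak_deriv Omega a b f) `^ p) `^ p^-1)%E.

Implicit Type F : R * R -> R * R.

Definition in_sobolev2 Omega (m : nat) p F : Prop :=
  in_sobolev Omega m p (fst \o F) /\ in_sobolev Omega m p (snd \o F).

Definition sobolev_norm2 Omega (m : nat) p F : \bar R :=
  ((sobolev_norm Omega m p (fst \o F) `^ p +
    sobolev_norm Omega m p (snd \o F) `^ p) `^ p^-1)%E.

End Sobolev.

Section BiotSavart.
Context (R : realType).
Implicit Types x y z : R * R.

Definition perp z : R * R := (z.2, - z.1).

Definition reflect2 z : R * R := (z.1, - z.2).

(* The library norm on R * R is the sup norm, hence this definition. *)
Definition sqnorm2 z : R := z.1 ^+ 2 + z.2 ^+ 2.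

Definition bs_kernel x y : R * R :=
  (sqnorm2 (x - y))^-1 *: perp (x - y) -
  (sqnorm2 (x - reflect2 y))^-1 *: perp (x - reflect2 y).

Definition biot_savart (omega : R * R -> R) x : R * R :=
  (2 * pi)^-1 *:
    (Rintegral (@lebesgue2 R) (@halfplane R)
       (fun y => (bs_kernel x y).1 * omega y),
     Rintegral (@lebesgue2 R) (@halfplane R)
       (fun y => (bs_kernel x y).2 * omega y)).

End BiotSavart.

(* Main.v *)
(* Extend the vorticity oddly across the boundary: the velocity becomes a
   full-plane convolution of the extension with z^perp / |z|^2, which is dominated
   by 1 / |z|, so the Hardy-Littlewood-Sobolev inequality bounds it in L^q,
   q = 2p / (2 - p).  Tangential derivatives commute with the odd extension, so
   they only need the same bound.  A normal derivative of the velocity is traded,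
   through div u = 0 and curl u = omega (up to a constant), for a tangential one
   plus a term c * d^alpha omega with |alpha| < m.  That term is in L^q as well,
   because a function on the half-plane is the convolution of its gradient with
   z / |z|^2 restricted to the lower half-plane, and the inequality applies again.
   Thus no singular integral estimate is needed. *)
Require Import Defs.
From HB Require Import structures.
From mathcomp Require Import all_boot all_order all_algebra.
From mathcomp Require Import all_classical all_reals all_analysis.
From mathcomp Require Import measurable_realfun ring lra.

Set Implicit Arguments.
Unset Strict Implicit.
Unset Printing Implicit Defensive.
Import Order.TTheory GRing.Theory Num.Theory.
Import numFieldNormedType.Exports.

Local Open Scope classical_set_scope.
Local Open Scope ring_scope.

(** Every identity is tested against a smooth [phi], and convolutions are moved onto [phi] by Fubini
    ([convol_corr]). Kernels are thus never differentiated at their singularity; most estimates only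
    use domination by [1 / |z|] ([kernel_like]). The price is that the correlation of a kernel with
    [phi] is smooth but in general not compactly supported, so the weak derivative formula has to be
    extended to it by cutoffs. At infinity integrability is enough. At the boundary a cutoff has a
    large normal derivative, and the odd extension may jump there: this is why its normal derivative
    is avoided. In the Sobolev bound the kernel lives in the lower half-plane precisely to make the
    correlation vanish near the boundary. The Hardy-Littlewood-Sobolev inequality is obtained
    directly in strong form, by choosing a truncation at each level and summing over levels, without
    interpolation. The constants of the divergence identities are multiples of pi that are never
    computed; the one for the half-plane only has to be nonzero, since it is divided by. *)

Notation leb := lebesgue_measure.

(* A plain set function, so that the sigma-finite structure, which the product
   measure [lebesgue2] does not carry, can be attached to it. *)
Definition leb2 (R : realType) : set (measurableTypeR R * measurableTypeR R) -> \bar R := @lebesgue2 R.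
HB.instance Definition _ (R : realType) := Measure.on (@leb2 R).

(** * Lebesgue measure and Borel sets of the plane *)

Section plane_basics.
Context {R : realType}.
Local Notation mR := (measurableTypeR R).
Local Notation mu := (@leb2 R).

Lemma leb2E (A B : set mR) : measurable A -> measurable B ->
  mu (A `*` B) = (leb A * leb B)%E.
Proof. by move=> mA mB; rewrite /leb2 /lebesgue2 /= product_measure1E. Qed.

Lemma leb2_sigma_finite : sigma_finite setT mu.
Proof.
exists (fun n => `[- n%:R, n%:R]%classic `*` `[- n%:R, n%:R]%classic).
  apply/seteqP; split => // -[x y] _.
  have [n Hn] : exists n : nat, Num.max `|x| `|y| <= n%:R.
    by exists (Num.truncn (Num.max `|x| `|y|)).+1; apply/ltW/truncnS_gt.
  exists n => //=; rewrite !in_itv/=; move: Hn; rewrite ge_max => /andP[].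
  by rewrite !ler_norml.
move=> n; split; first by apply: measurableX.
rewrite [ltLHS]leb2E// lebesgue_measure_itv/= lte_fin.
by case: ifP => _; rewrite ?mule0// -EFinB -EFinM ltry.
Qed.
HB.instance Definition _ := Measure_isSigmaFinite.Build _ _ _ mu leb2_sigma_finite.

(** The sigma-algebra is the product one, so an open set must be presented as a countable union of
    rectangles; the rational boxes contained in it suffice. *)
Lemma open_measurable2 (U : set (R * R)) : open U ->
  measurable (U : set (mR * mR)%type).
Proof.
move=> oU.
pose F (q : (rat * rat) * (rat * rat)) : set (mR * mR)%type :=
  let B := `]ratr q.1.1, ratr q.1.2[%classic `*` `]ratr q.2.1, ratr q.2.2[%classic in
  if `[< B `<=` U >] then B else set0.
have -> : U = \bigcup_q F q.
  apply/seteqP; split => [[x y] Uxy|[x y] [q _]]; last first.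
    by rewrite /F; case: ifPn => // /asboolP BU; exact: BU.
  have [/= e e0 eU] := (nbhs_ballP _ _).1 (open_nbhs_nbhs (conj oU Uxy)).
  have [a] := @rat_in_itvoo R (x - e) x ltac:(by rewrite ltrBlDr ltrDl).
  rewrite in_itv/= => /andP[a1 a2].
  have [b] := @rat_in_itvoo R x (x + e) ltac:(by rewrite ltrDl).
  rewrite in_itv/= => /andP[b1 b2].
  have [c] := @rat_in_itvoo R (y - e) y ltac:(by rewrite ltrBlDr ltrDl).
  rewrite in_itv/= => /andP[c1 c2].
  have [d] := @rat_in_itvoo R y (y + e) ltac:(by rewrite ltrDl).
  rewrite in_itv/= => /andP[d1 d2].
  exists ((a, b), (c, d)) => //; rewrite /F/=.
  rewrite asboolT; first by split; rewrite /= in_itv/=; apply/andP.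
  move=> [u v] [/=]; rewrite !in_itv/= => /andP[u1 u2] /andP[v1 v2].
  by apply: eU; split; rewrite /ball/= ltr_norml; apply/andP; split; lra.
apply: countable_bigcupT_measurable => // q; rewrite /F.
by case: ifPn => // _; apply: measurableX.
Qed.

Lemma closed_measurable2 (U : set (R * R)) : closed U ->
  measurable (U : set (mR * mR)%type).
Proof.
move=> cU; rewrite -(setCK U); apply: measurableC; apply: open_measurable2.
exact: closed_openC.
Qed.

Lemma continuous_measurable2 (f : R * R -> R) : continuous f ->
  measurable_fun setT (f : (mR * mR)%type -> R).
Proof.
move=> /continuousP cf; apply: (measurability _ (RGenOpens.measurableE R)).
move=> _ [_ [a [b ->] <-]]; rewrite setTI.
exact: (open_measurable2 (cf _ (interval_open _ _))).
Qed.

End plane_basics.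
(** The integral of a nonnegative function is a supremum over the simple functions below it, so
    pointwise comparison is enough. *)
Lemma ge0_integral_mono d (T : measurableType d) (R : realType)
    (mu : {measure set T -> \bar R}) (D : set T) (f g : T -> \bar R) :
  (forall x, D x -> 0 <= f x)%E -> (forall x, D x -> f x <= g x)%E ->
  (\int[mu]_(x in D) f x <= \int[mu]_(x in D) g x)%E.
Proof.
move=> f0 fg; rewrite !ge0_integralE//; last first.
  by move=> x Dx; rewrite (le_trans (f0 _ Dx))// fg.
apply: ereal_sup_le => _ [h /= hf <-]; exists h => // x.
apply: (le_trans (hf x)); rewrite !patchE; case: ifPn => // /set_mem Dx.
exact: fg.
Qed.

(** * Change of variables along measure-preserving maps *)

Section measure_preserving.
Context d (T : measurableType d) (R : realType).
Context (mu : {measure set T -> \bar R}).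

Definition mpres (phi : T -> T) := measurable_fun setT phi /\
  forall A, measurable A -> mu (phi @^-1` A) = mu A.

Lemma mpres_comp phi psi : mpres phi -> mpres psi -> mpres (phi \o psi).
Proof.
move=> [mphi hphi] [mpsi hpsi]; split; first exact: measurableT_comp.
move=> A mA; rewrite comp_preimage hpsi ?hphi//.
by rewrite -[X in measurable X]setTI; exact: mphi.
Qed.

Lemma mpres_ge0_integral phi (f : T -> \bar R) : mpres phi ->
  measurable_fun setT f -> (forall x, 0 <= f x)%E ->
  (\int[mu]_x f (phi x) = \int[mu]_x f x)%E.
Proof.
move=> [mphi hphi] mf f0.
transitivity (\int[pushforward mu phi]_x f x)%E.
  by rewrite (ge0_integral_pushforward mphi)// preimage_setT.
by apply: eq_measure_integral => A mA _; exact: hphi.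
Qed.

Lemma mpres_integrable phi (f : T -> \bar R) : mpres phi ->
  mu.-integrable setT f -> mu.-integrable setT (f \o phi).
Proof.
move=> hphi /integrableP[mf fi]; apply/integrableP; split.
  by apply: measurableT_comp => //; exact: hphi.1.
rewrite (mpres_ge0_integral (f := fun x => `|f x|%E))//.
exact: measurableT_comp.
Qed.

(** Integrals are differences of the integrals of the positive and negative parts, so both sides
    agree even when the integral diverges. *)
Lemma mpres_integral phi (f : T -> \bar R) : mpres phi ->
  measurable_fun setT f -> (\int[mu]_x f (phi x) = \int[mu]_x f x)%E.
Proof.
move=> hphi mf; rewrite integralE [RHS]integralE; congr (_ - _)%E.
  rewrite -(mpres_ge0_integral (f := f^\+%E) hphi)//.
    by apply: eq_integral => x _; rewrite !funeposE.
  exact: measurable_funepos.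
rewrite -(mpres_ge0_integral (f := f^\-%E) hphi)//.
  by apply: eq_integral => x _; rewrite !funenegE.
exact: measurable_funeneg.
Qed.

Lemma mpres_Rintegral phi (f : T -> R) : mpres phi ->
  measurable_fun setT f -> \int[mu]_x f (phi x) = \int[mu]_x f x.
Proof.
move=> hphi mf; rewrite /Rintegral (mpres_integral (f := EFin \o f) hphi)//.
exact/measurable_EFinP.
Qed.

End measure_preserving.

(** * Translations and reflections preserve planar Lebesgue measure *)

Section plane_invariance.
Context {R : realType}.
Local Notation mR := (measurableTypeR R).
Local Notation mu := (@leb2 R).

(** The pushforward has the right value on half-open intervals, which determine Lebesgue measure. *)
Lemma mpres_leb_shift (a : R) : mpres (@leb R) ((fun x => x + a) : mR -> mR).
Proof.
have ms : measurable_fun setT ((fun x => x + a) : mR -> mR).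
  by apply: measurable_funD => //; exact: measurable_id.
split => // A mA; change (pushforward (@leb R) ((fun x => x + a) : mR -> mR) A = leb A).
apply/esym/lebesgue_measure_unique => //= _ [[x y] _ <-] /=; rewrite /pushforward.
have -> : (fun x : mR => x + a) @^-1` `]x, y] = `]x - a, y - a]%classic.
  by apply/seteqP; split => z /=; rewrite !in_itv/= => /andP[? ?]; apply/andP; split; lra.
rewrite !lebesgue_measure_itv/= !lte_fin ltrD2r; case: ifP => // _.
by rewrite -!EFinB; congr EFin; ring.
Qed.

Lemma mpres_leb_opp : mpres (@leb R) (-%R : mR -> mR).
Proof.
split => [|A mA]; last by rewrite -[RHS]lebesgue_measureN.
exact: oppr_measurable.
Qed.

Lemma mpres_leb_id : mpres (@leb R) (id : mR -> mR).
Proof. by split. Qed.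

Lemma mpres_leb2 (phi psi : mR -> mR) : mpres (@leb R) phi -> mpres (@leb R) psi ->
  mpres mu (fun z => (phi z.1, psi z.2)).
Proof.
move=> [mphi hphi] [mpsi hpsi].
have m : measurable_fun setT ((fun z => (phi z.1, psi z.2)) : (mR * mR)%type -> (mR * mR)%type).
  by apply: measurable_fun_pair; apply: measurableT_comp.
split => // A mA.
change (pushforward mu ((fun z => (phi z.1, psi z.2)) : (mR * mR)%type -> (mR * mR)%type) A = (leb \x leb)%E A).
apply/esym/product_measure_unique => //.
move=> X Y mX mY; change (mu ((phi @^-1` X) `*` (psi @^-1` Y)) = (leb X * leb Y)%E).
rewrite leb2E ?hphi ?hpsi//; rewrite -[X in measurable X]setTI; [exact: mphi|exact: mpsi].
Qed.

Lemma mpres_shift (a : R * R) : mpres mu (fun z => z + a).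
Proof. exact: (mpres_leb2 (mpres_leb_shift a.1) (mpres_leb_shift a.2)). Qed.

Lemma mpres_opp : mpres mu (fun z => - z).
Proof. exact: (mpres_leb2 mpres_leb_opp mpres_leb_opp). Qed.

Lemma mpres_reflect : mpres mu (@reflect2 R).
Proof. exact: (mpres_leb2 mpres_leb_id mpres_leb_opp). Qed.

Lemma mpres_sub (a : R * R) : mpres mu (fun z => a - z).
Proof.
rewrite (_ : (fun z => a - z) = (fun z => z + a) \o (fun z => - z)).
  exact: (mpres_comp (mpres_shift a) mpres_opp).
by apply/funext => z /=; rewrite addrC.
Qed.

End plane_invariance.

(** * Integrals of real powers *)

Section powR_integral.
Context {R : realType}.
Local Notation mR := (measurableTypeR R).

Lemma continuous_powR (a x : R) : 0 < x -> {for x, continuous (@powR R ^~ a)}.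
Proof.
move=> x0; apply/differentiable_continuous/derivable1_diffP.
by apply: derivable_powR; rewrite in_itv/= x0.
Qed.

Lemma integral_powR_cc (a d G : R) : 0 < d -> d < G ->
  (\int[@leb R]_(t in `[d, G]) (a * t `^ (a - 1))%:E = (G `^ a - d `^ a)%:E)%E.
Proof.
move=> d0 dG; have cp b x : x \in `[d, G] -> {for x, continuous (@powR R ^~ b)}.
  by rewrite in_itv/= => /andP[dx _]; apply: continuous_powR; exact: lt_le_trans dx.
rewrite (@continuous_FTC2 _ _ (@powR R ^~ a))//.
- apply: continuous_in_subspaceT => x /[!inE] xdG.
  by apply: cvgM; [exact: cvg_cst|exact: cp].
- split.
  + move=> x; rewrite in_itv/= => /andP[dx _]; apply: derivable_powR.
    by rewrite in_itv/= (lt_trans d0 dx).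
  + by apply/cvg_at_right_filter/cp; rewrite in_itv/= lexx ltW.
  + by apply/cvg_at_left_filter/cp; rewrite in_itv/= lexx ltW.
- move=> x; rewrite in_itv/= => /andP[dx _]; rewrite powR_derive1//.
  by rewrite in_itv/= (lt_trans d0 dx).
Qed.

Lemma powR_cvg_inv (a : R) : 0 < a -> (n.+1%:R^-1 `^ a : R) @[n --> \oo] --> (0 : R).
Proof.
move=> a0; apply/cvgrPdist_lt => e e0.
have e1 : 0 < e `^ a^-1 by rewrite powR_gt0.
have eE : e = (e `^ a^-1) `^ a by rewrite -powRrM mulVf ?gt_eqF// powRr1// ltW.
near=> n; rewrite sub0r normrN ger0_norm ?powR_ge0// [ltRHS]eE.
apply: gt0_ltr_powR => //; rewrite ?nnegrE ?invr_ge0// ?powR_ge0//.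
near: n; exact: near_infty_natSinv_lt (PosNum e1).
Unshelve. all: end_near. Qed.

Lemma measurable_scaled_powR (D : set mR) (a b : R) : measurable D ->
  measurable_fun D (fun t : mR => (a * t `^ b)%:E).
Proof.
move=> mD; apply/measurable_EFinP/measurable_funM => //.
by apply: measurable_funTS; exact: measurable_powR.
Qed.

Lemma integral_powR_oc (a G : R) : 0 < a -> 0 < G ->
  (\int[@leb R]_(t in `]0%R, G]) (a * t `^ (a - 1))%:E = (G `^ a)%:E)%E.
Proof.
move=> a0 G0.
(* For [a < 1] the integrand is singular at 0, so the fundamental theorem is applied on intervals
   away from 0 that increase to []0, G]]. The minimum with [G / 2] keeps them nondegenerate for
   small [n]. *)
pose F n : set mR := `[Num.min n.+1%:R^-1 (G / 2), G]%classic.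
have min0 n : 0 < Num.min (n.+1%:R^-1) (G / 2) :> R by rewrite lt_min invr_gt0 ltr0Sn divr_gt0.
have UF : `]0, G]%classic = \bigcup_n F n.
  apply/seteqP; split => x; rewrite /F /= in_itv/=.
    move=> /andP[x0 xG]; exists (Num.truncn x^-1) => //=.
    rewrite in_itv/= xG andbT ge_min; apply/orP; left.
    by rewrite invf_ple ?posrE//; exact/ltW/truncnS_gt.
  by move=> [n _]; rewrite /= in_itv/= => /andP[h ->]; rewrite andbT (lt_le_trans (min0 n)).
pose m n := Num.min (n.+1%:R^-1) (G / 2).
have E : (fun n => (\int[@leb R]_(t in F n) (a * t `^ (a - 1))%:E)%E) =
    (fun n => (G `^ a - m n `^ a)%:E).
  apply/funext => n; rewrite integral_powR_cc//.
  by rewrite gt_min; apply/orP; right; lra.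
have : (fun n => (\int[@leb R]_(t in F n) (a * t `^ (a - 1))%:E)%E) @ \oo -->
    (\int[@leb R]_(t in \bigcup_n F n) (a * t `^ (a - 1))%:E)%E.
  apply: ge0_nondecreasing_set_cvg_integral.
  - move=> n k nk; apply/subsetPset => x; rewrite /F/= !in_itv/= => /andP[h ->]; rewrite andbT.
    apply: le_trans h; rewrite le_min !ge_min lexx orbT andbT lef_pV2 ?posrE// ler_nat ltnS nk//.
  - by move=> n; exact: measurable_itv.
  - by move=> n; apply: measurable_scaled_powR; exact: measurable_itv.
  - by move=> n x _; rewrite lee_fin mulr_ge0 ?powR_ge0 ?ltW.
rewrite E UF => /cvg_unique; apply => //.
apply: cvg_EFin; first exact: nearW.
rewrite -[X in _ --> X]subr0; apply: cvgB; first exact: cvg_cst.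
apply: (@squeeze_cvgr _ _ _ _ (fun=> 0) (fun n => n.+1%:R^-1 `^ a)); last 2 first.
- exact: cvg_cst.
- exact: powR_cvg_inv.
near=> n; rewrite powR_ge0/=; apply: ge0_ler_powR; rewrite ?nnegrE ?(ltW a0) ?(ltW (min0 n))//.
by rewrite ge_min lexx.
Unshelve. all: end_near. Qed.

(** This is the inner integral of the layer cake formula; [G] stands for the value of a function at
    a point and may be infinite. *)
Lemma integral_powR_lt (a : R) (G : \bar R) : 0 < a -> (0 <= G)%E ->
  (\int[@leb R]_(t in [set t : R | (0 < t)%R /\ (t%:E < G)%E]) (a * t `^ (a - 1))%:E = G `^ a)%E.
Proof.
move=> a0; case: G => [G| |]//.
- rewrite lee_fin le_eqVlt => /predU1P[<-|G0].
    rewrite (_ : [set _ | _] = set0) ?integral_set0 ?poweR0r ?gt_eqF//.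
    by apply/seteqP; split => // t [/=]; rewrite lte_fin; lra.
  rewrite poweR_EFin -integral_powR_oc//.
  rewrite -(@integral_itv_bndo_bndc _ _ _ _); last exact: measurable_scaled_powR.
  by congr integral; apply/seteqP; split => t/=; rewrite in_itv/= lte_fin => /andP.
- move=> _; rewrite poweRyr ?gt_eqF//.
  rewrite (_ : [set _ | _] = `]0, +oo[%classic); last first.
    by apply/seteqP; split => t/=; rewrite in_itv/= andbT ?ltry // => -[].
  apply: eq_infty => r.
  pose s := Num.max r 1; have s1 : 1 <= s by rewrite le_max lexx orbT.
  apply: (@le_trans _ _ (s%:E)); first by rewrite lee_fin le_max lexx.
  have <- : (s `^ a^-1) `^ a = s.
    by rewrite -powRrM mulVf ?gt_eqF// powRr1// (le_trans _ s1).
  rewrite -integral_powR_oc ?powR_gt0//; last exact: lt_le_trans s1.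
  apply: ge0_subset_integral => //.
  + exact: measurable_scaled_powR.
  + by move=> x _; rewrite lee_fin mulr_ge0 ?powR_ge0 ?ltW.
  + by move=> x /=; rewrite !in_itv/= => /andP[-> _].
Qed.

End powR_integral.

(** * Layer cake formulas *)

Section layer_cake.
Context d (T : measurableType d) {R : realType}.
Context (mu : {sigma_finite_measure set T -> \bar R}).
Local Notation mR := (measurableTypeR R).

(** Tonelli on the region under the graph of [g]. The weight is there for [hls_normalized], where
    the formula is read from right to left to reassemble integrals of [f] over its own superlevel
    sets. *)
Lemma weighted_layer_cake (a : R) (w g : T -> \bar R) : 0 < a ->
  measurable_fun setT w -> (forall x, 0 <= w x)%E ->
  measurable_fun setT g -> (forall x, 0 <= g x)%E ->
  (\int[mu]_x (w x * g x `^ a) =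
   \int[@leb R]_(t in `]0%R, +oo[)
     ((a * t `^ (a - 1))%:E * \int[mu]_(x in [set x | t%:E < g x]) w x))%E.
Proof.
move=> a0 mw w0 mg g0.
pose S : set (T * mR)%type := [set z | 0 < z.2 /\ (z.2%:E < g z.1)%E].
have mS : measurable S.
  have -> : S = [set z | (0 < z.2%:E)%E] `&` [set z | (z.2%:E < g z.1)%E].
    by apply/seteqP; split => z /=; rewrite lte_fin.
  apply: measurableI; rewrite -[X in measurable X]setTI; apply: measurable_lte => //.
  - by apply/measurable_EFinP; exact: measurable_snd.
  - by apply/measurable_EFinP; exact: measurable_snd.
  - by apply: measurableT_comp => //; exact: measurable_fst.
pose f : T * mR -> \bar R :=
  (fun z => (a * z.2 `^ (a - 1))%:E * ((w \o fst) \_ S) z)%E.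
have mf : measurable_fun setT f.
  apply: emeasurable_funM.
    by apply: (measurableT_comp (measurable_scaled_powR a (a - 1) measurableT)); exact: measurable_snd.
  apply: (measurable_restrictT _ mS).1; apply: measurable_funTS.
  by apply: measurableT_comp => //; exact: measurable_fst.
have p0 (t : R) : 0 <= a * t `^ (a - 1) by rewrite mulr_ge0 ?powR_ge0 ?ltW.
have f0 z : (0 <= f z)%E by rewrite mule_ge0 ?lee_fin// patchE; case: ifP => //= _; exact: w0.
have := fubini_tonelli (m1 := mu) (m2 := @leb R) f mf f0.
set lhs := (LHS); set rhs := (RHS) => E.
transitivity lhs.
  apply: eq_integral => x _; rewrite -(integral_powR_lt a0 (g0 x)) integral_mkcond muleC.
  have mI : measurable ([set t : R | 0 < t /\ (t%:E < g x)%E] : set mR).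
    rewrite (_ : [set t : R | _] = `]0, +oo[%classic `&` [set t | (t%:E < g x)%E]).
      by apply: measurable_lte => //; exact/measurable_EFinP/measurable_id.
    by apply/seteqP; split => t/=; rewrite in_itv/= andbT.
  rewrite -ge0_integralZr//; last 2 first.
  - by apply: (measurable_restrictT _ mI).1; exact: measurable_scaled_powR.
  - by move=> t _; rewrite patchE; case: ifP; rewrite ?lee_fin.
  apply: eq_integral => t _; rewrite /f !patchE.
  have -> : (t \in [set t : R | (0 < t)%R /\ (t%:E < g x)%E]) = ((x, t) \in S).
    by apply/idP/idP; rewrite !inE.
  by case: ifP => _; rewrite ?mul0e ?mule0.
rewrite E /rhs [RHS]integral_mkcond; apply: eq_integral => t _.
rewrite patchE; case: ifPn => [/set_mem|/negP tn].
  rewrite /= in_itv/= andbT => t0.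
  have mtg : measurable [set x | (t%:E < g x)%E].
    by rewrite -[X in measurable X]setTI; apply: measurable_lte.
  rewrite /f/= ge0_integralZl_EFin//; last 2 first.
  - by move=> x _; rewrite patchE; case: ifP => //=.
  - have mx : measurable_fun setT ((w \o fst) \_ S).
      apply: (measurable_restrictT _ mS).1; apply: measurable_funTS.
      by apply: measurableT_comp => //; exact: measurable_fst.
    apply: (measurableT_comp mx).
    by apply: measurable_fun_pair => //; exact: measurable_id.
  congr (_ * _)%E; rewrite [RHS]integral_mkcond; apply: eq_integral => x _.
  rewrite !patchE/=.
  have -> : ((x, t) \in S) = (x \in [set x | (t%:E < g x)%E]).
    by apply/idP/idP; rewrite !inE /S/=; tauto.
  by [].
rewrite integral0_eq// => x _; rewrite /f patchE memNset ?mule0//.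
by move=> [/= t0 _]; apply: tn; rewrite inE/= in_itv/= t0.
Qed.

Lemma layer_cake (a : R) (g : T -> \bar R) : 0 < a ->
  measurable_fun setT g -> (forall x, 0 <= g x)%E ->
  (\int[mu]_x g x `^ a =
   \int[@leb R]_(t in `]0%R, +oo[) ((a * t `^ (a - 1))%:E * mu [set x | t%:E < g x]))%E.
Proof.
move=> a0 mg g0.
transitivity (\int[mu]_x (cst 1 x * g x `^ a))%E.
  by apply: eq_integral => x _; rewrite mul1e.
rewrite weighted_layer_cake//.
apply: eq_integral => t _; rewrite integral_cst ?mul1e//.
by rewrite -[X in measurable X]setTI; apply: measurable_lte.
Qed.

End layer_cake.

(** * The kernel [1 / |z|], split near and far from the origin *)

Section riesz_kernel.
Context {R : realType}.
Local Notation mR := (measurableTypeR R).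
Local Notation mu := (@leb2 R).

(** The norm is the sup norm, so balls are squares of area [4 r ^ 2] and [rk] dominates the inverse
    of the Euclidean norm. At the origin its value is 0. *)
Definition rk (z : R * R) : R := `|z|^-1.

Lemma rk_ge0 z : 0 <= rk z. Proof. by rewrite invr_ge0. Qed.

Lemma normr2E (z : R * R) : `|z| = Num.max `|z.1| `|z.2|.
Proof. by []. Qed.

Lemma measurable_norm2 : measurable_fun setT (fun z : (mR * mR)%type => `|z : R * R| : R).
Proof. by apply: continuous_measurable2; exact: norm_continuous. Qed.

Lemma measurable_rk : measurable_fun setT (rk : (mR * mR)%type -> R).
Proof.
rewrite (_ : rk = fun z => `|z| `^ (-1)); last first.
  by apply/funext => z; rewrite powR_inv1.
by apply: (measurableT_comp (@measurable_powR R (-1))); exact: measurable_norm2.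
Qed.

Lemma ball2E (r : R) : [set z : R * R | `|z| < r] = `]-r, r[%classic `*` `]-r, r[%classic.
Proof.
apply/seteqP; split => z; rewrite /= normr2E gt_max !in_itv/= !ltr_norml.
  by move=> /andP[].
by move=> [-> ->].
Qed.

Lemma leb2_ball (r : R) : 0 <= r -> mu [set z : R * R | `|z| < r] = (4 * r ^+ 2)%:E.
Proof.
move=> r0; rewrite ball2E [LHS]leb2E//= lebesgue_measure_itv/= lte_fin.
case: ltP => h; first by rewrite -!EFinB -EFinM; congr EFin; ring.
have -> : r = 0 by lra.
by rewrite mule0 expr0n/= mulr0.
Qed.

Lemma measurable_ball2 (r : R) : measurable ([set z | `|z : R * R| < r] : set (mR * mR)%type).
Proof. rewrite ball2E; apply: measurableX; exact: measurable_itv. Qed.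

Definition near_rk (r : R) (z : R * R) : R := rk z * (`|z| < r)%R%:R.
Definition far_rk (r : R) (z : R * R) : R := rk z * (r <= `|z|)%R%:R.

Lemma rk_split (r : R) z : rk z = near_rk r z + far_rk r z.
Proof. by rewrite /near_rk /far_rk -mulrDr leNgt; case: (_ < _); rewrite ?addr0 ?add0r mulr1. Qed.

Lemma near_rk_ge0 (r : R) z : 0 <= near_rk r z.
Proof. by rewrite mulr_ge0 ?rk_ge0. Qed.

Lemma far_rk_ge0 (r : R) z : 0 <= far_rk r z.
Proof. by rewrite mulr_ge0 ?rk_ge0. Qed.

Lemma measurable_near_rk (r : R) : measurable_fun setT (near_rk r : (mR * mR)%type -> R).
Proof.
rewrite (_ : near_rk r = fun z => rk z * \1_[set z | `|z| < r] z); last first.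
  by apply/funext => z; rewrite indicE /near_rk mem_setE.
apply: measurable_funM; first exact: measurable_rk.
by apply: measurable_indic; exact: measurable_ball2.
Qed.

Lemma measurable_far_rk (r : R) : measurable_fun setT (far_rk r : (mR * mR)%type -> R).
Proof.
rewrite (_ : far_rk r = fun z => rk z - near_rk r z); last first.
  by apply/funext => z; rewrite (rk_split r z) addrC addKr.
by apply: measurable_funB; [exact: measurable_rk|exact: measurable_near_rk].
Qed.

Lemma rk_gt (t : R) z : 0 < t -> t < rk z -> `|z| < t^-1.
Proof.
move=> t0; rewrite /rk => tz; have z0 : 0 < `|z|.
  by rewrite -invr_gt0 (lt_trans t0).
by rewrite -[ltLHS]invrK ltf_pV2 ?posrE ?invr_gt0.
Qed.

Lemma integral_near_rk (r : R) : 0 < r -> (\int[mu]_z (near_rk r z)%:E <= (8 * r)%:E)%E.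
Proof.
move=> r0.
have -> : (\int[mu]_z (near_rk r z)%:E = \int[mu]_z (near_rk r z)%:E `^ 1)%E.
  by apply: eq_integral => z _; rewrite poweRe1// lee_fin near_rk_ge0.
rewrite layer_cake//; last 2 first.
- by apply/measurable_EFinP; exact: measurable_near_rk.
- by move=> z; rewrite lee_fin near_rk_ge0.
have ri0 : 0 < r^-1 by rewrite invr_gt0.
(* The superlevel set at height [t] lies in the ball of radius [r], and in the ball of radius
   [t^-1]. The first bound is used on [A], the second on [B]; each range contributes [4 r]. *)
pose A : set mR := `]0, r^-1]%classic.
pose B : set mR := `[r^-1, +oo[%classic.
pose b (t : mR) : \bar R := (4 * t `^ (-1 - 1))%:E.
have w0 t : (0 <= (b \_ B) t)%E.
  by rewrite patchE; case: ifP => // _; rewrite lee_fin mulr_ge0 ?powR_ge0.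
have v0 t : (0 <= (cst (4 * r ^+ 2)%:E \_ A) t)%E.
  by rewrite patchE; case: ifP => // _; rewrite lee_fin; apply: mulr_ge0 => //; exact: sqr_ge0.
have mw : measurable_fun setT (b \_ B).
  by apply: (measurable_restrictT _ _).1; [|apply: measurable_scaled_powR]; exact: measurable_itv.
have mv : measurable_fun setT (cst (4 * r ^+ 2)%:E \_ A).
  by apply: (measurable_restrictT _ _).1; [exact: measurable_itv|exact: measurable_cst].
rewrite integral_mkcond.
apply: (@le_trans _ _ (\int[@leb R]_t ((cst (4 * r ^+ 2)%:E \_ A) t + (b \_ B) t))%E).
  apply: ge0_integral_mono => [t _|t _].
    by rewrite patchE; case: ifP => // _; rewrite mule_ge0// lee_fin mulr_ge0 ?powR_ge0.
  rewrite [X in (X <= _)%E]patchE.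
  have [/set_mem/=|_] := ifPn; last exact: adde_ge0.
  rewrite in_itv/= andbT => t0; rewrite subrr powRr0 mulr1 mul1e.
  have mnear : measurable [set z | (t%:E < (near_rk r z)%:E)%E].
    rewrite -[X in measurable X]setTI; apply: measurable_lte => //.
    by apply/measurable_EFinP; exact: measurable_near_rk.
  have [tr|tr] := leP t r^-1.
    apply: (@le_trans _ _ ((cst (4 * r ^+ 2)%:E \_ A) t)); last by rewrite leeDl.
    rewrite patchE mem_set/=; last by rewrite /A/= in_itv/= t0.
    rewrite -(leb2_ball (ltW r0)); apply: le_measure; rewrite ?inE//; first exact: measurable_ball2.
    move=> z/=; rewrite lte_fin /near_rk; case: (_ < r) => //.
    by rewrite mulr0 ltNge ltW.
  apply: (@le_trans _ _ ((b \_ B) t)); last by rewrite leeDr.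
  rewrite patchE mem_set; last by rewrite /B/= in_itv/= andbT ltW.
  rewrite /b (_ : t `^ (-1 - 1) = t^-1 ^+ 2); last first.
    by rewrite (_ : -1 - 1 = - 2%:R); [rewrite powR_invn ?ltW// exprVn|lra].
  have ti0 : 0 <= t^-1 by rewrite invr_ge0 ltW.
  rewrite -(leb2_ball ti0).
  apply: le_measure; rewrite ?inE//; first exact: measurable_ball2.
  move=> z/=; rewrite lte_fin /near_rk; case: (_ < r); rewrite ?mulr1 ?mulr0; first exact: rk_gt.
  by rewrite ltNge ltW.
rewrite (ge0_integralD _ measurableT (fun t _ => v0 t) mv (fun t _ => w0 t) mw).
rewrite -!integral_mkcond integral_cst; last exact: measurable_itv.
have lA : leb A = r^-1%:E by rewrite /A lebesgue_measure_itv/= lte_fin ri0 -EFinB subr0.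
rewrite -[X in (_ * X + _)%E]/(leb A) lA /b.
rewrite (@ge0_continuous_FTC2y R _ (fun t => -4 * t `^ (-1)) _ 0); last 6 first.
- by move=> x _; rewrite mulr_ge0 ?powR_ge0.
- apply: continuous_in_subspaceT => x /[!inE]/=; rewrite in_itv/= andbT => rx.
  by apply: cvgM; [exact: cvg_cst|apply: continuous_powR; exact: lt_le_trans rx].
- rewrite -[X in _ --> X](mulr0 (-4)); apply: cvgM; first exact: cvg_cst.
  apply/cvgrPdist_lt => e e0; near=> x.
  have x0 : 0 < x by near: x; apply: nbhs_pinfty_gt; exact: num_real.
  rewrite sub0r normrN ger0_norm ?powR_ge0// powR_inv1 ?ltW//.
  by rewrite invf_plt ?posrE//; near: x; apply: nbhs_pinfty_gt; exact: num_real.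
- move=> x rx; apply: derivableM; first exact: derivable_cst.
  by apply: derivable_powR; rewrite in_itv/= andbT (lt_trans ri0).
- apply: cvgM; first exact: cvg_cst.
  by apply: cvg_at_right_filter; exact: continuous_powR.
- move=> x; rewrite in_itv/= andbT => rx.
  rewrite derive1Ml; last by apply: derivable_powR; rewrite in_itv/= andbT (lt_trans ri0).
  rewrite powR_derive1; last by rewrite in_itv/= andbT (lt_trans ri0).
  by rewrite mulrA; congr (_ * _); lra.
rewrite -EFinM -EFinB -EFinD lee_fin powR_inv1 ?(ltW ri0)// invrK.
by rewrite le_eqVlt; apply/orP; left; apply/eqP; field; rewrite gt_eqF.
Unshelve. all: end_near. Qed.

(** Superlevel sets are empty from height [r^-1] on and have area at most [4 t ^ (- 2)] below it;
    [2 < a] makes the remaining integral of [t ^ (a - 3)] converge at 0. *)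
Lemma integral_far_rk (a r : R) : 2 < a -> 0 < r ->
  (\int[mu]_z ((far_rk r z)%:E `^ a) <= (4 * a / (a - 2) * r `^ (2 - a))%:E)%E.
Proof.
move=> a2 r0; have a0 : 0 < a by lra.
have ri0 : 0 < r^-1 by rewrite invr_gt0.
rewrite layer_cake//; last 2 first.
- by apply/measurable_EFinP; exact: measurable_far_rk.
- by move=> z; rewrite lee_fin far_rk_ge0.
pose A : set mR := [set t : R | 0 < t /\ (t%:E < r^-1%:E)%E].
have -> : (4 * a / (a - 2) * r `^ (2 - a))%:E =
    (\int[@leb R]_(t in A) (4 * a / (a - 2) * ((a - 2) * t `^ (a - 2 - 1)))%:E)%E.
  under eq_integral do rewrite EFinM.
  have c0 : 0 <= 4 * a / (a - 2) by rewrite divr_ge0 ?mulr_ge0//; lra.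
  have mA : measurable A.
    rewrite (_ : A = `]0, r^-1[%classic); first exact: measurable_itv.
    by apply/seteqP; split => t; rewrite /A /= lte_fin in_itv/= => /andP.
  rewrite ge0_integralZl_EFin//; last 2 first.
  - by move=> t _; rewrite lee_fin mulr_ge0 ?powR_ge0//; lra.
  - exact: measurable_scaled_powR.
  rewrite integral_powR_lt ?lee_fin ?ltW//; last lra.
  rewrite poweR_EFin -EFinM; congr (_ * _)%:E.
  by rewrite -[r^-1]powR_inv1 ?ltW// -powRrM; congr (_ `^ _); ring.
rewrite integral_mkcond [leRHS]integral_mkcond.
apply: ge0_integral_mono => [t _|t _].
  by rewrite patchE; case: ifP => // _; rewrite mule_ge0// lee_fin mulr_ge0 ?powR_ge0 ?ltW.
rewrite [X in (X <= _)%E]patchE [X in (_ <= X)%E]patchE.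
have [/set_mem/=|_] := ifPn; last first.
  case: ifP => // _; rewrite lee_fin mulr_ge0//; first by rewrite divr_ge0 ?mulr_ge0//; lra.
  by rewrite mulr_ge0 ?powR_ge0//; lra.
rewrite in_itv/= andbT => t0.
have mfar : measurable [set z | (t%:E < (far_rk r z)%:E)%E].
  rewrite -[X in measurable X]setTI; apply: measurable_lte => //.
  by apply/measurable_EFinP; exact: measurable_far_rk.
case: ifPn => [_|/negP tA].
  apply: (@le_trans _ _ ((a * t `^ (a - 1))%:E * (4 * t^-1 ^+ 2)%:E)%E).
    apply: lee_pmul => //; first by rewrite lee_fin mulr_ge0 ?powR_ge0 ?ltW.
    have ti0 : 0 <= t^-1 by rewrite invr_ge0 ltW.
    rewrite -(leb2_ball ti0).
    apply: le_measure; rewrite ?inE//; first exact: measurable_ball2.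
    move=> z/=; rewrite lte_fin /far_rk; case: (r <= _); rewrite ?mulr1 ?mulr0; first exact: rk_gt.
    by rewrite ltNge ltW.
  rewrite -EFinM lee_fin le_eqVlt; apply/orP; left; apply/eqP.
  have -> : a - 2 - 1 = (a - 1) + - 2%:R by ring.
  rewrite (@powRD _ t (a - 1) (- 2%:R)); last by apply/implyP => _; rewrite gt_eqF.
  rewrite powR_invn ?ltW// exprVn; field.
  by apply/andP; split; rewrite gt_eqF//; lra.
rewrite (_ : [set _ | _] = set0) ?measure0 ?mule0//.
apply/seteqP; split => // z /=; rewrite lte_fin /far_rk.
case: (leP r `|z|) => rz; last by rewrite mulr0 ltNge ltW.
rewrite mulr1 => tz; apply: tA; rewrite inE; split => //.
by rewrite lte_fin (lt_le_trans tz)// /rk lef_pV2 ?posrE// (lt_le_trans r0).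
Qed.

End riesz_kernel.

(** * Superlevel sets of the Riesz potential *)

Section HLS.
Context {R : realType}.
Local Notation mR := (measurableTypeR R).
Local Notation T := (mR * mR)%type.
Local Notation mu := (@leb2 R).

Definition riesz (f : R * R -> R) (x : R * R) : \bar R :=
  (\int[mu]_y (rk (x - y) * f y)%:E)%E.

Lemma measurable_sub2 :
  measurable_fun setT (fun z : T * T => (z.1 - z.2 : R * R) : T).
Proof.
apply: measurable_fun_pair; apply: measurable_funB.
- exact: (measurableT_comp measurable_fst measurable_fst).
- exact: (measurableT_comp measurable_fst measurable_snd).
- exact: (measurableT_comp measurable_snd measurable_fst).
- exact: (measurableT_comp measurable_snd measurable_snd).
Qed.

Lemma measurable_convol (k f : T -> R) : measurable_fun setT k -> measurable_fun setT f ->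
  measurable_fun setT (fun z : T * T => k (z.1 - z.2) * f z.2).
Proof.
move=> mk mf; apply: measurable_funM.
  exact: (measurableT_comp mk measurable_sub2).
exact: (measurableT_comp mf measurable_snd).
Qed.

Lemma measurable_convol1 (k f : T -> R) (x : T) : measurable_fun setT k -> measurable_fun setT f ->
  measurable_fun setT (fun y : T => k (x - y : R * R) * f y).
Proof.
move=> mk mf; exact: (measurableT_comp (measurable_convol mk mf)
  (measurable_fun_pair (measurable_cst x) (@measurable_id _ _ setT))).
Qed.

Lemma measurable_ge0_convol (k f : T -> R) : measurable_fun setT k -> measurable_fun setT f ->
  (forall z, 0 <= k z) -> (forall z, 0 <= f z) ->
  measurable_fun setT (fun x : T => \int[mu]_y (k (x - y : R * R) * f y)%:E)%E.
Proof.
move=> mk mf k0 f0.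
apply: (measurable_fun_fubini_tonelli_F (m2 := mu)
  (fun z : T * T => (k (z.1 - z.2 : R * R) * f z.2)%:E)).
  by apply/measurable_EFinP; exact: measurable_convol.
by move=> z; rewrite lee_fin mulr_ge0.
Qed.

Lemma measurable_riesz (f : T -> R) : measurable_fun setT f -> (forall z, 0 <= f z) ->
  measurable_fun setT (riesz f : T -> \bar R).
Proof. by move=> mf f0; apply: measurable_ge0_convol => //; [exact: measurable_rk|exact: rk_ge0]. Qed.

Lemma riesz_ge0 f x : (forall z, 0 <= f z) -> (0 <= riesz f x)%E.
Proof. by move=> f0; apply: integral_ge0 => y _; rewrite lee_fin mulr_ge0 ?rk_ge0. Qed.

Lemma markov_gt (J : T -> \bar R) (c : R) : 0 < c -> measurable_fun setT J ->
  (forall x, 0 <= J x)%E ->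
  (mu [set x | c%:E < J x] <= c^-1%:E * \int[mu]_x J x)%E.
Proof.
move=> c0 mJ J0; rewrite -lee_pdivrMl// ?invrK; last by rewrite invr_gt0.
have mA : measurable [set x | (c%:E < J x)%E].
  by rewrite -[X in measurable X]setTI; apply: measurable_lte.
rewrite -integral_cst// integral_mkcond; apply: ge0_integral_mono => x _.
  by rewrite patchE; case: ifP => // _; rewrite lee_fin ltW.
by rewrite patchE; case: ifPn => [/set_mem/= /ltW|].
Qed.

Lemma integral_near_sub (r : R) x : 0 < r ->
  (\int[mu]_y (near_rk r (x - y))%:E <= (8 * r)%:E)%E.
Proof.
move=> r0; rewrite (mpres_ge0_integral (f := fun z : T => (near_rk r z)%:E) (mpres_sub x)).
- exact: integral_near_rk.
- by apply/measurable_EFinP; exact: measurable_near_rk.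
- by move=> z; rewrite lee_fin near_rk_ge0.
Qed.

Lemma integral_near_sub2 (r : R) y : 0 < r ->
  (\int[mu]_x (near_rk r (x - y))%:E <= (8 * r)%:E)%E.
Proof.
move=> r0; rewrite (mpres_ge0_integral (f := fun z : T => (near_rk r z)%:E) (mpres_shift (- y))).
- exact: integral_near_rk.
- by apply/measurable_EFinP; exact: measurable_near_rk.
- by move=> z; rewrite lee_fin near_rk_ge0.
Qed.

Lemma integral_far_sub (a r : R) x : 2 < a -> 0 < r ->
  (\int[mu]_y ((far_rk r (x - y))%:E `^ a) <= (4 * a / (a - 2) * r `^ (2 - a))%:E)%E.
Proof.
move=> a2 r0; rewrite (mpres_ge0_integral (f := fun z : T => ((far_rk r z)%:E `^ a)%E) (mpres_sub x)).
- exact: integral_far_rk.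
- under eq_fun do rewrite poweR_EFin.
  apply/measurable_EFinP/(measurableT_comp (@measurable_powR R a)).
  exact: measurable_far_rk.
- by move=> z; rewrite poweR_ge0.
Qed.

Lemma far_convol_le (p q p' C2 : R) (f : T -> R) (r : R) x : 1 < p -> p < 2 ->
  q = 2 * p / (2 - p) -> p' = p / (p - 1) -> C2 = 4 / (p' - 2) + p^-1 ->
  measurable_fun setT f -> (forall z, 0 <= f z) ->
  (\int[mu]_y ((f y) `^ p)%:E <= 1)%E -> 0 < r ->
  (\int[mu]_y (far_rk r (x - y) * f y)%:E <= (C2 * r `^ (- (2 / q)))%:E)%E.
Proof.
move=> p1 p2 qE p'E C2E mf f0 f1 r0.
have q2 : 2 < q by rewrite qE ltr_pdivlMr; lra.
have p'2 : 2 < p' by rewrite p'E ltr_pdivlMr; lra.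
(* Young's inequality is applied pointwise to [l * far_rk] and [f / l]. This weight makes both
   resulting integrals multiples of the same power [r ^ (- 2 / q)], whose coefficients add up to
   [C2]. *)
pose l := r `^ (2 / (q * p)).
have l0 : 0 < l by rewrite powR_gt0.
have mfar2 : measurable_fun setT (fun y : T => (far_rk r (x - y : R * R) `^ p')%:E).
  apply/measurable_EFinP/(measurableT_comp (@measurable_powR R p')).
  apply: (measurableT_comp (measurable_far_rk r)).
  exact: (mpres_sub x).1.
have mfp : measurable_fun setT (fun y : T => (f y `^ p)%:E).
  by apply/measurable_EFinP/(measurableT_comp (@measurable_powR R p)).
apply: (@le_trans _ _ (\int[mu]_y ((l `^ p' / p')%:E * (far_rk r (x - y) `^ p')%:E +
   (l `^ (- p) / p)%:E * (f y `^ p)%:E))%E).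
  apply: ge0_integral_mono => y _; first by rewrite lee_fin mulr_ge0 ?far_rk_ge0.
  rewrite -!EFinM -EFinD lee_fin.
  have -> : far_rk r (x - y) * f y = (l * far_rk r (x - y)) * (f y / l).
    by field; rewrite gt_eqF.
  apply: le_trans (@conjugate_powR _ _ _ p' p _ _ _ _ _) _.
  - by rewrite mulr_ge0 ?far_rk_ge0 ?(ltW l0).
  - by rewrite divr_ge0 ?(ltW l0).
  - lra.
  - lra.
  - by rewrite p'E; field; rewrite !gt_eqF//; lra.
  rewrite powRM ?far_rk_ge0 ?(ltW l0)// powRM ?invr_ge0 ?(ltW l0)// -[l^-1]powR_inv1 ?(ltW l0)//.
  rewrite -powRrM mulN1r le_eqVlt; apply/orP; left; apply/eqP; ring.
have pp0 : 0 < p' by lra.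
have c1 : 0 <= l `^ p' / p' by rewrite divr_ge0 ?powR_ge0 ?(ltW pp0).
have c2 : 0 <= l `^ (- p) / p by rewrite divr_ge0 ?powR_ge0//; lra.
rewrite ge0_integralD//; last 4 first.
- by move=> y _; rewrite -EFinM lee_fin mulr_ge0 ?powR_ge0.
- exact: measurable_funeM.
- by move=> y _; rewrite -EFinM lee_fin mulr_ge0 ?powR_ge0.
- exact: measurable_funeM.
rewrite !ge0_integralZl_EFin//; try by move=> y _; rewrite lee_fin powR_ge0.
apply: (@le_trans _ _ ((l `^ p' / p')%:E * (4 * p' / (p' - 2) * r `^ (2 - p'))%:E + (l `^ (- p) / p)%:E * 1)%E).
  apply: leeD; apply: lee_pmul => //.
  - by apply: integral_ge0 => y _; rewrite lee_fin powR_ge0.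
  - under eq_integral do rewrite -poweR_EFin.
    exact: integral_far_sub.
  - by apply: integral_ge0 => y _; rewrite lee_fin powR_ge0.
rewrite mule1 -EFinM -EFinD lee_fin /l -!powRrM.
have -> : 2 / (q * p) * - p = - (2 / q).
  by field; rewrite !gt_eqF//; lra.
have -> : r `^ (2 / (q * p) * p') / p' * (4 * p' / (p' - 2) * r `^ (2 - p')) =
   4 / (p' - 2) * (r `^ (2 / (q * p) * p') * r `^ (2 - p')).
  by field; rewrite !gt_eqF//; lra.
rewrite -powRD; last by apply/implyP => _; rewrite gt_eqF.
have -> : 2 / (q * p) * p' + (2 - p') = - (2 / q).
  rewrite qE p'E; field; rewrite !gt_eqF//; lra.
by rewrite C2E le_eqVlt; apply/orP; left; apply/eqP; ring.
Qed.

(* Truncating the kernel at radius r and f at height s, the two conditions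
   relating s and r to t say that the bounded part of f and the far part of the
   kernel each contribute at most t / 3, which leaves Markov's inequality for the
   near part of the kernel against the large part of f. *)
Lemma hls_superlevel (p q p' C2 : R) (f : T -> R) (t r s : R) : 1 < p -> p < 2 ->
  q = 2 * p / (2 - p) -> p' = p / (p - 1) -> C2 = 4 / (p' - 2) + p^-1 ->
  measurable_fun setT f -> (forall z, 0 <= f z) ->
  (\int[mu]_y ((f y) `^ p)%:E <= 1)%E -> 0 < r -> 0 < t -> 0 <= s ->
  s * (8 * r) <= t / 3 -> C2 * r `^ (- (2 / q)) <= t / 3 ->
  (mu [set x | t%:E < riesz f x] <=
    (24 * r / t)%:E * \int[mu]_(y in [set y | (s < f y)%R]) (f y)%:E)%E.
Proof.
move=> p1 p2 qE p'E C2E mf f0 f1 r0 t0 s0 sr far.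
pose A : set T := [set y | s < f y].
have mA : measurable A.
  rewrite (_ : A = f @^-1` `]s, +oo[%classic).
    by rewrite -[X in measurable X]setTI; exact: mf.
  by apply/seteqP; split => y; rewrite /A/= in_itv/= andbT.
pose g := f \_ A.
have mg : measurable_fun setT g by apply: (measurable_restrictT _ _).1 => //; exact: measurable_funTS.
have g0 y : 0 <= g y by rewrite /g patchE; case: ifP.
pose J (x : T) := (\int[mu]_y (near_rk r (x - y : R * R) * g y)%:E)%E.
have mJ : measurable_fun setT J.
  by apply: measurable_ge0_convol => //; [exact: measurable_near_rk|exact: near_rk_ge0].
have J0 x : (0 <= J x)%E.
  by apply: integral_ge0 => y _; rewrite lee_fin mulr_ge0 ?near_rk_ge0.
have t30 : 0 < t / 3 by rewrite divr_gt0.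
have mJ3 : measurable [set x | ((t / 3)%:E < J x)%E].
  by rewrite -[X in measurable X]setTI; apply: measurable_lte.
have mI : measurable [set x | (t%:E < riesz f x)%E].
  rewrite -[X in measurable X]setTI; apply: measurable_lte => //; exact: measurable_riesz.
apply: (@le_trans _ _ (mu [set x | ((t / 3)%:E < J x)%E])).
  apply: le_measure; rewrite ?inE// => x /=; apply: contraTT; rewrite -!leNgt => Jx.
  apply: (@le_trans _ _ (\int[mu]_y (s%:E * (near_rk r (x - y))%:E +
      ((near_rk r (x - y) * g y)%:E + (far_rk r (x - y) * f y)%:E)))%E).
    apply: ge0_integral_mono => y _; first by rewrite lee_fin mulr_ge0 ?rk_ge0.
    rewrite -EFinM -!EFinD lee_fin (rk_split r) mulrDl addrA lerD2r mulrC -!(mulrC (near_rk _ _)) -mulrDr.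
    apply: ler_wpM2l; first exact: near_rk_ge0.
    rewrite /g patchE; case: ifPn; first by rewrite lerDr.
    by move/negP; rewrite inE /A/= => /negP; rewrite -leNgt addr0.
  have mn : measurable_fun setT (fun y : T => near_rk r (x - y : R * R)).
    by apply: (measurableT_comp (measurable_near_rk r)); exact: (mpres_sub x).1.
  have m1 : measurable_fun setT (fun y : T => (s%:E * (near_rk r (x - y : R * R))%:E)%E).
    by apply: measurable_funeM; exact/measurable_EFinP.
  have m2 : measurable_fun setT (fun y : T => (near_rk r (x - y : R * R) * g y)%:E).
    by apply/measurable_EFinP; apply: measurable_funM.
  have m3 : measurable_fun setT (fun y : T => (far_rk r (x - y : R * R) * f y)%:E).
    by apply/measurable_EFinP; apply: measurable_convol1 => //; exact: measurable_far_rk.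
  have n1 y : (0 <= s%:E * (near_rk r (x - y))%:E)%E by rewrite -EFinM lee_fin mulr_ge0 ?near_rk_ge0.
  have n2 y : (0 <= (near_rk r (x - y) * g y)%:E)%E by rewrite lee_fin mulr_ge0 ?near_rk_ge0.
  have n3 y : (0 <= (far_rk r (x - y) * f y)%:E)%E by rewrite lee_fin mulr_ge0 ?far_rk_ge0.
  rewrite ge0_integralD//; last 2 first.
  - by move=> y _; exact: adde_ge0.
  - exact: emeasurable_funD.
  rewrite ge0_integralD// ge0_integralZl_EFin//; last 2 first.
  - by move=> y _; rewrite lee_fin near_rk_ge0.
  - exact/measurable_EFinP.
  apply: (@le_trans _ _ ((t / 3)%:E + ((t / 3)%:E + (t / 3)%:E))%E); last first.
    by rewrite -!EFinD lee_fin; lra.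
  apply: leeD; last apply: leeD => //.
    apply: (@le_trans _ _ (s%:E * (8 * r)%:E)%E); last by rewrite -EFinM lee_fin.
    by apply: lee_wpmul2l; [rewrite lee_fin|exact: integral_near_sub].
  apply: le_trans (far_convol_le x p1 p2 qE p'E C2E mf f0 f1 r0) _.
  by rewrite lee_fin.
apply: (le_trans (markov_gt t30 mJ J0)).
have -> : (24 * r / t)%:E = ((t / 3)^-1%:E * (8 * r)%:E)%E.
  by rewrite -EFinM; congr EFin; field; rewrite gt_eqF.
rewrite -muleA; apply: lee_wpmul2l; first by rewrite lee_fin invr_ge0 ltW.
rewrite /J (fubini_tonelli (fun z : T * T => (near_rk r (z.1 - z.2 : R * R) * g z.2)%:E)); last 2 first.
- by apply/measurable_EFinP; apply: measurable_convol => //; exact: measurable_near_rk.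
- by move=> z; rewrite lee_fin mulr_ge0 ?near_rk_ge0.
rewrite [X in (_ * X)%E]integral_mkcond -ge0_integralZl_EFin//; last 3 first.
- by move=> y _; rewrite patchE; case: ifP => // _; rewrite lee_fin.
- by apply: (measurable_restrictT _ mA).1; apply: measurable_funTS; exact/measurable_EFinP.
- by rewrite mulr_ge0 ?(ltW r0).
apply: ge0_integral_mono => y _.
  by apply: integral_ge0 => x _; rewrite lee_fin mulr_ge0 ?near_rk_ge0.
have -> : ((EFin \o f) \_ A) y = (g y)%:E by rewrite /g !patchE; case: ifP.
under eq_integral do rewrite /= EFinM.
rewrite (@ge0_integralZr _ _ _ mu _ _ (fun x : T => (near_rk r (x - y : R * R))%:E))//; last 3 first.
- apply/measurable_EFinP; apply: (measurableT_comp (measurable_near_rk r)).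
  exact: (mpres_shift (- y)).1.
- by move=> x _; rewrite lee_fin near_rk_ge0.
- by rewrite lee_fin.
apply: lee_wpmul2r; first by rewrite lee_fin.
exact: integral_near_sub2.
Qed.

End HLS.

(** * The Hardy-Littlewood-Sobolev inequality *)

Section HLS_inequality.
Context {R : realType}.
Local Notation mR := (measurableTypeR R).
Local Notation T := (mR * mR)%type.
Local Notation mu := (@leb2 R).

(** The layer cake formula is applied to the potential, and [hls_superlevel] is used at each height
    [t] with a truncation depending on [t]. What remains is an integral over [t] of [f] on
    superlevel sets of a power of [f], which the weighted formula turns back into a multiple of the
    integral of [f ^ p]. *)
Lemma hls_normalized (p q : R) : 1 < p -> p < 2 -> q = 2 * p / (2 - p) ->
  exists2 C : R, 0 <= C & forall f : T -> R,
    measurable_fun setT f -> (forall z, 0 <= f z) ->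
    (\int[mu]_y ((f y) `^ p)%:E <= 1)%E ->
    (\int[mu]_x (riesz f x `^ q) <= C%:E)%E.
Proof.
move=> p1 p2 qE.
pose p' := p / (p - 1); pose C2 := 4 / (p' - 2) + p^-1.
have q2 : 2 < q by rewrite qE ltr_pdivlMr; lra.
have p'2 : 2 < p' by rewrite /p' ltr_pdivlMr; lra.
have C20 : 0 < C2.
  by rewrite /C2; apply: addr_gt0; [apply: divr_gt0; rewrite ?subr_gt0|rewrite invr_gt0; lra].
(* Solves [C2 * r ^ (- 2 / q) = t / 3] as [r = B * t ^ (- q / 2)]. *)
pose B := (3 * C2) `^ (q / 2).
have B0 : 0 < B by rewrite powR_gt0// mulr_gt0.
pose a := q / 2 - 1.
have a0 : 0 < a by rewrite /a; lra.
pose g := 1 + q / 2.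
have g0 : 0 < g by rewrite /g; lra.
pose K := 24 * q * B / a.
have K0 : 0 < K by rewrite /K divr_gt0// !mulr_gt0//; lra.
(* Here the relation between [p] and [q] enters: [h ^ a] is a multiple of [f ^ (a / g)], and the
   factor [f] in front must raise this to [f ^ p]. *)
have agE : a / g = p - 1.
  rewrite /a /g qE; field; apply/andP; split; rewrite gt_eqF//; lra.
exists (K * (24 * B) `^ (p - 1)); first by rewrite mulr_ge0 ?powR_ge0 ?(ltW K0).
move=> f mf f0 f1.
pose h y := ((24 * B * f y) `^ g^-1)%:E.
have mh : measurable_fun setT h.
  apply/measurable_EFinP/(measurableT_comp (@measurable_powR R g^-1)).
  exact: measurable_funM.
have h0 y : (0 <= h y)%E by rewrite lee_fin powR_ge0.
have mth (t : R) : measurable [set y | (t%:E < h y)%E].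
  by rewrite -[X in measurable X]setTI; apply: measurable_lte.
rewrite layer_cake//; last 3 first.
- by lra.
- exact: measurable_riesz.
- by move=> x; exact: riesz_ge0.
have mKf : measurable_fun setT (fun y => (K * f y)%:E).
  by apply/measurable_EFinP/measurable_funM.
have Kf0 y : (0 <= (K * f y)%:E)%E by rewrite lee_fin mulr_ge0// ltW.
apply: (@le_trans _ _ (\int[mu]_y ((K * f y)%:E * h y `^ a))%E); last first.
  have E y : ((K * f y)%:E * h y `^ a)%E = ((K * (24 * B) `^ (p - 1))%:E * (f y `^ p)%:E)%E.
    rewrite /h poweR_EFin -!EFinM; congr EFin.
    have -> : ((24 * B * f y) `^ g^-1) `^ a = (24 * B) `^ (p - 1) * f y `^ (p - 1).
      by rewrite -powRrM (mulrC _ a) agE powRM// mulr_ge0// ltW.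
    have <- : f y * f y `^ (p - 1) = f y `^ p by apply: mulr_powRB1 => //; lra.
    by ring.
  under eq_integral do rewrite E.
  rewrite ge0_integralZl_EFin//; last 3 first.
  - by move=> y _; rewrite lee_fin powR_ge0.
  - by apply/measurable_EFinP/(measurableT_comp (@measurable_powR R p)).
  - by rewrite mulr_ge0 ?powR_ge0 ?(ltW K0).
  by rewrite -[leRHS]mule1; apply: lee_wpmul2l => //; rewrite lee_fin mulr_ge0 ?powR_ge0 ?(ltW K0).
rewrite (weighted_layer_cake _ a0 mKf Kf0 mh h0).
apply: ge0_integral_mono => t /=; rewrite in_itv/= andbT => t0.
  by rewrite mule_ge0// lee_fin mulr_ge0 ?powR_ge0//; lra.
pose r := B * t `^ (- (q / 2)).
have r0 : 0 < r by apply: mulr_gt0 => //; exact: powR_gt0.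
(* The largest height with [s * (8 * r) <= t / 3]. *)
pose s := t / (24 * r).
have s0 : 0 < s by rewrite /s divr_gt0// mulr_gt0.
have sr : s * (8 * r) <= t / 3.
  by rewrite /s le_eqVlt; apply/orP; left; apply/eqP; field; rewrite gt_eqF.
have far : C2 * r `^ (- (2 / q)) <= t / 3.
  rewrite /r powRM ?powR_ge0 ?(ltW B0)// /B -!powRrM.
  have -> : q / 2 * - (2 / q) = -1 by field; rewrite gt_eqF//; lra.
  have -> : - (q / 2) * - (2 / q) = 1 by field; rewrite gt_eqF//; lra.
  rewrite powRr1 ?(ltW t0)// powR_inv1 ?mulr_ge0 ?(ltW C20)//.
  by rewrite le_eqVlt; apply/orP; left; apply/eqP; field; rewrite gt_eqF.
have c0 : (0 <= (q * t `^ (q - 1))%:E)%E by rewrite lee_fin mulr_ge0 ?powR_ge0//; lra.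
have := hls_superlevel p1 p2 qE erefl erefl mf f0 f1 r0 t0 (ltW s0) sr far.
move=> /(lee_wpmul2l c0) /le_trans; apply.
rewrite [X in (_ <= _ * X)%E](_ : _ = K%:E * \int[mu]_(y in [set y | (t%:E < h y)%E]) (f y)%:E)%E; last first.
  under eq_integral do rewrite EFinM.
  rewrite ge0_integralZl_EFin ?(ltW K0)//.
    by move=> y _; rewrite lee_fin.
  by apply: measurable_funTS; exact/measurable_EFinP.
rewrite !muleA -!EFinM.
have -> : q * t `^ (q - 1) * (24 * r / t) = a * t `^ (a - 1) * K.
  have -> : a - 1 = (q - 1) + (- (q / 2) + - 1) by rewrite /a; lra.
  have ti : t != 0 by rewrite gt_eqF.
  rewrite (@powRD _ t (q - 1)) ?ti ?implybT// (@powRD _ t (- (q / 2))) ?ti ?implybT//.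
  rewrite powR_inv1 ?(ltW t0)// /r /K; field; rewrite ti gt_eqF//.
apply: lee_wpmul2l; first by rewrite lee_fin mulr_ge0 ?(ltW K0)// mulr_ge0 ?powR_ge0 ?(ltW a0).
(* Since [s = t ^ g / (24 * B)], the condition [s < f y] amounts to [t < h y]. *)
apply: ge0_subset_integral => //.
- rewrite (_ : [set y | s < f y] = f @^-1` `]s, +oo[%classic).
    by rewrite -[X in measurable X]setTI; exact: mf.
  by apply/seteqP; split => y; rewrite /= in_itv/= andbT.
- by apply: measurable_funTS; exact/measurable_EFinP.
- by move=> y _; rewrite lee_fin.
move=> y/= sf; rewrite lte_fin.
have tE : t = (t `^ g) `^ g^-1 by rewrite -powRrM mulfV ?gt_eqF// powRr1// ltW.
rewrite [ltLHS]tE; apply: gt0_ltr_powR; rewrite ?invr_gt0 ?nnegrE ?powR_ge0//.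
  by rewrite mulr_ge0// mulr_ge0// ltW.
move: sf; rewrite /s ltr_pdivrMr; last by rewrite mulr_gt0.
move=> tr; have tq : 0 < t `^ (q / 2) by rewrite powR_gt0.
have -> : t `^ g = t * t `^ (q / 2).
  rewrite /g powRD ?powRr1 ?(ltW t0)//; apply/implyP => _; exact: lt0r_neq0.
have -> : 24 * B * f y = f y * (24 * r) * t `^ (q / 2).
  by rewrite /r powRN; field; rewrite gt_eqF.
by rewrite ltr_pM2r.
Qed.

(** Homogeneity: the normalized case applied to [f / B]. *)
Lemma hls (p q : R) : 1 < p -> p < 2 -> q = 2 * p / (2 - p) ->
  exists2 C : R, 0 <= C & forall (f : T -> R) (B : R), 0 < B ->
    measurable_fun setT f -> (forall z, 0 <= f z) ->
    (\int[mu]_y ((f y) `^ p)%:E <= (B `^ p)%:E)%E ->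
    (\int[mu]_x (riesz f x `^ q) <= (C * B `^ q)%:E)%E.
Proof.
move=> p1 p2 qE; have [C C0 H] := hls_normalized p1 p2 qE.
have q2 : 2 < q by rewrite qE ltr_pdivlMr; lra.
exists C => // f B B0 mf f0 fB.
have Bi0 : 0 <= B^-1 by rewrite invr_ge0 ltW.
have mf' : measurable_fun setT (fun y => B^-1 * f y) by exact: measurable_funM.
have f'0 y : 0 <= B^-1 * f y by rewrite mulr_ge0.
have mfp : measurable_fun setT (fun y : T => (f y `^ p)%:E).
  by apply/measurable_EFinP/(measurableT_comp (@measurable_powR R p)).
have f'1 : (\int[mu]_y ((B^-1 * f y) `^ p)%:E <= 1)%E.
  under eq_integral do rewrite powRM// EFinM.
  rewrite ge0_integralZl_EFin ?powR_ge0//; last by move=> y _; rewrite lee_fin powR_ge0.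
  apply: (@le_trans _ _ ((B^-1 `^ p)%:E * (B `^ p)%:E)%E).
    by apply: lee_wpmul2l => //; rewrite lee_fin powR_ge0.
  by rewrite -EFinM -powRM// ?(ltW B0)// mulVf ?gt_eqF// powR1.
have rE x : riesz f x = (B%:E * riesz (fun y => B^-1 * f y)%R x)%E.
  rewrite /riesz -ge0_integralZl_EFin ?(ltW B0)//; last 2 first.
  - by move=> y _; rewrite lee_fin mulr_ge0 ?rk_ge0.
  - by apply/measurable_EFinP; apply: measurable_convol1 => //; exact: measurable_rk.
  by apply: eq_integral => y _; rewrite -EFinM; congr EFin; field; rewrite gt_eqF.
under eq_integral do rewrite rE poweRM ?lee_fin ?(ltW B0)// ?riesz_ge0// poweR_EFin.
rewrite ge0_integralZl_EFin ?powR_ge0//; last 2 first.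
- by move=> x _; rewrite poweR_ge0.
- exact: (measurableT_comp (measurable_poweR q) (measurable_riesz mf' f'0)).
rewrite mulrC EFinM; apply: lee_wpmul2l; first by rewrite lee_fin powR_ge0.
exact: H.
Qed.

End HLS_inequality.

(** * Smooth functions of two variables *)

Section smooth_calculus.
Context {R : realType}.
Implicit Types (f g : R * R -> R) (i : bool).

(** Moving one coordinate reduces partial derivatives to one variable, where the mean value theorem
    and the fundamental theorem of calculus apply. *)
Definition ins i (x : R * R) (t : R) : R * R := if i then (x.1, t) else (t, x.2).
Definition pcoord i (x : R * R) : R := if i then x.2 else x.1.

Lemma ins_pcoord i x : ins i x (pcoord i x) = x.
Proof. by case: i x => -[]. Qed.

Lemma diffquot_ins i f x :
  (fun h : R => h^-1 *: ((f \o shift x) (h *: basis_vec R i) - f x)) =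
  (fun h : R => h^-1 *: (((fun t => f (ins i x t)) \o shift (pcoord i x)) (h *: (1 : R)) - (fun t => f (ins i x t)) (pcoord i x))).
Proof.
apply/funext => h /=; rewrite ins_pcoord; congr (_ *: (f _ - _)).
by case: i x => -[x1 x2]; apply: injective_projections; rewrite /= ?scaler0 ?add0r.
Qed.

Lemma derivable_ins i f x : derivable f x (basis_vec R i) <->
  derivable (fun t => f (ins i x t)) (pcoord i x) 1.
Proof. by rewrite /derivable diffquot_ins. Qed.

Lemma partial_ins i f x : partial i f x = derive1 (fun t => f (ins i x t)) (pcoord i x).
Proof. by rewrite derive1E /partial /derive diffquot_ins. Qed.

Lemma ins_ins i x s t : ins i (ins i x s) t = ins i x t.
Proof. by case: i. Qed.

Lemma pcoord_ins i x t : pcoord i (ins i x t) = t.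
Proof. by case: i. Qed.

Lemma is_derive_ins i f x t : derivable f (ins i x t) (basis_vec R i) ->
  is_derive t 1 (fun s => f (ins i x s)) (partial i f (ins i x t)).
Proof.
move=> /derivable_ins; rewrite pcoord_ins => df.
have E : (fun s => f (ins i (ins i x t) s)) = (fun s => f (ins i x s)).
  by apply/funext => s; rewrite ins_ins.
rewrite E in df; apply: DeriveDef => //.
by rewrite partial_ins pcoord_ins E derive1E.
Qed.

Lemma continuous_pair {U : topologicalType} (f g : U -> R) :
  continuous f -> continuous g -> continuous (fun t => (f t, g t)).
Proof. by move=> cf cg t; exact: (cvg_pair (cf t) (cg t)). Qed.

Lemma continuous_ins i x : continuous (ins i x).
Proof.
case: i; rewrite /ins; apply: continuous_pair => t;
  by [exact: cvg_cst|exact: cvg_id].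
Qed.

Lemma smooth_continuous f : smooth f -> continuous f.
Proof. by move=> /(_ [::])[]. Qed.

Lemma smooth_derivable f x i : smooth f -> derivable f x (basis_vec R i).
Proof. by move=> /(_ [::])[_]; exact. Qed.

Lemma smooth_partial i f : smooth f -> smooth (partial i f).
Proof. by move=> sf s; have := sf (rcons s i); rewrite foldr_rcons. Qed.

(** A coinduction principle: it replaces the quantification over all sequences of derivatives by an
    invariant stable under a single derivative. *)
Lemma smooth_coind (P : (R * R -> R) -> Prop) :
  (forall f, P f -> [/\ continuous f, forall x i, derivable f x (basis_vec R i) &
     forall i, P (partial i f)]) ->
  forall f, P f -> smooth f.
Proof.
move=> H f Pf s; elim/last_ind: s f Pf => [|s i IH] f Pf; first by have [] := H f Pf.
by rewrite foldr_rcons; apply: IH; have [] := H f Pf.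
Qed.

Lemma partialD i f g x : derivable f x (basis_vec R i) -> derivable g x (basis_vec R i) ->
  partial i (fun y => f y + g y) x = partial i f x + partial i g x.
Proof. by move=> df dg; rewrite /partial (deriveD df dg). Qed.

Lemma partialM i f g x : derivable f x (basis_vec R i) -> derivable g x (basis_vec R i) ->
  partial i (fun y => f y * g y) x = f x * partial i g x + g x * partial i f x.
Proof. by move=> df dg; rewrite /partial (deriveM df dg). Qed.

Lemma partial_cst i (c : R) x : partial i (fun=> c) x = 0.
Proof. by rewrite /partial derive_cst. Qed.

(** The Leibniz and chain rules produce sums of products, so invariants are only asked to be stable
    up to these operations. *)
Inductive alg_closure (P : (R * R -> R) -> Prop) : (R * R -> R) -> Prop :=
| alg_base f : P f -> alg_closure P f
| alg_add f g : alg_closure P f -> alg_closure P g -> alg_closure P (fun x => f x + g x)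
| alg_mul f g : alg_closure P f -> alg_closure P g -> alg_closure P (fun x => f x * g x).

Lemma smooth_coind_alg (P : (R * R -> R) -> Prop) :
  (forall f, P f -> [/\ continuous f, forall x i, derivable f x (basis_vec R i) &
     forall i, alg_closure P (partial i f)]) ->
  forall f, alg_closure P f -> smooth f.
Proof.
move=> H; apply: smooth_coind => f; elim => {f}
  [f Pf|f g af [cf df pf] ag [cg dg pg]|f g af [cf df pf] ag [cg dg pg]].
- exact: H.
- split.
  + by move=> x; apply: cvgD; [exact: cf|exact: cg].
  + by move=> x i; exact: derivableD.
  + move=> i; rewrite (_ : partial i _ = fun x => partial i f x + partial i g x).
      exact: alg_add.
    by apply/funext => x; exact: partialD.
- split.
  + by move=> x; apply: cvgM; [exact: cf|exact: cg].
  + by move=> x i; exact: derivableM.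
  + move=> i; rewrite (_ : partial i _ = fun x => f x * partial i g x + g x * partial i f x).
      by apply: alg_add; exact: alg_mul.
    by apply/funext => x; exact: partialM.
Qed.

Lemma smooth_alg_closure f : alg_closure (@smooth R) f -> smooth f.
Proof.
apply: smooth_coind_alg => {}f sf; split; [exact: smooth_continuous|by move=> x i; exact: smooth_derivable|].
by move=> i; apply/alg_base/smooth_partial.
Qed.

Lemma smooth_cst (c : R) : smooth (fun=> c : R).
Proof.
apply: (@smooth_coind (fun f => exists c, f = fun=> c)); last by exists c.
move=> _ [d ->]; split.
- by move=> x; exact: cvg_cst.
- by move=> x i; exact: derivable_cst.
- by move=> i; exists 0; apply/funext => x; exact: partial_cst.
Qed.

Lemma smoothD f g : smooth f -> smooth g -> smooth (fun x => f x + g x).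
Proof. by move=> sf sg; apply/smooth_alg_closure/alg_add; exact: alg_base. Qed.

Lemma smoothM f g : smooth f -> smooth g -> smooth (fun x => f x * g x).
Proof. by move=> sf sg; apply/smooth_alg_closure/alg_mul; exact: alg_base. Qed.

(** One chain rule for this diagonal affine map covers translations, reflections and dilations. *)
Definition scale2 (a b : R * R) (x : R * R) : R * R := (a.1 * x.1 + b.1, a.2 * x.2 + b.2).

Lemma continuous_scale2 a b : continuous (scale2 a b).
Proof.
apply: continuous_pair => x; apply: cvgD; try exact: cvg_cst.
  by apply: cvgM; [exact: cvg_cst|exact: cvg_fst].
by apply: cvgM; [exact: cvg_cst|exact: cvg_snd].
Qed.

Lemma is_derive_affine (a b t : R) : is_derive t 1 (fun s : R => a * s + b) a.
Proof.
rewrite (_ : (fun s : R => a * s + b) = (a \*: (id : R -> R)) + cst b); last exact/funext.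
by apply: is_derive_eq; rewrite /GRing.scale/= mulr1 addr0.
Qed.

Lemma is_derive_scale2 i f a b x : derivable f (scale2 a b x) (basis_vec R i) ->
  is_derive (pcoord i x) 1 (fun t => f (scale2 a b (ins i x t))) (pcoord i a * partial i f (scale2 a b x)).
Proof.
move=> df.
have E : (fun t => f (scale2 a b (ins i x t))) =
    (fun s => f (ins i (scale2 a b x) s)) \o (fun s => pcoord i a * s + pcoord i b).
  by apply/funext => t; case: {df} i.
rewrite E mulrC; apply: is_derive1_comp; last exact: is_derive_affine.
have E2 : scale2 a b x = ins i (scale2 a b x) (pcoord i a * pcoord i x + pcoord i b).
  by case: {df E} i.
by rewrite [in partial _ _ _]E2; apply: is_derive_ins; rewrite -E2.
Qed.

Lemma derivable_scale2 i f a b x : derivable f (scale2 a b x) (basis_vec R i) ->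
  derivable (f \o scale2 a b) x (basis_vec R i).
Proof. by move=> /is_derive_scale2 H; apply/derivable_ins; case: H. Qed.

Lemma partial_scale2 i f a b x : derivable f (scale2 a b x) (basis_vec R i) ->
  partial i (f \o scale2 a b) x = pcoord i a * partial i f (scale2 a b x).
Proof. by move=> /is_derive_scale2 H; rewrite partial_ins derive1E; case: H. Qed.

Lemma smooth_scale2 f a b : smooth f -> smooth (f \o scale2 a b).
Proof.
move=> sf; apply: (@smooth_coind (fun h => exists c g, smooth g /\ h = fun x => c * g (scale2 a b x))).
  move=> _ [c [g [sg ->]]].
  have dg x i : derivable (g \o scale2 a b) x (basis_vec R i).
    by apply: derivable_scale2; exact: smooth_derivable.
  split.
  - move=> x; apply: cvgM; first exact: cvg_cst.
    by apply: (@continuous_comp _ _ _ (scale2 a b) g); [exact: continuous_scale2|exact: smooth_continuous].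
  - by move=> x i; apply: derivableM => //; exact: derivable_cst.
  - move=> i; exists (c * pcoord i a), (partial i g); split; first exact: smooth_partial.
    apply/funext => x; rewrite (partialM (f := fun=> c) (g := g \o scale2 a b))//.
    by rewrite partial_cst mulr0 addr0 partial_scale2 ?mulrA//; exact: smooth_derivable.
exists 1, f; split => //; apply/funext => x; by rewrite mul1r.
Qed.

Lemma smooth_mvt i f x a b : smooth f -> a < b ->
  exists2 c, a < c < b & f (ins i x b) - f (ins i x a) = (b - a) * partial i f (ins i x c).
Proof.
move=> sf ab; have dF (t : R) : is_derive t 1 (fun t => f (ins i x t)) (partial i f (ins i x t)).
  by apply: is_derive_ins; exact: smooth_derivable.
have [//||c] := @MVT R (fun t => f (ins i x t)) (fun t => partial i f (ins i x t)) a b.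
  apply: continuous_subspaceT => t.
  by apply: (@continuous_comp _ _ _ (ins i x) f); [exact: continuous_ins|exact: smooth_continuous].
by rewrite in_itv/= => acb E; exists c => //; rewrite E mulrC.
Qed.

Lemma insC i x s t : ins i (ins (~~ i) x s) t = ins (~~ i) (ins i x t) s.
Proof. by case: i. Qed.

(** The mean value theorem in direction [i], then in the other one. The left side is the same for
    both values of [i]; letting [e] tend to 0 gives the symmetry of mixed derivatives in
    [partialC]. *)
Lemma second_difference i f x e : smooth f -> 0 < e ->
  exists2 y, `|x - y| < e &
    f (x.1 + e, x.2 + e) - f (x.1 + e, x.2) - f (x.1, x.2 + e) + f x =
    e * e * partial (~~ i) (partial i f) y.
Proof.
move=> sf e0; pose a := pcoord i x; pose b := pcoord (~~ i) x.
pose G t := f (ins i (ins (~~ i) x (b + e)) t) - f (ins i x t).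
have dG (t : R) : is_derive t 1 G (partial i f (ins i (ins (~~ i) x (b + e)) t) - partial i f (ins i x t)).
  by apply: is_deriveB; apply: is_derive_ins; exact: smooth_derivable.
have ae : a < a + e by rewrite ltrDl.
have [|c] := @MVT R G _ a (a + e) ae (fun t _ => dG t).
  apply: continuous_subspaceT => t; apply/differentiable_continuous/derivable1_diffP.
  by have [] := dG t.
rewrite in_itv/= => /andP[ac ca] E.
have be : b < b + e by rewrite ltrDl.
have [d /andP[bd db] E2] := smooth_mvt (~~ i) (ins i x c) (smooth_partial i sf) be.
exists (ins (~~ i) (ins i x c) d).
  rewrite normr2E gt_max; move: ac ca bd db; rewrite /a /b.
  by case: i {G dG ae E be E2 a b} => /= h1 h2 h3 h4; rewrite !ltr_norml; apply/andP; split; apply/andP; split; lra.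
transitivity (G (a + e) - G a).
  rewrite /G /a /b; case: i {G dG ae ac ca E be bd db E2 a b} => /=; rewrite -!surjective_pairing; ring.
rewrite E insC.
have Eb : ins (~~ i) (ins i x c) b = ins i x c by rewrite -insC /b ins_pcoord.
rewrite Eb in E2; rewrite E2; ring.
Qed.

Lemma partialC i j f x : smooth f -> partial i (partial j f) x = partial j (partial i f) x.
Proof.
move=> sf; have H : partial true (partial false f) x = partial false (partial true f) x.
  pose g := partial true (partial false f); pose h := partial false (partial true f).
  have cg : continuous g by apply/smooth_continuous/smooth_partial/smooth_partial.
  have ch : continuous h by apply/smooth_continuous/smooth_partial/smooth_partial.
  apply/eqP; rewrite -subr_eq0 -normr_le0; apply/ler_addgt0Pl => e e0; rewrite addr0.
  have e20 : 0 < e / 2 by rewrite divr_gt0.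
  have /cvgrPdist_lt/(_ _ e20)/nbhs_ballP[r1 /= r10 Hg] := cg x.
  have /cvgrPdist_lt/(_ _ e20)/nbhs_ballP[r2 /= r20 Hh] := ch x.
  pose r := Num.min r1 r2; have r0 : 0 < r by rewrite lt_min r10.
  have [y ry Ey] := second_difference false x sf r0.
  have [z rz Ez] := second_difference true x sf r0.
  have yz : g y = h z.
    by move: Ez; rewrite Ey => /(mulfI (lt0r_neq0 (mulr_gt0 r0 r0))).
  have -> : partial true (partial false f) x - partial false (partial true f) x = (g x - g y) - (h x - h z).
    by rewrite yz opprB addrA subrK.
  apply: (le_trans (ler_normB _ _)); rewrite [e]splitr; apply: lerD; apply: ltW.
    apply: Hg; rewrite -ball_normE /ball_/=; apply: (lt_le_trans ry); by rewrite ge_min lexx.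
  apply: Hh; rewrite -ball_normE /ball_/=; apply: (lt_le_trans rz); by rewrite ge_min lexx orbT.
case: i; case: j; [reflexivity|exact: H|exact: esym H|reflexivity].
Qed.

End smooth_calculus.

(** * Flat functions and one-dimensional cutoffs *)

Section flat_function.
Context {R : realType}.

(* The family is closed under differentiation, see [is_derive_flat]. *)
Definition flat (n : nat) (x : R) : R := if 0 < x then x^-1 ^+ n * expR (- x^-1) else 0.

Lemma flat_le0 n x : x <= 0 -> flat n x = 0.
Proof. by rewrite /flat leNgt => /negbTE->. Qed.

Lemma flat_ge0 n x : 0 <= flat n x.
Proof.
by rewrite /flat; case: ifP => // x0; rewrite mulr_ge0 ?expR_ge0// exprn_ge0// invr_ge0 ltW.
Qed.

Lemma flat0_le1 x : flat 0 x <= 1.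
Proof.
rewrite /flat; case: ifP => // x0; rewrite mul1r -expR0 ler_expR oppr_le0 invr_ge0; exact: ltW.
Qed.

(** With [y = x^-1] and [k = n + 2], the inequality [expR y >= (y / k) ^ k] beats [y ^ n] by two
    powers. A quadratic bound is what makes the derivative at 0 vanish. *)
Lemma flat_bound n x : `|flat n x| <= (n.+2%:R ^+ n.+2) * x ^+ 2.
Proof.
rewrite ger0_norm ?flat_ge0// /flat; case: ifP => [x0|_]; last first.
  by apply: mulr_ge0; [rewrite exprn_ge0|exact: sqr_ge0].
have m0 : 0 < n.+2%:R :> R by rewrite ltr0Sn.
set y := x^-1; have y0 : 0 < y by rewrite invr_gt0.
have H : (y / n.+2%:R) ^+ n.+2 <= expR y.
  have -> : expR y = expR (y / n.+2%:R) ^+ n.+2.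
    by rewrite -expRM_natl mulrCA mulfV ?gt_eqF// mulr1.
  apply: lerXn2r; rewrite ?nnegrE ?expR_ge0 ?divr_ge0 ?(ltW y0)//.
  by apply: le_trans (expR_ge1Dx _); rewrite lerDr.
have xE : x = y^-1 by rewrite invrK.
rewrite expRN xE ler_pdivrMr ?expR_gt0//.
have -> : y ^+ n = n.+2%:R ^+ n.+2 * y^-1 ^+ 2 * (y / n.+2%:R) ^+ n.+2.
  by rewrite expr_div_n -addn2 !exprD exprVn; field; rewrite !gt_eqF// ?exprn_gt0// addn2.
by apply: ler_wpM2l => //; apply: mulr_ge0; [rewrite exprn_ge0|exact: sqr_ge0].
Qed.

Lemma is_derive_flat n (x : R) : is_derive x 1 (flat n) (- n%:R * flat n.+1 x + flat n.+2 x).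
Proof.
have [x0|x0|->] := ltgtP x 0.
- rewrite !flat_le0 ?(ltW x0)// mulr0 addr0.
  apply: (near_eq_is_derive _ (is_derive_cst (0 : R) x 1)).
  near=> t; rewrite flat_le0//; apply: ltW; near: t.
  exact: lt_nbhsl.
- apply: (near_eq_is_derive (f := (fun t : R => t^-1) ^+ n * (expR \o (fun t => - t^-1)))).
    near=> t; have t0 : 0 < t by near: t; exact: lt_nbhsr.
    by rewrite /flat t0 mulrfctE exprfctE.
  have dV : is_derive x 1 (fun t : R => t^-1) (- x ^- 2).
    apply: is_derive_eq; first by apply: (is_deriveV (f := id)); rewrite gt_eqF.
    by rewrite /GRing.scale/= mulr1.
  have dE : is_derive x 1 (expR \o (fun t => - t^-1)) (expR (- x^-1) * x ^- 2).
    have dN : is_derive x 1 (- (fun t : R => t^-1)) (x ^- 2).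
      by rewrite -[x ^- 2]opprK; exact: (is_deriveN dV).
    exact: (is_derive1_comp (is_derive_expR _) dN).
  apply: (is_derive_eq (is_deriveM (is_deriveX n dV) dE)).
  rewrite /flat x0 /GRing.scale/= ?exprfctE /=; case: n => [|n].
    by rewrite -!exprVn; ring.
  by rewrite /= -!exprVn !exprS; ring.
rewrite !flat_le0// mulr0 addr0; apply/is_derive1_caratheodory.
exists (fun z => flat n z / z); split; last by rewrite invr0 mulr0.
  move=> z; rewrite (flat_le0 n (lexx 0)) !subr0.
  have [->|z0] := eqVneq z 0; first by rewrite mulr0 flat_le0.
  by rewrite divfK.
apply/cvgrPdist_lt => e e0 /=.
pose M : R := n.+2%:R ^+ n.+2; have M0 : 0 < M by rewrite exprn_gt0// ltr0Sn.
near=> z; rewrite invr0 mulr0 sub0r normrN normrM.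
have [->|z0] := eqVneq z 0; first by rewrite invr0 normr0 mulr0.
apply: (@le_lt_trans _ _ (M * `|z|)).
  rewrite normfV ler_pdivrMr ?normr_gt0//; apply: (le_trans (flat_bound n z)).
  by rewrite -[X in _ * X <= _](real_normK (num_real z)) expr2 mulrA.
rewrite mulrC -ltr_pdivlMr//.
have : `|0 - z| < e / M; last by rewrite sub0r normrN.
near: z; apply/nbhs_ballP; exists (e / M); first by rewrite /= divr_gt0.
by move=> t.
Unshelve. all: end_near. Qed.

Lemma continuous_flat n : continuous (flat n).
Proof.
move=> x; apply/differentiable_continuous/derivable1_diffP.
by case: (is_derive_flat n x).
Qed.

Lemma smooth_flat_coord n i : smooth (fun x : R * R => flat n (pcoord i x)).
Proof.
pose P (f : R * R -> R) := (exists c, f = fun=> c) \/ exists n, f = fun x => flat n (pcoord i x).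
apply: (@smooth_coind_alg _ P); last by apply: alg_base; right; exists n.
move=> f [[c ->]|[m ->]].
  split; first by move=> x; exact: cvg_cst.
    by move=> x j; exact: derivable_cst.
  move=> j; apply: alg_base; left; exists 0.
  by apply/funext => x; exact: partial_cst.
have E j x : (fun t => flat m (pcoord i (ins j x t))) =
    if i == j then flat m else cst (flat m (pcoord i x)).
  by apply/funext => t; case: i j {P} => -[].
have D j x : is_derive (pcoord j x) 1 (fun t => flat m (pcoord i (ins j x t)))
   (if i == j then - m%:R * flat m.+1 (pcoord i x) + flat m.+2 (pcoord i x) else 0).
  rewrite E; case: eqP => [->|_]; first exact: is_derive_flat.
  exact: is_derive_cst.
split.
- move=> x; apply: (@continuous_comp _ _ _ (pcoord i) (flat m)); last exact: continuous_flat.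
  by case: {P E D} i; [exact: cvg_snd|exact: cvg_fst].
- by move=> x j; apply/derivable_ins; case: (D j x).
- move=> j; have -> : partial j (fun x => flat m (pcoord i x)) = fun x =>
     if i == j then - m%:R * flat m.+1 (pcoord i x) + flat m.+2 (pcoord i x) else 0.
    by apply/funext => x; rewrite partial_ins derive1E; case: (D j x).
  case: (i == j); last by apply: alg_base; left; exists 0.
  apply: (@alg_add _ _ (fun x => - m%:R * flat m.+1 (pcoord i x))); last by apply: alg_base; right; exists m.+2.
  apply: (@alg_mul _ _ (fun=> - m%:R)); apply: alg_base; first by left; exists (- m%:R).
  by right; exists m.+1.
Qed.

Lemma smooth_flat_affine n i (a b : R) : smooth (fun x : R * R => flat n (a * pcoord i x + b)).
Proof.
have := smooth_scale2 (a, a) (b, b) (smooth_flat_coord n i).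
by congr smooth; apply/funext => x; case: i.
Qed.

(* Normalised so that [cutoff 0 = 1]. *)
Definition cutoff (x : R) : R := expR 2 * (flat 0 (1 - x) * flat 0 (1 + x)).

Lemma cutoff0 : cutoff 0 = 1.
Proof.
rewrite /cutoff subr0 addr0 /flat ltr01 !expr0 !mul1r invr1 -!expRD -expR0.
by congr expR; lra.
Qed.

Lemma cutoff_ge0 x : 0 <= cutoff x.
Proof. by rewrite mulr_ge0 ?expR_ge0// mulr_ge0// flat_ge0. Qed.

Lemma cutoff_out x : 1 <= `|x| -> cutoff x = 0.
Proof.
rewrite ler_normr /cutoff => /orP[x1|x1].
  by rewrite flat_le0 ?mul0r ?mulr0//; lra.
by rewrite (@flat_le0 0 (1 + x)) ?mulr0//; lra.
Qed.

Lemma continuous_cutoff : continuous cutoff.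
Proof.
move=> x; apply: cvgM; first exact: cvg_cst.
apply: cvgM.
  apply: (@continuous_comp _ _ _ (fun t : R => 1 - t) (flat 0)); last exact: continuous_flat.
  by apply: cvgB; [exact: cvg_cst|exact: cvg_id].
apply: (@continuous_comp _ _ _ (fun t : R => 1 + t) (flat 0)); last exact: continuous_flat.
by apply: cvgD; [exact: cvg_cst|exact: cvg_id].
Qed.

Lemma smooth_cutoff_affine i (a b : R) : smooth (fun x : R * R => cutoff (a * pcoord i x + b)).
Proof.
apply: smoothM; first exact: smooth_cst.
have H1 := smooth_flat_affine 0 i (- a) (1 - b).
have H2 := smooth_flat_affine 0 i a (1 + b).
have := smoothM H1 H2; congr smooth; apply/funext => x.
by congr (flat 0 _ * flat 0 _); ring.
Qed.

End flat_function.

(** * Test functions and their derivatives *)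

Section test_functions.
Context {R : realType}.
Implicit Types (Omega : set (R * R)) (phi f g : R * R -> R).

Lemma hausdorff2 : hausdorff_space (R * R)%type.
Proof. exact: norm_hausdorff. Qed.

Lemma test_intro Omega (K : set (R * R)) phi : smooth phi -> compact K -> K `<=` Omega ->
  (forall x, ~ K x -> phi x = 0) -> test_function Omega phi.
Proof.
move=> sphi cK KO phiK.
have S : closure [set x | phi x != 0] `<=` K.
  have cl := compact_closed hausdorff2 cK.
  rewrite [X in _ `<=` X](closure_id _).1//; apply: closure_subset => x /= /eqP px.
  by apply: contrapT => /phiK.
split => //.
- by apply: subclosed_compact cK S; exact: closed_closure.
- exact: subset_trans KO.
Qed.

Lemma test_smooth Omega phi : test_function Omega phi -> smooth phi.
Proof. by case. Qed.

Lemma test_out Omega phi x : test_function Omega phi -> ~ Omega x -> phi x = 0.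
Proof.
case=> _ _ KO nO; apply/eqP; apply: contrapT => /negP p0.
by apply/nO/KO/subset_closure.
Qed.

Lemma test_sub Omega Omega' phi : Omega `<=` Omega' -> test_function Omega phi -> test_function Omega' phi.
Proof. by move=> OO [s c K]; split => //; exact: subset_trans OO. Qed.

Lemma compact_box (a b c d : R) : compact (`[a, b]%classic `*` `[c, d]%classic : set (R * R)).
Proof. by apply: compact_setX; exact: segment_compact. Qed.

Lemma compact_bound (K : set (R * R)) : compact K -> exists2 M, 0 < M & forall x, K x -> `|x| < M.
Proof.
move=> /compact_bounded[M [Mr HM]]; exists (Num.max 1 (M + 1) + 1); first by rewrite ltr_wpDl// le_max ler01.
move=> x Kx; apply: (le_lt_trans (HM (Num.max 1 (M + 1)) _ x Kx)); last by rewrite ltrDl.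
by rewrite lt_max ltrDl ltr01 orbT.
Qed.

Lemma test_bound Omega phi : test_function Omega phi ->
  exists2 M, 0 < M & (forall x, `|phi x| <= M) /\ (forall x, M <= `|x| -> phi x = 0).
Proof.
move=> [sphi cK _]; have [M1 M10 H1] := compact_bound cK.
have cphi := smooth_continuous sphi.
have := @continuous_compact _ _ phi _ (continuous_subspaceT cphi) cK.
move=> /compact_bounded[M2 [_ H2]].
pose M := Num.max M1 (M2 + 1); exists M; first by rewrite lt_max M10.
have out x : ~ closure [set x | phi x != 0] x -> phi x = 0.
  by move=> nx; apply/eqP; apply: contrapT => /negP p0; apply/nx/subset_closure.
split => x.
  have [Kx|nKx] := pselect (closure [set x | phi x != 0] x).
    by apply: H2; [rewrite lt_max ltrDl ltr01 orbT|exists x].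
  by rewrite out// normr0 le_max ltW.
move=> Mx; apply: out => /H1; apply/negP; rewrite -leNgt; apply: le_trans Mx.
by rewrite le_max lexx.
Qed.

Lemma test_intro_bound phi M : smooth phi -> (forall x, M <= `|x| -> phi x = 0) -> test_function setT phi.
Proof.
move=> sphi H; apply: (test_intro sphi (@compact_box (- M) M (- M) M)) => // x nx.
apply: H; rewrite leNgt; apply/negP => xM; apply: nx.
move: xM; rewrite normr2E gt_max !ltr_norml => /andP[/andP[? ?] /andP[? ?]].
by split; rewrite /= in_itv/= !ltW.
Qed.

Lemma closure_near (A : set (R * R)) x : ~ closure A x -> \forall y \near x, ~ A y.
Proof.
move=> nA; apply: contrapT => H; apply: nA => B Bx; apply: contrapT => nAB; apply: H.
by apply: filterS Bx => y By Ay; apply: nAB; exists y.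
Qed.

Lemma partial_near i f g x : (\forall y \near x, f y = g y) -> partial i f x = partial i g x.
Proof.
by move=> fg; exact: near_eq_derive.
Qed.

Lemma test_partial Omega i phi : test_function Omega phi -> test_function Omega (partial i phi).
Proof.
move=> [sphi cK KO]; apply: (test_intro (smooth_partial i sphi) cK KO) => x /closure_near nx.
rewrite (partial_near i (g := fun=> 0)) ?partial_cst//.
by apply: filterS nx => y /=; move/negP; rewrite negbK => /eqP.
Qed.

Lemma test_mulr Omega g phi : smooth g -> test_function Omega phi -> test_function Omega (fun x => g x * phi x).
Proof.
move=> sg [sphi cK KO]; apply: (test_intro _ cK KO); first exact: smoothM.
move=> x nx; have -> : phi x = 0; last by rewrite mulr0.
by apply/eqP; apply: contrapT => /negP p0; apply/nx/subset_closure.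
Qed.

Lemma test_multi_partial Omega a b phi : test_function Omega phi ->
  test_function Omega (multi_partial a b phi).
Proof.
move=> t; rewrite /multi_partial; elim: a => [|a IH]; last exact: test_partial.
by elim: b => [|b IH]; [exact: t|exact: test_partial].
Qed.

Lemma smooth_iter_partial i n phi : smooth phi -> smooth (iter n (partial i) phi).
Proof. by move=> sp; elim: n => [|n IH]; [exact: sp|exact: smooth_partial]. Qed.

Lemma multi_partial_S2 a b phi : smooth phi ->
  multi_partial a b.+1 phi = partial true (multi_partial a b phi).
Proof.
move=> sphi; rewrite /multi_partial /=.
move: (smooth_iter_partial true b sphi); move: (iter b _ _) => {sphi}psi spsi.
elim: a => [//|a IH]; rewrite !iterS IH.
by apply/funext => x; apply: partialC; exact: smooth_iter_partial.
Qed.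

Lemma multi_partial_S1 a b phi :
  multi_partial a.+1 b phi = partial false (multi_partial a b phi).
Proof. by []. Qed.

Lemma multi_partial_in1 a b phi : smooth phi ->
  multi_partial a b (partial false phi) = multi_partial a.+1 b phi.
Proof.
move=> sphi; rewrite /multi_partial iterSr; congr iter.
elim: b => [//|b IH]; rewrite !iterS IH.
by apply/funext => x; apply: partialC; exact: smooth_iter_partial.
Qed.

Lemma multi_partial_in2 a b phi :
  multi_partial a b (partial true phi) = multi_partial a b.+1 phi.
Proof. by rewrite /multi_partial iterSr. Qed.

(** The height attains its minimum on the compact support, and that minimum is positive because the
    support lies in the open half-plane. *)
Lemma test_halfplane_gap phi : test_function (@halfplane R) phi ->
  exists2 c, 0 < c & forall x, x.2 < c -> phi x = 0.
Proof.
move=> [sphi cK KO].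
set K := closure _ in cK KO.
have [K0'|K0] := pselect (K !=set0); last first.
  exists 1 => // x _; apply/eqP; apply: contrapT => /negP p0; apply: K0; exists x.
  exact: subset_closure.
have cf : {within K, continuous (fun x : R * R => x.2)}.
  by apply: continuous_subspaceT => x; exact: cvg_snd.
have [c /set_mem Kc Hc] := compact_EVT_min K0' cK cf.
exists c.2; first exact: KO.
move=> x xc; apply/eqP; apply: contrapT => /negP p0.
have : c.2 <= x.2 by apply: Hc; rewrite inE; exact: subset_closure.
by rewrite leNgt xc.
Qed.

End test_functions.

(** * Correlation of a kernel with a test function *)

Section correlation.
Context {R : realType}.
Local Notation mR := (measurableTypeR R).
Local Notation T := (mR * mR)%type.
Local Notation mu := (@leb2 R).
Implicit Types (k : T -> R) (psi : R * R -> R).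

Lemma near_rk_integrable (r : R) : 0 < r -> mu.-integrable setT (EFin \o (near_rk r : T -> R)).
Proof.
move=> r0; apply/integrableP; split; first by apply/measurable_EFinP; exact: measurable_near_rk.
apply: (@le_lt_trans _ _ (8 * r)%:E); last by rewrite ltry.
apply: le_trans (integral_near_rk r0); apply: ge0_integral_mono => z _ //.
by rewrite /= ger0_norm ?near_rk_ge0.
Qed.

(** Domination by [rk] gives local integrability and access to the Hardy-Littlewood-Sobolev bound.
    The class contains the Biot-Savart components, their regularisations and their truncations to
    half-planes. *)
Definition kernel_like k := measurable_fun setT k /\ forall z, `|k z| <= rk z.

Lemma kernel_mul_le k (B M : R) (h : R * R -> R) z : kernel_like k ->
  (forall z, `|h z| <= B) -> (forall z, M <= `|z| -> h z = 0) ->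
  `|k z * h z| <= B * near_rk M z.
Proof.
move=> [_ kb] hB hM; rewrite normrM /near_rk mulrA mulrC; have [zM|zM] := ltP `|z| M.
  by rewrite mulr1 mulrC [leRHS]mulrC; apply: ler_pM.
by rewrite hM// normr0 mul0r mulr0.
Qed.

Lemma kernel_mul_integrable k (B M : R) (h : T -> R) : kernel_like k -> 0 < M ->
  measurable_fun setT h ->
  (forall z, `|h z| <= B) -> (forall z : R * R, M <= `|z| -> h z = 0) ->
  mu.-integrable setT (fun z => (k z * h z)%:E).
Proof.
move=> kk M0 mh hB hM.
apply: (le_integrable measurableT (f := fun z => (k z * h z)%:E) (g := fun z => (B%:E * (near_rk M z)%:E)%E)).
- by apply/measurable_EFinP/measurable_funM => //; exact: kk.1.
- move=> z _; rewrite -EFinM /= lee_fin (le_trans (kernel_mul_le z kk hB hM))// ler_norm//.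
- by apply: integrableZl => //; exact: near_rk_integrable.
Qed.

Lemma shift_out psi (M : R) (y z : R * R) : (forall x, M <= `|x| -> psi x = 0) ->
  M + `|y| <= `|z| -> psi (y + z) = 0.
Proof.
move=> H yz; apply: H; have := ler_normB (y + z) y.
by rewrite addrAC subrr add0r; lra.
Qed.

Lemma continuous_shift2 psi (y : R * R) : continuous psi -> continuous (fun z => psi (y + z)).
Proof.
move=> cp z; apply: (@continuous_comp _ _ _ (fun z => y + z) psi); last exact: cp.
by apply: cvgD; [exact: cvg_cst|exact: cvg_id].
Qed.

(* The transpose of convolution with k, see [convol_corr]. *)
Definition corr k psi (y : R * R) : R := \int[mu]_z (k z * psi (y + z)).

Lemma corr_integrable k psi y : kernel_like k -> test_function setT psi ->
  mu.-integrable setT (fun z => (k z * psi (y + z))%:E).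
Proof.
move=> kk tp; have [M M0 [HB HM]] := test_bound tp.
apply: (@kernel_mul_integrable k M (M + `|y|)) => //.
- by rewrite ltr_wpDr.
- by apply: continuous_measurable2; apply: continuous_shift2; exact: smooth_continuous (test_smooth tp).
- by move=> z; exact: shift_out.
Qed.

Lemma test_lipschitz psi : test_function setT psi ->
  exists2 L, 0 < L & forall x y, `|psi x - psi y| <= L * `|x - y|.
Proof.
move=> tp; have sp := test_smooth tp.
have [M1 M10 [H1 _]] := test_bound (test_partial false tp).
have [M2 M20 [H2 _]] := test_bound (test_partial true tp).
have step i (M : R) x a b : 0 < M -> (forall x, `|partial i psi x| <= M) ->
    `|psi (ins i x b) - psi (ins i x a)| <= M * `|b - a|.
  move=> M0 H; wlog ab : a b / a < b => [W|].
    have [/W//|/W W2|->] := ltgtP a b; last by rewrite !subrr normr0 mulr0.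
    by rewrite distrC (distrC b).
  have [c _ ->] := smooth_mvt i x sp ab.
  by rewrite normrM mulrC; apply: ler_wpM2r.
exists (M1 + M2); first exact: addr_gt0.
move=> x y; have S1 := step false M1 x y.1 x.1 M10 H1.
have S2 := step true M2 (ins false x y.1) y.2 x.2 M20 H2.
have E1 : ins true (ins false x y.1) x.2 = ins false x y.1 by [].
have E2 : ins true (ins false x y.1) y.2 = y by rewrite /ins /= -surjective_pairing.
have E3 : ins false x x.1 = x by rewrite /ins -surjective_pairing.
rewrite E1 E2 in S2; rewrite E3 in S1.
have -> : psi x - psi y = (psi x - psi (ins false x y.1)) + (psi (ins false x y.1) - psi y).
  by rewrite addrA subrK.
apply: (le_trans (ler_normD _ _)); rewrite mulrDl; apply: lerD.
  by apply: (le_trans S1); rewrite ler_wpM2l ?(ltW M10)// normr2E le_max lexx.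
by apply: (le_trans S2); rewrite ler_wpM2l ?(ltW M20)// normr2E le_max lexx orbT.
Qed.

Lemma corr_continuous k psi : kernel_like k -> test_function setT psi ->
  continuous (corr k psi).
Proof.
move=> kk tp y; have [M M0 [HB HM]] := test_bound tp.
have [L L0 HL] := test_lipschitz tp.
(* A radius that contains the supports of all the translates by points within distance 1 of [y], so
   that a single integrable majorant serves. *)
pose M' := M + (`|y| + 1).
have M'0 : 0 < M' by rewrite addr_gt0// ltr_wpDl.
pose N := fine (\int[mu]_z (near_rk M' z)%:E)%E.
have fN : (\int[mu]_z (near_rk M' z)%:E)%E = N%:E.
  rewrite fineK//; apply: integrable_fin_num => //; exact: near_rk_integrable.
have N0 : 0 <= N by rewrite fine_ge0// integral_ge0// => z _; rewrite lee_fin near_rk_ge0.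
have bound (x : R * R) : `|y - x| < 1 -> `|corr k psi y - corr k psi x| <= L * `|y - x| * N.
  move=> yx; rewrite /corr -RintegralB//; try exact: corr_integrable.
  have I : mu.-integrable setT (fun z => (k z * psi (y + z) - k z * psi (x + z))%:E).
    by under eq_fun do rewrite EFinB; apply: integrableB => //; exact: corr_integrable.
  apply: (le_trans (le_normr_Rintegral _ _)) => //.
  have -> : L * `|y - x| * N = \int[mu]_z (L * `|y - x| * near_rk M' z).
    rewrite RintegralZl//; exact: near_rk_integrable.
  apply: le_Rintegral => //.
  - exact: integrable_norm I.
  - exact: (integrableZl measurableT (L * `|y - x|) (near_rk_integrable M'0)).
  move=> z _; rewrite -mulrBr.
  apply: (@kernel_mul_le k (L * `|y - x|) M' (fun z => psi (y + z) - psi (x + z)) z kk).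
  - move=> w; apply: (le_trans (HL _ _)); have -> : y + w - (x + w) = y - x; last by [].
    by rewrite opprD addrACA subrr addr0.
  - move=> w Mw; rewrite (shift_out HM) ?(shift_out HM) ?subrr//.
      apply: le_trans Mw; rewrite /M' lerD2l.
      have -> : x = y - (y - x) by rewrite subKr.
      by apply: (le_trans (ler_normB _ _)); rewrite lerD2l ltW.
    by apply: le_trans Mw; rewrite /M' lerD2l lerDl.
apply/cvgrPdist_lt => e e0.
pose d := Num.min 1 (e / (L * N + 1)).
have LN : 0 < L * N + 1 by rewrite ltr_wpDl// mulr_ge0 ?(ltW L0).
have d0 : 0 < d by rewrite lt_min ltr01 divr_gt0.
near=> x.
have : ball y d x by near: x; exact: (nbhsx_ballx y d d0).
rewrite -ball_normE /ball_/= lt_min => /andP[x1 xe].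
apply: (le_lt_trans (bound x x1)).
rewrite mulrAC; apply: (@le_lt_trans _ _ ((L * N + 1) * `|y - x|)).
  by apply: ler_wpM2r => //; rewrite lerDl.
by rewrite mulrC -ltr_pdivlMr.
Unshelve. all: end_near. Qed.

Lemma ins_shift i (x z : R * R) t : ins i x t + z = ins i (x + z) (t + pcoord i z).
Proof. by case: i. Qed.

Lemma corr_derive i k psi y : kernel_like k -> test_function setT psi ->
  derivable (corr k psi) y (basis_vec R i) /\ partial i (corr k psi) y = corr k (partial i psi) y.
Proof.
move=> kk tp; have [M M0 [HB HM]] := test_bound tp.
have sp := test_smooth tp; have tq := test_partial i tp.
have [M1 M10 [HB1 HM1]] := test_bound tq.
pose t0 := pcoord i y.
pose f (t : R) (z : T) := k z * psi (ins i y t + z).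
(* For [t] within 1 of [t0], the norm of [ins i y t] is at most [|y| + |t0| + 1]; hence all the
   translated supports lie in this one ball. *)
pose M' := M1 + (`|y| + `|t0| + 1).
have M'0 : 0 < M' by rewrite addr_gt0// ltr_wpDl// addr_ge0.
have It0 : `]t0 - 1, t0 + 1[%classic t0 by rewrite /= in_itv/= ltrBlDr !ltrDl ltr01.
have dp (t : R) (z : R * R) : is_derive t 1 (fun t => psi (ins i y t + z)) (partial i psi (ins i y t + z)).
  have -> : (fun t => psi (ins i y t + z)) = (fun t => psi (ins i (y + z) t)) \o (fun t => 1 * t + pcoord i z).
    by apply/funext => s /=; rewrite mul1r ins_shift.
  rewrite ins_shift -[partial i psi _]mulr1; apply: is_derive1_comp; last exact: is_derive_affine.
  by rewrite mul1r; apply: is_derive_ins; exact: smooth_derivable.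
have df (t : R) z : is_derive t 1 (f ^~ z) (k z * partial i psi (ins i y t + z)).
  have := is_deriveZ (k z) (dp t z); rewrite /GRing.scale/=; congr (is_derive _ _ _ _).
have d1 t z : partial1of2 f t z = k z * partial i psi (ins i y t + z).
  by rewrite partial1of2E; case: (df t z).
have intf t : `]t0 - 1, t0 + 1[%classic t -> mu.-integrable setT (EFin \o f t).
  by move=> _; exact: corr_integrable.
have derf t z : `]t0 - 1, t0 + 1[%classic t -> setT z -> derivable (f ^~ z) t 1.
  by move=> _ _; case: (df t z).
have G0 (z : T) : 0 <= M1 * near_rk M' z by rewrite mulr_ge0 ?near_rk_ge0 ?(ltW M10).
have intG : mu.-integrable setT (EFin \o (fun z : T => M1 * near_rk M' z)).
  by apply: (integrableZl measurableT M1 (near_rk_integrable M'0)).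
have Gub t z : `]t0 - 1, t0 + 1[%classic t -> setT z -> `|partial1of2 f t z| <= M1 * near_rk M' z.
  rewrite /= in_itv/= => /andP[t1 t2] _; rewrite d1.
  apply: (@kernel_mul_le k M1 M' (fun z => partial i psi (ins i y t + z)) z kk) => // w Mw.
  apply: (shift_out HM1); apply: le_trans Mw; rewrite /M' lerD2l.
  have tt : `|t| <= `|t0| + 1.
    have -> : t = t0 - (t0 - t) by rewrite subKr.
    apply: (le_trans (ler_normB _ _)); rewrite lerD2l ler_norml; apply/andP; split; lra.
  rewrite normr2E; have := normr2E y; move: (`|y|) => ny yE.
  have y1 : `|y.1| <= ny by rewrite yE le_max lexx.
  have y2 : `|y.2| <= ny by rewrite yE le_max lexx orbT.
  have n0 := normr_ge0 y.1; have nt0 := normr_ge0 t0.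
  by rewrite ge_max; case: (i) => /=; apply/andP; split; lra.
have E : (fun t => corr k psi (ins i y t)) = (fun t => \int[mu]_(z in setT) f t z) by [].
split.
  by apply/derivable_ins; rewrite E; exact: (derivable_under_integral measurableT It0 intf derf G0 intG Gub).
rewrite partial_ins E (differentiation_under_integral measurableT It0 intf derf G0 intG Gub).
by apply: eq_Rintegral => z _; rewrite d1 ins_pcoord.
Qed.

Lemma corr_smooth k psi : kernel_like k -> test_function setT psi -> smooth (corr k psi).
Proof.
move=> kk tp; apply: (@smooth_coind _ (fun h => exists psi, test_function setT psi /\ h = corr k psi)).
  move=> _ [{}psi [{}tp ->]]; split; first exact: corr_continuous.
    by move=> x i; case: (corr_derive i x kk tp).
  move=> i; exists (partial i psi); split; first exact: test_partial.
  by apply/funext => x; case: (corr_derive i x kk tp).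
by exists psi.
Qed.

Lemma partial_corr i k psi y : kernel_like k -> test_function setT psi ->
  partial i (corr k psi) y = corr k (partial i psi) y.
Proof. by move=> kk tp; case: (corr_derive i y kk tp). Qed.

End correlation.
Lemma Rintegral_dominated_cvg d (T : measurableType d) (R : realType)
    (mu : {measure set T -> \bar R}) (f_ : nat -> T -> R) (f g : T -> R) :
  (forall n, measurable_fun setT (f_ n)) ->
  (forall x, f_ n x @[n --> \oo] --> f x) ->
  mu.-integrable setT (EFin \o g) ->
  (forall n x, `|f_ n x| <= g x) ->
  mu.-integrable setT (EFin \o f) /\
  (\int[mu]_x f_ n x) @[n --> \oo] --> \int[mu]_x f x.
Proof.
move=> mf ff ig fg.
have mfE n : measurable_fun setT (EFin \o f_ n) by exact/measurable_EFinP.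
have ffE x : (EFin \o f_ n) x @[n --> \oo] --> (EFin \o f) x.
  by apply: cvg_EFin; [exact: nearW|exact: ff].
have mlim : measurable_fun setT (EFin \o f).
  apply: (emeasurable_fun_cvg (fun n => EFin \o f_ n)) => // x _; exact: ffE.
have := @dominated_convergence _ _ _ mu _ measurableT (fun n => EFin \o f_ n) (EFin \o f) (EFin \o g)
  mfE mlim (aeW _ (fun x _ => ffE x)) ig (aeW _ (fun x n _ => fg n x)).
move=> [intf _ C]; split => //.
apply: fine_cvg; rewrite fineK//; exact: integrable_fin_num.
Qed.

(** * Integrals of derivatives on the line and half-line *)

Section line_integrals.
Context {R : realType}.
Local Notation mR := (measurableTypeR R).
Local Notation leb := (@lebesgue_measure R).

Lemma Rintegral_derive_itv (F f : R -> R) (l r : R) : l < r ->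
  (forall t : R, is_derive t 1 F (f t)) -> continuous f ->
  \int[leb]_(t in `[l, r]) f t = F r - F l.
Proof.
move=> lr dF cf.
have cF : continuous F.
  by move=> t; apply/differentiable_continuous/derivable1_diffP; case: (dF t).
rewrite /Rintegral (@continuous_FTC2 _ f F)//.
- by apply: continuous_subspaceT => t; exact: cf.
- split; first by move=> t _; case: (dF t).
  + by apply: cvg_at_right_filter; exact: cF.
  + by apply: cvg_at_left_filter; exact: cF.
- by move=> t _; rewrite derive1E; case: (dF t).
Qed.

Lemma Rintegral_derive_half (b : bool) (F f : R -> R) (M : R) : 0 < M ->
  (forall t : R, is_derive t 1 F (f t)) -> continuous f ->
  (forall t, M <= `|t| -> F t = 0) -> (forall t, M <= `|t| -> f t = 0) ->
  \int[leb]_t ((if b then (0 < t)%R%:R else 1) * f t) = if b then - F 0 else 0.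
Proof.
move=> M0 dF cf FM fM.
pose l : R := if b then 0 else - M.
have lM : l < M by rewrite /l; case: (b) => //; lra.
have -> : (if b then - F 0 else 0) = F M - F l.
  rewrite (FM M) ?ger0_norm ?(ltW M0)// /l; case: b {l lM}; rewrite sub0r//.
  by rewrite FM ?oppr0// normrN ger0_norm ?(ltW M0).
rewrite -(Rintegral_derive_itv lM dF cf) -[RHS]Rintegral_itv_obnd_cbnd; last first.
  have I : leb.-integrable `[l, M] (EFin \o f).
    apply: continuous_compact_integrable; first exact: segment_compact.
    exact: continuous_subspaceT.
  apply: integrableS I => //; exact: subset_itv_oc_cc.
rewrite Rintegral_mkcond [RHS]Rintegral_mkcond.
apply: eq_Rintegral => t _; rewrite patch_setT patchE.
case: (boolP (t \in `]l, M]%classic)) => [/set_mem|/negP tl].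
  rewrite /= in_itv/= /l => /andP[lt tM].
  by clear -lt; case: b lt => [->|_]; rewrite mul1r.
have [tM|tM] := leP M `|t|; first by rewrite fM// mulr0.
move: tM; rewrite ltr_norml => /andP[t1 t2].
move: tl; rewrite /l; clear l lM; case: b => tl.
  have [t0|t0] := ltP 0 t; last by rewrite mul0r.
  by exfalso; apply: tl; rewrite inE/= in_itv/= t0 ltW.
by exfalso; apply: tl; rewrite inE/= in_itv/= t1 ltW.
Qed.

End line_integrals.

(** * Integration by parts on the plane and the half-plane *)

Section plane_divergence.
Context {R : realType}.
Local Notation mR := (measurableTypeR R).
Local Notation T := (mR * mR)%type.
Local Notation mu := (@leb2 R).

(** The flag treats the two domains at once: the plane serves for the velocity, the half-plane for
    the Sobolev bound. *)
Definition half_weight (b : bool) (z : R * R) : R := if b then (0 < z.2)%R%:R else 1.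

Lemma half_weight_bound b z : `|half_weight b z| <= 1.
Proof. by rewrite /half_weight; case: b; [case: (0 < z.2)|]; rewrite ?normr1 ?normr0. Qed.

Lemma measurable_half_weight b : measurable_fun setT (half_weight b : T -> R).
Proof.
rewrite /half_weight; case: b; last exact: measurable_cst.
rewrite (_ : (fun z => _) = \1_([set z : T | 0 < z.2])); last first.
  by apply/funext => z; rewrite indicE; congr ((nat_of_bool _)%:R); rewrite mem_setE.
apply: measurable_indic; rewrite -[X in measurable X]setTI.
rewrite (_ : [set z : T | 0 < z.2] = snd @^-1` `]0, +oo[%classic).
  by apply: measurable_snd.
by apply/seteqP; split => z; rewrite /= in_itv/= andbT.
Qed.

Lemma test_integrable psi : test_function setT psi -> mu.-integrable setT (EFin \o (psi : T -> R)).
Proof.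
move=> tp; have [M M0 [HB HM]] := test_bound tp.
apply: (le_integrable measurableT (f := EFin \o (psi : T -> R)) (g := fun z => (M%:E * (\1_[set z : R * R | `|z| < M] z)%:E)%E)).
- by apply/measurable_EFinP; apply: continuous_measurable2; exact: smooth_continuous (test_smooth tp).
- move=> z _; rewrite -EFinM /= lee_fin indicE.
  have [zM|zM] := ltP `|z| M; last by rewrite HM// normr0.
  by rewrite mem_set// mulr1 (ger0_norm (ltW M0)).
- apply: integrableZl => //; apply/integrableP; split.
    by apply/measurable_EFinP/measurable_indic; exact: measurable_ball2.
  under eq_integral => z _ do rewrite gee0_abs ?lee_fin//.
  rewrite integral_indic//; last exact: measurable_ball2.
  by rewrite setIT [ltLHS]leb2_ball ?(ltW M0)// ltry.
Qed.

Lemma weighted_integrable b (f : T -> R) : mu.-integrable setT (EFin \o f) ->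
  mu.-integrable setT (EFin \o (fun z => half_weight b z * f z)).
Proof.
move=> If; have /integrableP[mf _] := If.
apply: (le_integrable measurableT (g := EFin \o f)) => //.
- apply/measurable_EFinP/measurable_funM; [exact: measurable_half_weight|exact/measurable_EFinP].
- move=> z _ /=; rewrite lee_fin normrM -[leRHS]mul1r; apply: ler_wpM2r => //.
  exact: half_weight_bound.
Qed.

Lemma Rintegral_prod12 (f : T -> R) : mu.-integrable setT (EFin \o f) ->
  (forall x, \int[@lebesgue_measure R]_y f (x, y) = 0) ->
  (forall x, (@lebesgue_measure R).-integrable setT (fun y => (f (x, y))%:E)) ->
  \int[mu]_z f z = 0.
Proof.
move=> If f0 fi; rewrite /Rintegral.
have := integral12_prod_meas1 (m1 := @lebesgue_measure R) (m2 := @lebesgue_measure R) If.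
rewrite /leb2 /lebesgue2 => <-.
rewrite integral0_eq// => x _; rewrite /fubini_F.
have := f0 x; rewrite /Rintegral => E.
by rewrite -[LHS](fineK (integrable_fin_num measurableT (fi x))) [X in X%:E]E.
Qed.

Lemma Rintegral_prod21 (f : T -> R) : mu.-integrable setT (EFin \o f) ->
  (forall y, \int[@lebesgue_measure R]_x f (x, y) = 0) ->
  (forall y, (@lebesgue_measure R).-integrable setT (fun x => (f (x, y))%:E)) ->
  \int[mu]_z f z = 0.
Proof.
move=> If f0 fi; rewrite /Rintegral.
have := integral21_prod_meas1 (m1 := @lebesgue_measure R) (m2 := @lebesgue_measure R) If.
rewrite /leb2 /lebesgue2 => <-.
rewrite integral0_eq// => x _; rewrite /fubini_G.
have := f0 x; rewrite /Rintegral => E.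
by rewrite -[LHS](fineK (integrable_fin_num measurableT (fi x))) [X in X%:E]E.
Qed.

Lemma compact_support_integrable1 (b : bool) (f : R -> R) (M : R) : 0 < M -> continuous f ->
  (forall t, M <= `|t| -> f t = 0) ->
  (@lebesgue_measure R).-integrable setT (fun t => ((if b then (0 < t)%R%:R else 1) * f t)%:E).
Proof.
move=> M0 cf fM.
have I : (@lebesgue_measure R).-integrable setT (EFin \o f).
  have J : (@lebesgue_measure R).-integrable `[- M, M] (EFin \o f).
    apply: continuous_compact_integrable; first exact: segment_compact.
    exact: continuous_subspaceT.
  move: J; rewrite integrable_mkcond//; apply: eq_integrable => // t _.
  rewrite patchE; case: ifPn => // /negP tM; rewrite /= fM//.
  rewrite leNgt; apply/negP => H; apply: tM; rewrite inE/= in_itv/=.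
  by move: H; rewrite ltr_norml => /andP[h1 h2]; rewrite !ltW.
have mf : measurable_fun setT f by exact: continuous_measurable_fun.
apply: (le_integrable (mu := @lebesgue_measure R) measurableT (f := fun t : mR => ((if b then (0 < t)%R%:R else 1) * f t)%:E) (g := EFin \o (f : mR -> R))) => //.
  apply/measurable_EFinP/measurable_funM => //.
  case: b; last exact: measurable_cst.
  rewrite (_ : (fun t => _) = \1_(`]0, +oo[%classic)); last first.
    by apply/funext => t; rewrite indicE; congr ((nat_of_bool _)%:R); rewrite mem_setE in_itv/= andbT.
  exact: measurable_indic.
move=> t _ /=; rewrite lee_fin normrM -[leRHS]mul1r; apply: ler_wpM2r => //.
by case: b; [case: (0 < t)|]; rewrite ?normr1 ?normr0.
Qed.

(** Fubini with the integration in direction [i] done first. A boundary term can only arise for the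
    normal derivative on the half-plane, where [w] is assumed to vanish on the boundary. *)
Lemma Rintegral_partial b i w : test_function setT w ->
  (b && i -> forall t, w (t, 0) = 0) ->
  \int[mu]_z (half_weight b z * partial i w z) = 0.
Proof.
move=> tw w0; have tq := test_partial i tw.
have [M M0 [_ HM]] := test_bound tw; have [M1 M10 [_ HM1]] := test_bound tq.
pose N := Num.max M M1.
have N0 : 0 < N by rewrite lt_max M0.
have big (x : R * R) t : N <= `|t| -> N <= `|ins i x t|.
  by move=> Nt; rewrite normr2E; apply: le_trans Nt _; case: (i); rewrite /= le_max lexx ?orbT.
have HN x t : N <= `|t| -> w (ins i x t) = 0.
  by move=> Nt; apply: HM; apply: le_trans (big x t Nt); rewrite le_max lexx.
have HN1 x t : N <= `|t| -> partial i w (ins i x t) = 0.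
  by move=> Nt; apply: HM1; apply: le_trans (big x t Nt); rewrite le_max lexx orbT.
have If : mu.-integrable setT (EFin \o (fun z => half_weight b z * partial i w z)).
  by apply: weighted_integrable; exact: test_integrable.
have dw x (t : R) : is_derive t 1 (fun t => w (ins i x t)) (partial i w (ins i x t)).
  by apply: is_derive_ins; apply: smooth_derivable; exact: test_smooth tw.
have cw x : continuous (fun t => partial i w (ins i x t)).
  move=> t; apply: (@continuous_comp _ _ _ (ins i x) (partial i w)); first exact: continuous_ins.
  exact: (smooth_continuous (test_smooth tq)).
case: i @N N0 big HN HN1 If dw cw w0 {tq HM1} => N N0 big HN HN1 If dw cw w0.
- apply: Rintegral_prod12 => // x.
    rewrite (Rintegral_derive_half b N0 (dw (x, 0)) (cw (x, 0)) (HN (x, 0)) (HN1 (x, 0))).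
    by case: b w0 {If} => // w0; rewrite /ins/= w0// oppr0.
  exact: (compact_support_integrable1 b N0 (cw (x, 0)) (HN1 (x, 0))).
- apply: Rintegral_prod21 => // y.
    have E := Rintegral_derive_half false N0 (dw (0, y)) (cw (0, y)) (HN (0, y)) (HN1 (0, y)).
    rewrite /half_weight/=; case: b {If w0} => //.
    case: (0 < y); first exact: E.
    by under eq_Rintegral do rewrite mul0r; rewrite Rintegral_cst// mul0r.
  have H := compact_support_integrable1 false N0 (cw (0, y)) (HN1 (0, y)).
  rewrite /half_weight/=; case: b {If w0} => //.
  case: (0 < y); first exact: H.
  by under eq_fun do rewrite mul0r; exact: integrable0.
Qed.

End plane_divergence.

(** * The field [z / |z|^2] and its regularisation *)

Section newton_kernel.
Context {R : realType}.
Local Notation mR := (measurableTypeR R).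
Local Notation T := (mR * mR)%type.
Local Notation mu := (@leb2 R).

(** The gradient of the Euclidean [log |z|]; up to order and sign its components are those of
    [z^perp / |z|^2]. *)
Definition kern i (z : R * R) : R := pcoord i z / sqnorm2 z.

Lemma sqnorm2_ge (z : R * R) : `|z| ^+ 2 <= sqnorm2 z.
Proof.
rewrite normr2E /sqnorm2; have [_|_] := leP `|z.1| `|z.2|; rewrite real_normK ?num_real//.
  by rewrite lerDr sqr_ge0.
by rewrite lerDl sqr_ge0.
Qed.

Lemma sqnorm2_ge0 (z : R * R) : 0 <= sqnorm2 z.
Proof. by rewrite addr_ge0// sqr_ge0. Qed.

Lemma pcoord_le i (z : R * R) : `|pcoord i z| <= `|z|.
Proof. by rewrite normr2E; case: i; rewrite /= le_max lexx ?orbT. Qed.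

Lemma continuous_pcoord i : continuous (@pcoord R i).
Proof. by case: i => z; [exact: cvg_snd|exact: cvg_fst]. Qed.

Lemma continuous_sqnorm2 : continuous (@sqnorm2 R).
Proof.
have -> : @sqnorm2 R = fun z => z.1 * z.1 + z.2 * z.2.
  by apply/funext => z; rewrite /sqnorm2 !expr2.
move=> z; apply: cvgD.
  by apply: cvgM; exact: cvg_fst.
by apply: cvgM; exact: cvg_snd.
Qed.

Lemma reg_kernel_like i (s : R) : 0 <= s -> kernel_like (fun z : T => pcoord i (z : R * R) / (sqnorm2 (z : R * R) + s)).
Proof.
move=> s0; split.
  rewrite (_ : (fun z => _) = fun z => pcoord i z * (sqnorm2 z + s) `^ (-1)); last first.
    by apply/funext => z; rewrite powR_inv1// addr_ge0 ?sqnorm2_ge0.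
  apply: measurable_funM; first by apply: continuous_measurable2; exact: continuous_pcoord.
  apply: (measurableT_comp (@measurable_powR R (-1))); apply: measurable_funD => //.
  by apply: continuous_measurable2; exact: continuous_sqnorm2.
move=> z; rewrite normrM normfV /rk.
have [z0|z0] := eqVneq `|z : R * R| 0.
  have := pcoord_le i z; rewrite z0 normr_le0 => /eqP->.
  by rewrite normr0 mul0r invr0.
have zp : 0 < `|z : R * R| by rewrite lt_neqAle eq_sym z0 normr_ge0.
have sp : 0 < sqnorm2 (z : R * R) + s.
  rewrite ltr_wpDr//; apply: lt_le_trans (sqnorm2_ge z); exact: exprn_gt0.
rewrite (gtr0_norm sp) ler_pdivrMr// ler_pdivlMl//.
apply: (@le_trans _ _ (`|z : R * R| ^+ 2)); first by rewrite expr2 ler_wpM2l// pcoord_le.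
by apply: (le_trans (sqnorm2_ge z)); rewrite lerDl.
Qed.

Lemma kern_like i : kernel_like (kern i : T -> R).
Proof.
rewrite (_ : kern i = fun z => pcoord i z / (sqnorm2 z + 0)); first exact: reg_kernel_like.
by apply/funext => z; rewrite addr0.
Qed.

Lemma is_derive_pcoord i j (z : R * R) (t : R) : is_derive t 1 (fun t => pcoord j (ins i z t)) (i == j)%:R.
Proof.
case: eqP => [->|/eqP ij].
  rewrite (_ : (fun t => _) = id); first exact: is_derive_id.
  by apply/funext => s; rewrite pcoord_ins.
rewrite (_ : (fun t => _) = cst (pcoord j z)); first exact: is_derive_cst.
by apply/funext => s; case: i j ij => -[].
Qed.

Lemma partial_pcoord i j (z : R * R) : partial i (pcoord j) z = (i == j)%:R.
Proof. by rewrite partial_ins derive1E; case: (is_derive_pcoord i j z (pcoord i z)). Qed.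

Lemma derivable_pcoord i j (z : R * R) : derivable (pcoord j) z (basis_vec R i).
Proof. by apply/derivable_ins; case: (is_derive_pcoord i j z (pcoord i z)). Qed.

Lemma smooth_pcoord j : smooth (@pcoord R j).
Proof.
apply: (@smooth_coind _ (fun f => f = pcoord j \/ exists c, f = fun=> c)); last by left.
move=> _ [->|[c ->]]; split.
- exact: continuous_pcoord.
- by move=> x i; exact: derivable_pcoord.
- by move=> i; right; exists ((i == j)%:R); apply/funext => x; exact: partial_pcoord.
- by move=> x; exact: cvg_cst.
- by move=> x i; exact: derivable_cst.
- by move=> i; right; exists 0; apply/funext => x; exact: partial_cst.
Qed.

Definition hreg (s : R) (z : R * R) : R := (sqnorm2 z + s)^-1.

Lemma hreg_gt0 (s : R) (z : R * R) : 0 < s -> 0 < sqnorm2 z + s.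
Proof. by move=> s0; rewrite ltr_wpDl// sqnorm2_ge0. Qed.

Lemma is_derive_hreg i (s : R) (z : R * R) : 0 < s ->
  is_derive (pcoord i z) 1 (fun t => hreg s (ins i z t)) (- 2 * pcoord i z * hreg s z ^+ 2).
Proof.
move=> s0; pose c := pcoord (~~ i) z ^+ 2 + s.
have E : (fun t => hreg s (ins i z t)) = (fun t => ((id ^+ 2 + cst c : R -> R) t)^-1).
  by apply/funext => t; rewrite /hreg /sqnorm2 /c /= addrfctE exprfctE /=; case: i {c} => /=; congr (_^-1); ring.
have E2 : (id ^+ 2 + cst c : R -> R) (pcoord i z) = sqnorm2 z + s.
  by rewrite /sqnorm2 /c addrfctE exprfctE /=; case: i {c E} => /=; ring.
rewrite E; have p := hreg_gt0 z s0.
have d2 : is_derive (pcoord i z) 1 (id ^+ 2 + cst c : R -> R) (2 * pcoord i z).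
  by apply: is_derive_eq; rewrite /GRing.scale/= addr0 mulr1 expr1.
have n0 : (id ^+ 2 + cst c : R -> R) (pcoord i z) != 0 by rewrite E2 gt_eqF.
apply: (is_derive_eq (is_deriveV n0 d2)).
by rewrite E2 /hreg /GRing.scale/= -exprVn; ring.
Qed.

Lemma partial_hreg i (s : R) (z : R * R) : 0 < s -> partial i (hreg s) z = - 2 * pcoord i z * hreg s z ^+ 2.
Proof. by move=> s0; rewrite partial_ins derive1E; case: (is_derive_hreg i z s0). Qed.

Lemma derivable_hreg i (s : R) (z : R * R) : 0 < s -> derivable (hreg s) z (basis_vec R i).
Proof. by move=> s0; apply/derivable_ins; case: (is_derive_hreg i z s0). Qed.

Lemma continuous_hreg (s : R) : 0 < s -> continuous (hreg s).
Proof.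
move=> s0 z; apply: cvgV; first by rewrite gt_eqF// hreg_gt0.
by apply: cvgD; [exact: continuous_sqnorm2|exact: cvg_cst].
Qed.

Lemma smooth_hreg (s : R) : 0 < s -> smooth (hreg s).
Proof.
move=> s0; apply: (@smooth_coind_alg _ (fun f => f = hreg s \/ smooth f)); last by apply: alg_base; left.
move=> f [->|sf]; split.
- exact: continuous_hreg.
- by move=> x i; exact: derivable_hreg.
- move=> i; rewrite (_ : partial i _ = fun z => (- 2 * pcoord i z) * (hreg s z * hreg s z)); last first.
    by apply/funext => z; rewrite partial_hreg// expr2.
  apply: alg_mul; last by apply: alg_mul; apply: alg_base; left.
  by apply: alg_base; right; apply: smoothM; [exact: smooth_cst|exact: smooth_pcoord].
- exact: smooth_continuous.
- by move=> x i; exact: smooth_derivable.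
- by move=> i; apply: alg_base; right; exact: smooth_partial.
Qed.

Lemma partial_reg i j (s : R) (psi : R * R -> R) z : 0 < s -> smooth psi ->
  partial i (fun z => pcoord j z * hreg s z * psi z) z =
  pcoord j z * hreg s z * partial i psi z +
  ((i == j)%:R * hreg s z - 2 * pcoord j z * pcoord i z * hreg s z ^+ 2) * psi z.
Proof.
move=> s0 sp; have dg : derivable (fun z => pcoord j z * hreg s z) z (basis_vec R i).
  by apply: derivableM; [exact: derivable_pcoord|exact: derivable_hreg].
rewrite (partialM dg (smooth_derivable sp)) partialM; [|exact: derivable_pcoord|exact: derivable_hreg].
rewrite partial_pcoord partial_hreg//; ring.
Qed.

Lemma test_reg j (s : R) (psi : R * R -> R) : 0 < s -> test_function setT psi ->
  test_function setT (fun z => pcoord j z * hreg s z * psi z).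
Proof.
by move=> s0 tp; apply: test_mulr => //; apply: smoothM; [exact: smooth_pcoord|exact: smooth_hreg].
Qed.

Lemma half_kernel_like b (k : T -> R) : kernel_like k -> kernel_like (fun z : T => half_weight b z * k z).
Proof.
move=> [mk kb]; split; first by apply: measurable_funM => //; exact: measurable_half_weight.
move=> z; rewrite normrM -[leRHS]mul1r; apply: ler_pM => //; exact: half_weight_bound.
Qed.

Lemma kernel_test_integrable (k : T -> R) (psi : R * R -> R) : kernel_like k -> test_function setT psi ->
  mu.-integrable setT (EFin \o (fun z : T => k z * psi z)).
Proof.
move=> kk tp; have := corr_integrable 0 kk tp.
by under eq_fun do rewrite add0r.
Qed.

(** The regularised field is the gradient of [log (|z|^2 + s) / 2], hence has no curl. *)
Lemma flux_perp_reg (s : R) (psi : R * R -> R) : 0 < s -> test_function setT psi ->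
  \int[mu]_z (pcoord true z * hreg s z * partial false psi z) =
  \int[mu]_z (pcoord false z * hreg s z * partial true psi z).
Proof.
move=> s0 tp; have sp := test_smooth tp.
have I i j : mu.-integrable setT (EFin \o (fun z : T => pcoord j z * hreg s z * partial i psi z)).
  apply: (@kernel_test_integrable (fun z => pcoord j z / (sqnorm2 z + s))); last exact: test_partial.
  by apply: reg_kernel_like; exact: ltW.
have Ip i j : mu.-integrable setT (EFin \o (partial i (fun z => pcoord j z * hreg s z * psi z) : T -> R)).
  by apply: test_integrable; apply: test_partial; exact: test_reg.
have Z i j : \int[mu]_z partial i (fun z => pcoord j z * hreg s z * psi z) z = 0.
  have := @Rintegral_partial R false i _ (test_reg j s0 tp) ltac:(by []).
  by rewrite /half_weight; under eq_Rintegral do rewrite mul1r.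
apply/eqP; rewrite -subr_eq0 -RintegralB//; apply/eqP.
rewrite -[RHS](subrr (0 : R)) -{1}(Z false true) -(Z true false) -RintegralB//.
by apply: eq_Rintegral => z _; rewrite !partial_reg//=; ring.
Qed.

(** The divergence of [z / (|z|^2 + s)] is [2 s / (|z|^2 + s)^2], which concentrates at the origin
    as [s] tends to 0. On the half-plane no boundary term appears because the normal component of
    the field vanishes on the boundary line. *)
Lemma flux_radial_reg b (s : R) (psi : R * R -> R) : 0 < s -> test_function setT psi ->
  \int[mu]_z (half_weight b z * (pcoord false z * hreg s z * partial false psi z +
     pcoord true z * hreg s z * partial true psi z)) =
  - \int[mu]_z (half_weight b z * (2 * s * hreg s z ^+ 2 * psi z)).
Proof.
move=> s0 tp; have sp := test_smooth tp.
pose w j z := pcoord j z * hreg s z * psi z.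
have Ip i j : mu.-integrable setT (EFin \o (fun z : T => half_weight b z * partial i (w j) z)).
  by apply: weighted_integrable; apply: test_integrable; apply: test_partial; exact: test_reg.
have Z i : \int[mu]_z (half_weight b z * partial i (w i) z) = 0.
  apply: Rintegral_partial; first exact: test_reg.
  by case: i; rewrite ?andbF// => _ t; rewrite /w /= !mul0r.
have Ih : mu.-integrable setT (EFin \o (fun z : T => half_weight b z * (2 * s * hreg s z ^+ 2 * psi z))).
  apply: weighted_integrable; apply: test_integrable; apply: test_mulr => //.
  apply: (@smoothM _ (fun=> 2 * s)); first exact: smooth_cst.
  have := smoothM (smooth_hreg s0) (smooth_hreg s0); congr smooth.
transitivity (\int[mu]_z ((half_weight b z * partial false (w false) z +
   half_weight b z * partial true (w true) z) - half_weight b z * (2 * s * hreg s z ^+ 2 * psi z))).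
  apply: eq_Rintegral => z _; rewrite /w !partial_reg//=.
  have hE : hreg s z * (sqnorm2 z + s) = 1 by rewrite mulVf// gt_eqF// hreg_gt0.
  rewrite -!mulrDr -mulrBr; congr (_ * _).
  have -> : 2 * s * hreg s z ^+ 2 * psi z = 2 * (hreg s z * (hreg s z * (sqnorm2 z + s)) - sqnorm2 z * hreg s z ^+ 2) * psi z by ring.
  by rewrite hE /sqnorm2; ring.
rewrite RintegralB//; last first.
  by apply: (integrableD measurableT (Ip false false) (Ip true true)).
by rewrite RintegralD// !Z addr0 sub0r.
Qed.

End newton_kernel.

(** * Curl and divergence of [z / |z|^2] in the weak sense *)

Section newton_flux.
Context {R : realType}.
Local Notation mR := (measurableTypeR R).
Local Notation T := (mR * mR)%type.
Local Notation mu := (@leb2 R).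
Implicit Types (psi : R * R -> R).

Definition eps (n : nat) : R := n.+1%:R^-1.

Lemma eps_gt0 n : 0 < eps n. Proof. by rewrite invr_gt0 ltr0Sn. Qed.

Lemma eps2_gt0 n : 0 < eps n ^+ 2. Proof. by rewrite exprn_gt0// eps_gt0. Qed.

Lemma eps_cvg : eps n @[n --> \oo] --> 0.
Proof.
apply/cvgrPdist_lt => e e0; near=> n; rewrite sub0r normrN ger0_norm ?(ltW (eps_gt0 n))//.
near: n; exact: (near_infty_natSinv_lt (PosNum e0)).
Unshelve. all: end_near. Qed.

Lemma eps2_cvg : eps n ^+ 2 @[n --> \oo] --> 0.
Proof.
have -> : (fun n => eps n ^+ 2) = (fun n => eps n * eps n) by apply/funext => n; rewrite expr2.
by rewrite -[X in _ --> X](mulr0 0); apply: cvgM; exact: eps_cvg.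
Qed.

Lemma sqnorm2_gt0 (z : R * R) : z != 0 -> 0 < sqnorm2 z.
Proof.
move=> z0; apply: lt_le_trans (sqnorm2_ge z); rewrite exprn_gt0// lt_neqAle normr_ge0 andbT.
by rewrite eq_sym normr_eq0.
Qed.

Lemma hreg_cvg (z : R * R) : z != 0 -> hreg (eps n ^+ 2) z @[n --> \oo] --> (sqnorm2 z)^-1.
Proof.
move=> z0; apply: cvgV; first by rewrite gt_eqF// sqnorm2_gt0.
by rewrite -[X in _ --> X]addr0; apply: cvgD; [exact: cvg_cst|exact: eps2_cvg].
Qed.

Lemma pcoord0 i : pcoord i (0 : R * R) = 0. Proof. by case: i. Qed.

Lemma reg_kern_cvg j (z : R * R) : pcoord j z * hreg (eps n ^+ 2) z @[n --> \oo] --> kern j z.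
Proof.
rewrite /kern; have [->|z0] := eqVneq z 0.
  by under eq_fun do rewrite pcoord0 mul0r; rewrite pcoord0 mul0r; exact: cvg_cst.
by apply: cvgM; [exact: cvg_cst|exact: hreg_cvg].
Qed.

Lemma rk_like : kernel_like (@rk R : T -> R).
Proof. by split; [exact: measurable_rk|move=> z; rewrite ger0_norm ?rk_ge0]. Qed.

Lemma rk_test_integrable psi : test_function setT psi ->
  mu.-integrable setT (EFin \o (fun z : T => rk (z : R * R) * `|psi z|)).
Proof.
move=> tp; have [M M0 [HB HM]] := test_bound tp.
apply: (@kernel_mul_integrable _ _ M M (fun z => `|psi z|) rk_like M0).
- by apply: measurableT_comp => //; apply: continuous_measurable2; exact: smooth_continuous (test_smooth tp).
- by move=> z; rewrite normr_id.
- by move=> z /HM ->; rewrite normr0.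
Qed.

Lemma reg_kern_le j n (z : R * R) : `|pcoord j z * hreg (eps n ^+ 2) z| <= rk z.
Proof. exact: (reg_kernel_like j (ltW (eps2_gt0 n))).2. Qed.

Lemma flux_perp psi : test_function setT psi ->
  \int[mu]_z (kern true z * partial false psi z) = \int[mu]_z (kern false z * partial true psi z).
Proof.
move=> tp.
have C i j : \int[mu]_z (pcoord j z * hreg (eps n ^+ 2) z * partial i psi z) @[n --> \oo] -->
    \int[mu]_z (kern j z * partial i psi z).
  have tq := test_partial i tp.
  have [] // := @Rintegral_dominated_cvg _ _ _ mu (fun n (z : T) => pcoord j z * hreg (eps n ^+ 2) z * partial i psi z)
    (fun z => kern j z * partial i psi z) (fun z => rk z * `|partial i psi z|).
  - move=> n; have := kernel_test_integrable (reg_kernel_like j (ltW (eps2_gt0 n))) tq.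
    by move=> /integrableP[/measurable_EFinP].
  - by move=> z; apply: cvgM; [exact: reg_kern_cvg|exact: cvg_cst].
  - exact: rk_test_integrable.
  - by move=> n z; rewrite normrM ler_wpM2r// reg_kern_le.
have := C false true; under eq_fun do rewrite (flux_perp_reg (eps2_gt0 _) tp).
by move=> /cvg_unique; apply => //; exact: C.
Qed.

(** Minus the weak divergence of [z / |z|^2], tested on [psi]; its classical value is
    [- 2 pi psi(0)] on the plane and [- pi psi(0)] on the half-plane. *)
Definition radial_flux b psi : R :=
  \int[mu]_z (half_weight b z * (kern false z * partial false psi z + kern true z * partial true psi z)).

Lemma radial_flux_cvg b psi : test_function setT psi ->
  (- \int[mu]_z (half_weight b z * (2 * eps n ^+ 2 * hreg (eps n ^+ 2) z ^+ 2 * psi z))) @[n --> \oo] -->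
  radial_flux b psi.
Proof.
move=> tp; under eq_fun do rewrite -(flux_radial_reg b (eps2_gt0 _) tp).
have [] // := @Rintegral_dominated_cvg _ _ _ mu (fun n (z : T) => half_weight b z * (pcoord false z * hreg (eps n ^+ 2) z * partial false psi z +
     pcoord true z * hreg (eps n ^+ 2) z * partial true psi z))
  (fun z => half_weight b z * (kern false z * partial false psi z + kern true z * partial true psi z))
  (fun z => rk z * `|partial false psi z| + rk z * `|partial true psi z|).
- move=> n; apply: measurable_funM; first exact: measurable_half_weight.
  apply: measurable_funD.
    have := kernel_test_integrable (reg_kernel_like false (ltW (eps2_gt0 n))) (test_partial false tp).
    by move=> /integrableP[/measurable_EFinP].
  have := kernel_test_integrable (reg_kernel_like true (ltW (eps2_gt0 n))) (test_partial true tp).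
  by move=> /integrableP[/measurable_EFinP].
- move=> z; apply: cvgM; first exact: cvg_cst.
  by apply: cvgD; apply: cvgM; try exact: reg_kern_cvg; exact: cvg_cst.
- exact: (integrableD measurableT (rk_test_integrable (test_partial false tp)) (rk_test_integrable (test_partial true tp))).
- move=> n z; rewrite normrM -[leRHS]mul1r; apply: ler_pM => //; first exact: half_weight_bound.
  apply: (le_trans (ler_normD _ _)); rewrite !normrM -!normrM; apply: lerD;
    by rewrite normrM ler_wpM2r// reg_kern_le.
Qed.

(** As [psi] is Lipschitz and vanishes at 0, one factor [hreg] times [|psi|] is at most [L * rk],
    while [eps n ^ 2] times the other is at most 1. The regularised divergence is thus dominated by
    an integrable function and tends to 0 pointwise. *)
Lemma radial_flux_eq0 b psi : test_function setT psi -> psi 0 = 0 -> radial_flux b psi = 0.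
Proof.
move=> tp p0; have C := @radial_flux_cvg b psi tp.
have [M M0 [HB HM]] := test_bound tp; have [L L0 HL] := test_lipschitz tp.
have hL z : `|psi z| <= L * `|z| by rewrite -[psi z]subr0 -p0 -[X in _ * `|X|]subr0; exact: HL.
have h0 n z : 0 <= hreg (eps n ^+ 2) z by rewrite ltW// invr_gt0 hreg_gt0// eps2_gt0.
have hrk n (z : R * R) : z != 0 -> hreg (eps n ^+ 2) z * `|z| <= rk z.
  move=> z0; have zp : 0 < `|z| by rewrite normr_gt0.
  rewrite /rk mulrC ler_pdivrMr ?hreg_gt0 ?eps2_gt0// ler_pdivlMl//.
  rewrite -expr2; apply: (le_trans (sqnorm2_ge z)); rewrite lerDl; exact/ltW/eps2_gt0.
have sh n z : eps n ^+ 2 * hreg (eps n ^+ 2) z <= 1.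
  by rewrite ler_pdivrMr ?hreg_gt0 ?eps2_gt0// mul1r lerDr sqnorm2_ge0.
suff C0 : (- \int[mu]_z (half_weight b z * (2 * eps n ^+ 2 * hreg (eps n ^+ 2) z ^+ 2 * psi z))) @[n --> \oo] --> (0 : R).
  by move: C => /cvg_unique; apply.
rewrite -[X in _ --> X]oppr0; apply: cvgN.
have -> : 0 = Rintegral mu setT (fun=> 0) by rewrite Rintegral_cst// mul0r.
have [] // := @Rintegral_dominated_cvg _ _ _ mu (fun n (z : T) => half_weight b z * (2 * eps n ^+ 2 * hreg (eps n ^+ 2) z ^+ 2 * psi z))
  (fun=> 0) (fun z => (2 * L) * near_rk M z).
- move=> n; apply: measurable_funM; first exact: measurable_half_weight.
  apply: measurable_funM; last by apply: continuous_measurable2; exact: smooth_continuous (test_smooth tp).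
  apply: measurable_funM => //; apply: measurable_funX.
  by apply: continuous_measurable2; apply: continuous_hreg; exact: eps2_gt0.
- move=> z; rewrite -[X in _ --> X](mulr0 (half_weight b z)); apply: cvgM; first exact: cvg_cst.
  have [->|z0] := eqVneq z 0; first by under eq_fun do rewrite p0 mulr0; exact: cvg_cst.
  rewrite -[X in _ --> X](mul0r (psi z)); apply: cvgM; last exact: cvg_cst.
  have -> : (0 : R) = 2 * 0 * ((sqnorm2 z)^-1 * (sqnorm2 z)^-1) by rewrite mulr0 mul0r.
  apply: cvgM; first by apply: cvgM; [exact: cvg_cst|exact: eps2_cvg].
  by under eq_fun do rewrite expr2; apply: cvgM; exact: hreg_cvg.
- apply: (integrableZl measurableT (2 * L) (near_rk_integrable M0)).
- move=> n z; rewrite normrM -[leRHS]mul1r; apply: ler_pM => //; first exact: half_weight_bound.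
  rewrite /near_rk; have [zM|zM] := ltP `|z| M; last by rewrite HM// mulr0 normr0 !mulr0.
  have [->|z0] := eqVneq z 0; first by rewrite p0 mulr0 normr0 !mulr_ge0 ?rk_ge0 ?(ltW L0).
  rewrite normrM ger0_norm; last by rewrite !mulr_ge0 ?exprn_ge0 ?(ltW (eps_gt0 n)).
  have -> : 2 * eps n ^+ 2 * hreg (eps n ^+ 2) z ^+ 2 * `|psi z| =
     2 * (eps n ^+ 2 * hreg (eps n ^+ 2) z * (hreg (eps n ^+ 2) z * `|psi z|)) by ring.
  rewrite mulr1 -(mulrA 2 L); apply: ler_wpM2l => //; rewrite -[leRHS]mul1r; apply: ler_pM.
  + by rewrite mulr_ge0 ?exprn_ge0 ?(ltW (eps_gt0 n)).
  + exact: mulr_ge0.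
  + exact: sh.
  apply: (@le_trans _ _ (hreg (eps n ^+ 2) z * (L * `|z|))); first by rewrite ler_wpM2l.
  by rewrite mulrCA; apply: ler_wpM2l; [exact: ltW|exact: hrk].
Qed.

Definition plane_cutoff (z : R * R) : R := cutoff z.1 * cutoff z.2.

Lemma test_plane_cutoff : test_function setT plane_cutoff.
Proof.
apply: (@test_intro_bound _ _ 1).
  have H1 := @smooth_cutoff_affine R false 1 0; have H2 := @smooth_cutoff_affine R true 1 0.
  have := smoothM H1 H2; congr smooth; apply/funext => z.
  by rewrite /plane_cutoff !mul1r !addr0.
move=> x; rewrite normr2E le_max /plane_cutoff => /orP[] x1.
  by rewrite (@cutoff_out _ x.1)// mul0r.
by rewrite (@cutoff_out _ x.2)// mulr0.
Qed.

Lemma plane_cutoff0 : plane_cutoff 0 = 1.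
Proof. by rewrite /plane_cutoff !cutoff0 mulr1. Qed.

Lemma plane_cutoff_ge0 z : 0 <= plane_cutoff z.
Proof. by rewrite mulr_ge0 ?cutoff_ge0. Qed.

(* By [radial_flux_eq0] the flux only sees psi 0, so its constant, the value on
   one fixed cutoff, is never computed: only its sign is needed, and only for the
   half-plane. *)
Lemma radial_flux_linear b psi : test_function setT psi ->
  radial_flux b psi = psi 0 * radial_flux b plane_cutoff.
Proof.
move=> tp; pose h z := psi z + (- psi 0) * plane_cutoff z.
have tb := test_plane_cutoff.
have tcb : test_function setT (fun z => - psi 0 * plane_cutoff z).
  by apply: test_mulr => //; exact: smooth_cst.
have th : test_function setT h.
  have [M M0 [_ HM]] := test_bound tp; have [N N0 [_ HN]] := test_bound tb.
  apply: (@test_intro_bound _ _ (Num.max M N)).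
    by apply: smoothD; [exact: test_smooth tp|exact: test_smooth tcb].
  by move=> x; rewrite ge_max => /andP[? ?]; rewrite /h HM// HN// mulr0 addr0.
have h0 : h 0 = 0 by rewrite /h plane_cutoff0 mulr1 subrr.
have I phi : test_function setT phi -> mu.-integrable setT (EFin \o (fun z : T =>
    half_weight b z * (kern false z * partial false phi z + kern true z * partial true phi z))).
  move=> tphi; apply: weighted_integrable.
  exact: (integrableD measurableT (kernel_test_integrable (kern_like false) (test_partial false tphi))
    (kernel_test_integrable (kern_like true) (test_partial true tphi))).
apply/eqP; rewrite -subr_eq0 -[X in _ == X](@radial_flux_eq0 b h th h0) /radial_flux.
rewrite -RintegralZl//; last exact: I.
rewrite -RintegralB//; [|exact: I|exact: (integrableZl measurableT (psi 0) (I _ tb))].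
apply/eqP/eq_Rintegral => z _.
have E i : partial i h z = partial i psi z - psi 0 * partial i plane_cutoff z.
  rewrite partialD; [|exact: smooth_derivable (test_smooth tp)|exact: smooth_derivable (test_smooth tcb)].
  rewrite partialM; [|exact: derivable_cst|exact: smooth_derivable (test_smooth tb)].
  by rewrite partial_cst mulr0 addr0 mulNr.
rewrite !E; move: (partial false psi z) (partial true psi z) (partial false plane_cutoff z)
  (partial true plane_cutoff z) (kern false z) (kern true z) (half_weight b z) (psi 0) => ? ? ? ? ? ? ? ?.
by ring.
Qed.

End newton_flux.

(** * The half-plane flux constant is nonzero *)

Section radial_flux_sign.
Context {R : realType}.
Local Notation mR := (measurableTypeR R).
Local Notation T := (mR * mR)%type.
Local Notation mu := (@leb2 R).

Lemma radial_flux_plane_cutoff_lt0 : radial_flux true (@plane_cutoff R) < 0.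
Proof.
have tb := @test_plane_cutoff R; have C := @radial_flux_cvg R true _ tb.
(* On the square of side [e = eps n] the quantity [|z|^2 + e^2] is at most [3 e^2] and the cutoff is
   eventually at least [1 / 2]. The regularised divergence is therefore at least [1 / (9 e^2)] on a
   set of area [e^2]. *)
apply: (@le_lt_trans _ _ (- 9^-1)); last by rewrite oppr_lt0 invr_gt0.
apply: (cvgr_to_le C).
have cb := smooth_continuous (test_smooth tb).
have h2 : 0 < 2^-1 :> R by rewrite invr_gt0.
have /cvgrPdist_lt/(_ _ h2)/nbhs_ballP[d /= d0 Hd] := cb 0.
near=> n; rewrite lerNl opprK.
have ed : eps n < d.
  by near: n; exact: (near_infty_natSinv_lt (PosNum d0)).
have e0 := @eps_gt0 R n; set e := eps n in e0 ed *.
pose Q : set T := `]0, e[%classic `*` `]0, e[%classic.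
have mQ : measurable Q by apply: measurableX; exact: measurable_itv.
have muQ : mu Q = (e ^+ 2)%:E.
  by rewrite [LHS]leb2E// lebesgue_measure_itv/= lte_fin e0 -EFinB subr0 -EFinM expr2.
have s0 : 0 < e ^+ 2 by rewrite exprn_gt0.
have Ih : mu.-integrable setT (EFin \o (fun z : T => half_weight true z * (2 * e ^+ 2 * hreg (e ^+ 2) z ^+ 2 * plane_cutoff z))).
  apply: weighted_integrable; apply: test_integrable; apply: test_mulr => //.
  apply: (@smoothM _ (fun=> 2 * e ^+ 2)); first exact: smooth_cst.
  have := smoothM (smooth_hreg s0) (smooth_hreg s0); congr smooth.
have Iq : mu.-integrable setT (EFin \o (\1_Q : T -> R)).
  apply/integrableP; split; first exact/measurable_EFinP/measurable_indic.
  under eq_integral => z _ do rewrite gee0_abs ?lee_fin//.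
  by rewrite integral_indic// setIT [ltLHS]muQ ltry.
have -> : 9^-1 = \int[mu]_z ((9 * e ^+ 2)^-1 * \1_Q z).
  rewrite RintegralZl//= /Rintegral integral_indic// setIT [X in fine X]muQ /=.
  by field; rewrite gt_eqF.
apply: le_Rintegral => //; first exact: (integrableZl measurableT (9 * e ^+ 2)^-1 Iq).
move=> z _; rewrite indicE; case: (boolP (z \in Q)) => [/set_mem[]|_]; last first.
  rewrite mulr0; apply: mulr_ge0; first by rewrite /half_weight ler0n.
  rewrite mulr_ge0 ?plane_cutoff_ge0// mulr_ge0 ?sqr_ge0// mulr_ge0//; exact: ltW.
rewrite /= !in_itv/= => /andP[z10 z1e] /andP[z20 z2e]; rewrite mulr1 /half_weight z20 mul1r.
have b2 : 2^-1 <= plane_cutoff z.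
  have : `|plane_cutoff 0 - plane_cutoff z| < 2^-1.
    apply: Hd; rewrite -ball_normE /ball_/= sub0r normrN normr2E gt_max !gtr0_norm//.
    by rewrite (lt_trans z1e)// (lt_trans z2e).
  by rewrite plane_cutoff0 ltr_norml => /andP[_]; rewrite ltrBlDl -ltrBlDr => H; apply: ltW; apply: le_lt_trans H; lra.
have z12 : z.1 ^+ 2 <= e ^+ 2 by apply: lerXn2r; rewrite ?nnegrE; exact: ltW.
have z22 : z.2 ^+ 2 <= e ^+ 2 by apply: lerXn2r; rewrite ?nnegrE; exact: ltW.
have hb : (3 * e ^+ 2)^-1 <= hreg (e ^+ 2) z.
  rewrite /hreg lef_pV2 ?posrE ?hreg_gt0 ?mulr_gt0// /sqnorm2.
  by move: z12 z22; lra.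
have h0 : 0 <= (3 * e ^+ 2)^-1 by rewrite invr_ge0 mulr_ge0// ltW.
have hb2 : (3 * e ^+ 2)^-1 ^+ 2 <= hreg (e ^+ 2) z ^+ 2.
  by apply: lerXn2r => //; rewrite nnegrE (le_trans h0).
have -> : (9 * e ^+ 2)^-1 = 2 * e ^+ 2 * (3 * e ^+ 2)^-1 ^+ 2 * 2^-1.
  by field; rewrite gt_eqF.
apply: ler_pM => //; last by apply: ler_wpM2l => //; rewrite mulr_ge0// ltW.
by rewrite mulr_ge0 ?sqr_ge0// mulr_ge0// ltW.
Unshelve. all: end_near. Qed.

End radial_flux_sign.

(** * Integrable functions whose integrals over rectangles vanish *)

Section vanishing_integrals.
Context d (T : measurableType d) {R : realType} (mu : {measure set T -> \bar R}).

(** Dynkin induction. The map [proj] allows it to be run on one coordinate at a time as well as on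
    the whole space. *)
Lemma integral_eq0_dynkin d' (S : measurableType d') (proj : T -> S) (G : set (set S))
    (g : T -> \bar R) :
  @measurable _ S = <<s G >> -> setI_closed G -> measurable_fun setT proj ->
  mu.-integrable setT g -> (\int[mu]_x g x = 0)%E ->
  (forall A, G A -> \int[mu]_(x in proj @^-1` A) g x = 0)%E ->
  (forall A, measurable A -> \int[mu]_(x in proj @^-1` A) g x = 0)%E.
Proof.
move=> mE GI mp ig g0 gG A; rewrite mE; move: A.
have mpre B : measurable B -> measurable (proj @^-1` B).
  by move=> mB; rewrite -[X in measurable X]setTI; exact: mp.
apply: (dynkin_induction mE GI) => //.
- move=> B mB PB; have mC := mpre _ mB.
  have := g0; rewrite -(setUv (proj @^-1` B)) integral_setU//; last 3 first.
  + exact: measurableC.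
  + by rewrite setUv; exact: measurable_int ig.
  + exact/disj_setPCl.
  by rewrite PB add0e preimage_setC.
- move=> F mF tF PF; rewrite preimage_bigcup integral_bigcup.
  + by apply: eseries0 => n _ _; exact: PF.
  + apply/trivIsetP => /= i j _ _ ij; rewrite -preimage_setI.
    by move/trivIsetP : tF => /(_ _ _ _ _ ij) ->//; rewrite preimage_set0.
  + by move=> n; exact: mpre.
  + apply: integrableS ig => //; apply: bigcup_measurable => n _; exact: mpre.
Qed.

End vanishing_integrals.

Section du_bois_reymond.
Context {R : realType}.
Local Notation mR := (measurableTypeR R).
Local Notation T := (mR * mR)%type.
Local Notation mu := (@leb2 R).

(** Three passes: intervals become measurable sets in the first coordinate, then in the second, and
    finally products become arbitrary measurable sets. The hypotheses on strips and on the plane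
    supply the vanishing total integral from which the passes start. *)
Lemma integral_eq0_rect (g : T -> \bar R) : mu.-integrable setT g ->
  (\int[mu]_z g z = 0)%E ->
  (forall (a b c d : R), \int[mu]_(z in (`]a, b[%classic `*` `]c, d[%classic)) g z = 0)%E ->
  (forall (a b : R), \int[mu]_(z in (`]a, b[%classic `*` setT)) g z = 0)%E ->
  (forall (c d : R), \int[mu]_(z in (setT `*` `]c, d[%classic)) g z = 0)%E ->
  forall A, measurable A -> (\int[mu]_(z in A) g z = 0)%E.
Proof.
move=> ig gT gR g1 g2.
pose G : set (set mR) := [set A | exists x y, A = `]x, y[%classic].
have GE : @measurable _ mR = <<s G >> by exact: RGenOpens.measurableE.
have GI : setI_closed G.
  move=> _ _ [a [b ->]] [c [d ->]]; exists (Num.max a c), (Num.min b d).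
  apply/seteqP; split => x; rewrite /= !in_itv/= gt_max lt_min.
    by move=> [/andP[-> ->] /andP[-> ->]].
  by move=> /andP[/andP[-> ->] /andP[-> ->]].
have S1 c d' (A : set mR) : measurable A -> (\int[mu]_(z in A `*` `]c, d'[%classic) g z = 0)%E.
  have mJ : measurable (setT `*` `]c, d'[%classic : set T) by apply: measurableX.
  have ig' : mu.-integrable setT (g \_ (setT `*` `]c, d'[%classic)).
    by rewrite -integrable_mkcond//; apply: integrableS ig.
  have E (B : set mR) : (\int[mu]_(z in fst @^-1` B) (g \_ (setT `*` `]c, d'[%classic)) z =
      \int[mu]_(z in B `*` `]c, d'[%classic) g z)%E.
    by rewrite -integral_mkcondr; congr integral; apply/seteqP; split => z /=; tauto.
  move=> mA; rewrite -E; move: A mA.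
  apply: (integral_eq0_dynkin GE GI) => //.
    by rewrite -integral_mkcond.
  by move=> _ [a [b ->]]; rewrite E.
have S1T (A : set mR) : measurable A -> (\int[mu]_(z in A `*` setT) g z = 0)%E.
  have E (B : set mR) : fst @^-1` B = B `*` setT :> set T by apply/seteqP; split => z // [].
  move=> mA; rewrite -E; move: A mA.
  apply: (integral_eq0_dynkin GE GI) => //.
  by move=> _ [a [b ->]]; rewrite E.
have S2 (A B : set mR) : measurable A -> measurable B -> (\int[mu]_(z in A `*` B) g z = 0)%E.
  move=> mA.
  have mJ : measurable (A `*` setT : set T) by apply: measurableX.
  have ig' : mu.-integrable setT (g \_ (A `*` setT)).
    by rewrite -integrable_mkcond//; apply: integrableS ig.
  have E (C : set mR) : (\int[mu]_(z in snd @^-1` C) (g \_ (A `*` setT)) z =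
      \int[mu]_(z in A `*` C) g z)%E.
    by rewrite -integral_mkcondr; congr integral; apply/seteqP; split => z /=; tauto.
  move=> mB; rewrite -E; move: B mB.
  apply: (integral_eq0_dynkin GE GI) => //.
    by rewrite -integral_mkcond S1T.
  by move=> _ [a [b ->]]; rewrite E S1.
have PE : @measurable _ T = <<s [set A `*` B | A in @measurable _ mR & B in @measurable _ mR] >>.
  exact: measurable_prod_measurableType.
move=> A mA; rewrite -[A]preimage_id; move: A mA.
apply: (integral_eq0_dynkin PE) => //.
  move=> _ _ [A1 mA1 [A2 mA2 <-]] [B1 mB1 [B2 mB2 <-]].
  exists (A1 `&` B1); first exact: measurableI.
  exists (A2 `&` B2); first exact: measurableI.
  by rewrite setXI.
by move=> _ [A mA [B mB <-]]; rewrite preimage_id S2.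
Qed.

End du_bois_reymond.

(** * Local integrability on the half-plane *)

Section local_integrability.
Context {R : realType}.
Local Notation mR := (measurableTypeR R).
Local Notation T := (mR * mR)%type.
Local Notation mu := (@leb2 R).
Local Notation H := (@halfplane R).

Lemma measurable_halfplane : measurable (H : set T).
Proof.
apply: open_measurable2; rewrite (_ : H = snd @^-1` [set t : R | 0 < t]); last by [].
apply: open_comp; last exact: open_gt.
by move=> z _; exact: cvg_snd.
Qed.

Lemma compact_measurable2 (K : set (R * R)) : compact K -> measurable (K : set T).
Proof. by move=> cK; apply: closed_measurable2; apply: compact_closed cK; exact: hausdorff2. Qed.

Lemma leb2_compact_fin (K : set (R * R)) : compact K -> (mu K < +oo)%E.
Proof.
move=> cK; have [M M0 HM] := compact_bound cK.
apply: (@le_lt_trans _ _ (mu [set z : R * R | `|z| < M])).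
  apply: le_measure; rewrite ?inE//; [exact: compact_measurable2|exact: measurable_ball2].
by rewrite leb2_ball ?(ltW M0)// ltry.
Qed.

Definition exhaust (n : nat) : set (R * R) :=
  `]- n.+1%:R, n.+1%:R[%classic `*` `]n.+1%:R^-1, n.+1%:R[%classic.

Definition exhaust_cl (n : nat) : set (R * R) :=
  `[- n.+1%:R, n.+1%:R]%classic `*` `[n.+1%:R^-1, n.+1%:R]%classic.

Lemma exhaust_cl_compact n : compact (exhaust_cl n).
Proof. exact: compact_box. Qed.

Lemma exhaust_cl_sub n : exhaust_cl n `<=` H.
Proof.
move=> z [_]; rewrite /= in_itv/= => /andP[h _]; apply: lt_le_trans h.
by rewrite invr_gt0 ltr0Sn.
Qed.

Lemma exhaust_sub_cl n : exhaust n `<=` exhaust_cl n.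
Proof. by move=> z [h1 h2]; split; exact: subset_itv_oo_cc. Qed.

Lemma exhaust_measurable n : measurable (exhaust n : set T).
Proof. by apply: measurableX; exact: measurable_itv. Qed.

Lemma exhaust_cover z : H z -> exists n, exhaust n z.
Proof.
move=> z0; pose M := Num.max `|z.1| (Num.max z.2 z.2^-1).
exists (Num.truncn M); have := truncnS_gt M; rewrite /M !gt_max.
move=> /andP[h1 /andP[h2 h3]]; split; rewrite /= in_itv/=; first by rewrite -ltr_norml.
by rewrite h2 andbT invf_plt ?posrE ?ltr0Sn.
Qed.

Lemma loc_integrable_measurable f : loc_integrable H f -> measurable_fun (H : set T) (f : T -> R).
Proof.
move=> lf.
have E : H = \bigcup_n exhaust_cl n.
  apply/seteqP; split => z; last by move=> [n _]; exact: exhaust_cl_sub.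
  by move=> /exhaust_cover[n hn]; exists n => //; exact: exhaust_sub_cl.
rewrite E; apply/measurable_fun_bigcup => n.
  by apply: compact_measurable2; exact: exhaust_cl_compact.
have /integrableP[/measurable_EFinP] // := lf _ (@exhaust_cl_compact n) (@exhaust_cl_sub n).
Qed.

Lemma restrict_measurable (f : T -> R) : measurable_fun (H : set T) f -> measurable_fun setT (f \_ H).
Proof. by move=> mf; apply: (measurable_restrictT _ measurable_halfplane).1. Qed.

Lemma loc_integrable_test_bound f phi : loc_integrable H f -> test_function H phi ->
  mu.-integrable setT (EFin \o (fun z : T => (f \_ H) z * phi z)).
Proof.
move=> lf tp; have [M M0 [HB _]] := test_bound tp.
have [sp cK KO] := tp; set K := closure _ in cK KO.
have mK : measurable (K : set T) by exact: compact_measurable2.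
have IK : mu.-integrable setT (EFin \o (f \_ K)).
  by rewrite -restrict_EFin -integrable_mkcond//; exact: lf.
have mf := loc_integrable_measurable lf.
apply: (le_integrable (mu := mu) measurableT (f := fun z : T => ((f \_ H) z * phi z)%:E) (g := fun z : T => (M%:E * `|(f \_ K) z|%:E)%E)).
- apply/measurable_EFinP/measurable_funM; first exact: restrict_measurable.
  by apply: continuous_measurable2; exact: smooth_continuous.
- move=> z _; rewrite -EFinM /= lee_fin normrM (@ger0_norm _ (M * _)) ?mulr_ge0 ?(ltW M0)//.
  have [Kz|nKz] := pselect (K z).
    rewrite mulrC; apply: ler_pM => //.
    by rewrite !patchE !mem_set//; exact: KO.
  have -> : phi z = 0; last by rewrite normr0 mulr0 mulr_ge0// ltW.
  by apply/eqP; apply: contrapT => /negP p0; apply/nKz/subset_closure.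
- by apply: integrableZl => //; exact: integrable_norm.
Qed.

Lemma Rintegral_halfplane f phi : Rintegral mu H (fun x => f x * phi x) =
  \int[mu]_x ((f \_ H) x * phi x).
Proof.
rewrite Rintegral_mkcond; apply: eq_Rintegral => z _; rewrite !patchE.
by case: ifP => // _; rewrite mul0r.
Qed.

End local_integrability.

(** * The fundamental lemma of the calculus of variations *)

Section du_bois_reymond_theorem.
Context {R : realType}.
Local Notation mR := (measurableTypeR R).
Local Notation T := (mR * mR)%type.
Local Notation mu := (@leb2 R).
Local Notation H := (@halfplane R).

(** Smooth functions with values in [[0, 1]] that converge pointwise to the indicator of []a, b[],
    since [flat 0] tends to 1 at infinity. *)
Definition itv_cutoff (n : nat) (a b t : R) : R :=
  flat 0 (n.+1%:R * (t - a)) * flat 0 (n.+1%:R * (b - t)).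

Lemma itv_cutoff_bound n a b t : `|itv_cutoff n a b t| <= 1.
Proof.
rewrite ger0_norm ?mulr_ge0 ?flat_ge0// -[leRHS]mul1r.
by apply: ler_pM; rewrite ?flat_ge0 ?flat0_le1.
Qed.

Lemma itv_cutoff_out n a b t : ~ (a < t < b) -> itv_cutoff n a b t = 0.
Proof.
move=> /negP; rewrite negb_and -!leNgt => /orP[h|h]; rewrite /itv_cutoff.
  by rewrite flat_le0 ?mul0r// pmulr_rle0 ?ltr0Sn// subr_le0.
by rewrite (@flat_le0 _ 0 (_ * (b - t))) ?mulr0// pmulr_rle0 ?ltr0Sn// subr_le0.
Qed.

Lemma smooth_itv_cutoff n a b i : smooth (fun x : R * R => itv_cutoff n a b (pcoord i x)).
Proof.
have H1 := @smooth_flat_affine R 0 i n.+1%:R (- n.+1%:R * a).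
have H2 := @smooth_flat_affine R 0 i (- n.+1%:R) (n.+1%:R * b).
have := smoothM H1 H2; congr smooth; apply/funext => x.
by congr (flat 0 _ * flat 0 _); ring.
Qed.

Lemma flat0_cvg (s : R) : 0 < s -> flat 0 (n.+1%:R * s) @[n --> \oo] --> (1 : R).
Proof.
move=> s0.
have -> : (fun n => flat 0 (n.+1%:R * s)) = (fun n => expR (- (@eps R n * s^-1))).
  by apply/funext => n; rewrite /flat mulr_gt0 ?ltr0Sn// expr0 mul1r invfM.
rewrite -expR0; apply: continuous_cvg; first exact: continuous_expR.
rewrite -[X in _ --> X]oppr0; apply: cvgN; rewrite -[X in _ --> X](mul0r s^-1).
by apply: cvgM; [exact: eps_cvg|exact: cvg_cst].
Qed.

Lemma itv_cutoff_cvg a b t : itv_cutoff n a b t @[n --> \oo] --> ((a < t < b)%R%:R : R).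
Proof.
have [h|h] := boolP (a < t < b); last first.
  by under eq_fun do rewrite (itv_cutoff_out _ (negP h)); exact: cvg_cst.
move: h => /andP[h1 h2]; rewrite /= -[X in _ --> X]mulr1.
by apply: cvgM; apply: flat0_cvg; rewrite subr_gt0.
Qed.

(** Products of interval cutoffs are test functions, because [0 < c] keeps the closed rectangle
    inside the half-plane; they converge boundedly to the indicator of the open rectangle. *)
Lemma rect_integral_eq0 f (a b c d : R) : loc_integrable H f ->
  (forall phi, test_function H phi -> Rintegral mu H (fun x => f x * phi x) = 0) ->
  0 < c -> (\int[mu]_(z in (`]a, b[%classic `*` `]c, d[%classic)) (f z)%:E = 0)%E.
Proof.
move=> lf f0 c0; pose K : set (R * R) := `[a, b]%classic `*` `[c, d]%classic.
have cK : compact K by exact: compact_box.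
have KH : K `<=` H by move=> z [_]; rewrite /= in_itv/= => /andP[h _]; exact: lt_le_trans h.
have mK : measurable (K : set T) by exact: compact_measurable2.
pose Q : set T := `]a, b[%classic `*` `]c, d[%classic.
have mQ : measurable Q by apply: measurableX; exact: measurable_itv.
have QK : Q `<=` K by move=> z [h1 h2]; split; exact: subset_itv_oo_cc.
have IK : mu.-integrable setT (EFin \o (f \_ K)).
  by rewrite -restrict_EFin -integrable_mkcond//; exact: lf.
have IQ : mu.-integrable Q (EFin \o f) by apply: integrableS (lf _ cK KH).
pose phi n (z : R * R) := itv_cutoff n a b (pcoord false z) * itv_cutoff n c d (pcoord true z).
have phi_out n z : ~ K z -> phi n z = 0.
  move=> nK; rewrite /phi; have [h1|h1] := pselect (a < z.1 < b); last by rewrite itv_cutoff_out ?mul0r.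
  rewrite (@itv_cutoff_out _ c d)/= ?mulr0// => h2; apply: nK.
  by apply: QK; split; rewrite /= in_itv.
have tphi n : test_function H (phi n).
  apply: (test_intro _ cK KH); last exact: phi_out.
  by apply: smoothM; exact: smooth_itv_cutoff.
have [] := @Rintegral_dominated_cvg _ _ _ mu (fun n (z : T) => (f \_ K) z * phi n z)
  (fun z => (f \_ K) z * \1_Q z) (fun z => `|(f \_ K) z|).
- move=> n; apply: measurable_funM.
    by have /integrableP[/measurable_EFinP] := IK.
  by apply: continuous_measurable2; exact: smooth_continuous (test_smooth (tphi n)).
- move=> z; apply: cvgM; first exact: cvg_cst.
  have -> : \1_Q z = (a < z.1 < b)%R%:R * (c < z.2 < d)%R%:R :> R.
    rewrite indicE /Q; have [h|h] := boolP (z \in _).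
      by move: h => /set_mem [/=]; rewrite !in_itv/= => -> ->; rewrite mulr1.
    have [h1|h1] := boolP (a < z.1 < b); last by rewrite mul0r.
    have [h2|h2] := boolP (c < z.2 < d); last by rewrite mulr0.
    by exfalso; move/negP: h; apply; rewrite inE; split; rewrite /= in_itv.
  by apply: cvgM; exact: itv_cutoff_cvg.
- exact: integrable_norm IK.
- move=> n z; rewrite normrM -[leRHS]mulr1; apply: ler_wpM2l => //.
  by rewrite normrM -[leRHS]mul1r; apply: ler_pM => //; exact: itv_cutoff_bound.
move=> _; have E n : \int[mu]_z ((f \_ K) z * phi n z) = 0.
  rewrite -(f0 _ (tphi n)) Rintegral_halfplane; apply: eq_Rintegral => z _.
  have [Kz|nK] := pselect (K z); last by rewrite phi_out// !mulr0.
  by rewrite !patchE !mem_set//; exact: KH.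
under eq_fun do rewrite E.
move=> C; have E0 : \int[mu]_z ((f \_ K) z * \1_Q z) = 0.
  by move: C => /cvg_unique; apply => //; exact: cvg_cst.
rewrite -[LHS]fineK; last exact: (integrable_fin_num mQ IQ).
congr EFin; rewrite -[RHS]E0 -/(Rintegral mu Q f) Rintegral_mkcond.
apply: eq_Rintegral => z _; rewrite !patchE indicE.
have [Qz|_] := boolP (z \in Q); last by rewrite mulr0.
by rewrite mulr1 mem_set//; apply: QK; exact: set_mem.
Qed.

(** Integrability only holds away from the boundary and infinity, so the argument is run on each box
    of an exhaustion and countably many null sets are united. As [f] is cut to zero outside the box,
    strips and the plane reduce to rectangles. *)
Lemma du_bois_reymond f : loc_integrable H f ->
  (forall phi, test_function H phi -> Rintegral mu H (fun x => f x * phi x) = 0) ->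
  {ae mu, forall x, H x -> f x = 0}.
Proof.
move=> lf f0.
suff S n : {ae mu, forall x, exhaust n x -> f x = 0}.
  have /ae_foralln := S; apply: filterS => x Hx /exhaust_cover[n]; exact: Hx.
pose B : set T := exhaust n.
have mB : measurable B by exact: exhaust_measurable.
have IB : mu.-integrable B (EFin \o f).
  apply: integrableS (lf _ (@exhaust_cl_compact R n) (@exhaust_cl_sub R n)) => //.
    by apply: compact_measurable2; exact: exhaust_cl_compact.
  exact: exhaust_sub_cl.
pose g := (EFin \o f) \_ B.
have ig : mu.-integrable setT g by rewrite -integrable_mkcond.
have gE (A : set T) : (\int[mu]_(z in A) g z = \int[mu]_(z in A `&` B) (f z)%:E)%E.
  by rewrite /g -integral_mkcondr.
pose r : R := n.+1%:R; have r0 : 0 < r by rewrite ltr0Sn.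
have rect (a b c d : R) : (\int[mu]_(z in (`]a, b[%classic `*` `]c, d[%classic)) g z = 0)%E.
  rewrite gE -[RHS](rect_integral_eq0 (Num.max a (- r)) (Num.min b r) (Num.min d r) lf f0
    (c := Num.max c r^-1)); last by rewrite lt_max invr_gt0 r0 orbT.
  congr integral; apply/seteqP; split => z; rewrite /B /exhaust -/r /= !in_itv/= !gt_max !lt_min.
    by move=> [[/andP[-> ->] /andP[-> ->]] [/andP[-> ->] /andP[-> ->]]].
  by move=> [/andP[/andP[-> ->] /andP[-> ->]] /andP[/andP[-> ->] /andP[-> ->]]].
have all0 A : measurable A -> (\int[mu]_(z in A) g z = 0)%E.
  apply: integral_eq0_rect => //.
  - rewrite -(rect (- r) r r^-1 r) !gE; congr integral; apply/seteqP; split => z.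
      by move=> [_ Bz]; split => //; exact: Bz.
    by move=> [_ Bz].
  - move=> a b; rewrite -(rect a b r^-1 r) !gE; congr integral; apply/seteqP; split => z.
      by move=> [[h _] Bz]; split => //; split => //; case: Bz.
    by move=> [[h _] Bz].
  - move=> c d; rewrite -(rect (- r) r c d) !gE; congr integral; apply/seteqP; split => z.
      by move=> [[_ h] Bz]; split => //; split => //; case: Bz.
    by move=> [[_ h] Bz].
have : ae_eq mu setT g (cst 0%E).
  apply: integral_ae_eq => // A _ mA; rewrite all0// integral0//.
apply: filterS => x /(_ I) + Bx; rewrite /g patchE mem_set//= => -[]//.
Qed.

End du_bois_reymond_theorem.

(** * Calculus of bounds on Lebesgue norms *)

Section Lebesgue_bounds.
Context d (T : measurableType d) (R : realType).
Context (mu : {measure set T -> \bar R}).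

Lemma ge0_in_itv (x : \bar R) : (0 <= x)%E -> x \in `[0%E, +oo%E].
Proof. by move=> x0; rewrite in_itv/= x0 leey. Qed.

Lemma Lnorm_le_integral (p B : R) (G : T -> \bar R) : 0 < p -> 0 <= B ->
  ('N[mu]_(p%:E)[G] <= B%:E)%E <-> (\int[mu]_x (`|G x| `^ p) <= (B `^ p)%:E)%E.
Proof.
move=> p0 B0; have I0 : (0 <= \int[mu]_x (`|G x| `^ p))%E.
  by apply: integral_ge0 => x _; exact: poweR_ge0.
rewrite -(@poweR_Lnorm _ _ _ mu G p) ?gt_eqF//; have N0 := Lnorm_ge0 mu p%:E G.
split=> h.
  rewrite -poweR_EFin; apply: (gt0_ler_poweR (ltW p0)) h.
    exact: ge0_in_itv.
  by apply: ge0_in_itv; rewrite lee_fin.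
move: h; rewrite -poweR_EFin => h.
have pi0 : 0 <= p^-1 by rewrite invr_ge0 ltW.
have := @gt0_ler_poweR _ p^-1 pi0 _ _ _ _ h; rewrite -!poweRrM mulfV ?gt_eqF// !poweRe1 ?lee_fin//.
by apply; apply: ge0_in_itv; exact: poweR_ge0.
Qed.

Lemma measurable_abse_poweR (p : R) (G : T -> \bar R) : measurable_fun setT G ->
  measurable_fun setT (fun x => `|G x| `^ p)%E.
Proof.
move=> mG; apply: (measurableT_comp (measurable_poweR p)).
exact: measurableT_comp.
Qed.

Lemma Lnorm_le_ae (p : R) (F G : T -> \bar R) : 0 < p ->
  measurable_fun setT F -> measurable_fun setT G ->
  {ae mu, forall x, (`|F x| <= `|G x|)%E} -> ('N[mu]_(p%:E)[F] <= 'N[mu]_(p%:E)[G])%E.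
Proof.
move=> p0 mF mG FG; rewrite unlock /Lnorm; apply: gt0_ler_poweR.
- by rewrite invr_ge0 ltW.
- by apply: ge0_in_itv; apply: integral_ge0 => x _; exact: poweR_ge0.
- by apply: ge0_in_itv; apply: integral_ge0 => x _; exact: poweR_ge0.
apply: ae_ge0_le_integral => //; try by move=> x _; exact: poweR_ge0.
- exact: measurable_abse_poweR.
- exact: measurable_abse_poweR.
apply: filterS FG => x FGx _; apply: (gt0_ler_poweR (ltW p0)) => //; exact: ge0_in_itv.
Qed.

(** The bound is a real number and measurability travels with it, so that estimates are added and
    scaled in [R]. *)
Definition Lp_bounded (p B : R) (F : T -> R) :=
  measurable_fun setT F /\ ('N[mu]_(p%:E)[EFin \o F] <= B%:E)%E.

Lemma Lp_bounded_ge0 p B F : Lp_bounded p B F -> 0 <= B.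
Proof. by move=> [_ h]; rewrite -lee_fin (le_trans _ h)// Lnorm_ge0. Qed.

Lemma Lp_bounded_le p B B' F : B <= B' -> Lp_bounded p B F -> Lp_bounded p B' F.
Proof. by move=> BB [mF h]; split => //; apply: le_trans h _; rewrite lee_fin. Qed.

Lemma Lp_bounded_ae p B (F G : T -> R) : 0 < p -> measurable_fun setT F -> Lp_bounded p B G ->
  {ae mu, forall x, `|F x| <= `|G x|} -> Lp_bounded p B F.
Proof.
move=> p0 mF [mG h] FG; split => //; apply: le_trans h; apply: Lnorm_le_ae => //.
- exact/measurable_EFinP.
- exact/measurable_EFinP.
Qed.

Lemma Lp_boundedD p B B' (F G : T -> R) : 1 <= p -> Lp_bounded p B F -> Lp_bounded p B' G ->
  Lp_bounded p (B + B') (fun x => F x + G x).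
Proof.
move=> p1 [mF hF] [mG hG]; split; first exact: measurable_funD.
by rewrite EFinD; apply: le_trans (leeD hF hG); exact: minkowski_EFin.
Qed.

Lemma Lp_boundedZ p B c (F : T -> R) : 0 < p -> Lp_bounded p B F ->
  Lp_bounded p (`|c| * B) (fun x => c * F x).
Proof.
move=> p0 hF; have B0 := Lp_bounded_ge0 hF; case: hF => mF hF.
have mcF : measurable_fun setT (fun x => c * F x) by exact: measurable_funM.
split=> //; apply/Lnorm_le_integral => //; first by rewrite mulr_ge0.
have -> : (\int[mu]_x `|(EFin \o (fun x => (c * F x)%R)) x| `^ p =
    \int[mu]_x ((`|c| `^ p)%:E * `|(EFin \o F) x| `^ p))%E.
  by apply: eq_integral => x _; rewrite /= normrM powRM.
rewrite ge0_integralZl_EFin ?powR_ge0//; last 2 first.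
- by move=> x _; exact: poweR_ge0.
- by apply: measurable_abse_poweR; exact/measurable_EFinP.
rewrite powRM// EFinM; apply: lee_wpmul2l; first by rewrite lee_fin powR_ge0.
by apply/Lnorm_le_integral.
Qed.

Lemma powR_lin_bound (p x : R) : 1 <= p -> 0 <= x -> x <= 1 + x `^ p.
Proof.
move=> p1 x0; have [x1|x1] := leP x 1; first by rewrite (le_trans x1)// lerDl powR_ge0.
apply: (@le_trans _ _ (x `^ p)); last by rewrite lerDr.
rewrite -[leLHS]powRr1//; apply: ler_powR => //; exact: ltW.
Qed.

Lemma Lp_bounded_integrable p B (F : T -> R) (D : set T) : 1 <= p -> Lp_bounded p B F ->
  measurable D -> (mu D < +oo)%E -> mu.-integrable D (EFin \o F).
Proof.
move=> p1 hF mD muD; have p0 : 0 < p by lra.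
have B0 := Lp_bounded_ge0 hF; case: hF => mF hN.
have hF := (Lnorm_le_integral (EFin \o F) p0 B0).1 hN.
have mFD : measurable_fun D (EFin \o F) by apply/measurable_EFinP; exact: measurable_funTS.
have mP : measurable_fun setT (fun x => `|(EFin \o F) x| `^ p)%E.
  by apply: measurable_abse_poweR; exact/measurable_EFinP.
apply/integrableP; split => //.
apply: (@le_lt_trans _ _ (\int[mu]_(x in D) (1 + `|(EFin \o F) x| `^ p))%E).
  apply: ge0_integral_mono => x _ //=; rewrite -?EFinD lee_fin; exact: powR_lin_bound.
rewrite ge0_integralD//; last 2 first.
- by move=> x _; exact: poweR_ge0.
- exact: measurable_funTS.
rewrite integral_cst// mul1e; apply: lte_add_pinfty => //.
apply: (@le_lt_trans _ _ (B `^ p)%:E); last by rewrite ltry.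
apply: le_trans hF; apply: ge0_subset_integral => //.
by move=> x _; exact: poweR_ge0.
Qed.

End Lebesgue_bounds.

(** * The Hardy-Littlewood-Sobolev inequality for norms *)

Section riesz_bounds.
Context {R : realType}.
Local Notation mR := (measurableTypeR R).
Local Notation T := (mR * mR)%type.
Local Notation mu := (@leb2 R).

Lemma hls_Lnorm (p q : R) : 1 < p -> p < 2 -> q = 2 * p / (2 - p) ->
  exists2 C : R, 0 <= C & forall (F : T -> R) (B : R), Lp_bounded mu p B F ->
    ('N[mu]_(q%:E)[riesz (fun y => `|F y|%R)] <= (C * B)%:E)%E.
Proof.
move=> p1 p2 qE; have [C C0 H] := hls p1 p2 qE; have p0 : 0 < p by lra.
have q0 : 0 < q by rewrite qE divr_gt0; lra.
exists (C `^ q^-1) => [|F B hF]; first exact: powR_ge0.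
have B0 := Lp_bounded_ge0 hF; have [mF _] := hF.
have mA : measurable_fun setT (fun y => `|F y|) by exact: measurableT_comp.
have S (B' : R) : 0 < B' -> B <= B' ->
    ('N[mu]_(q%:E)[riesz (fun y => `|F y|%R)] <= (C `^ q^-1 * B')%:E)%E.
  move=> B'0 BB; apply/Lnorm_le_integral => //; first by rewrite mulr_ge0 ?powR_ge0// ltW.
  rewrite powRM ?powR_ge0 ?(ltW B'0)// -powRrM mulVf ?gt_eqF// powRr1//.
  have [_ hN] := Lp_bounded_le BB hF; have hp := (Lnorm_le_integral mu (EFin \o F) p0 (ltW B'0)).1 hN.
  apply: le_trans (H (fun y => `|F y|) B' B'0 mA (fun=> normr_ge0 _) hp).
  apply: ge0_integral_mono => x _; first exact: poweR_ge0.
  by rewrite gee0_abs// riesz_ge0.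
(* The inequality [hls] is stated for positive bounds and [B] may be 0, so [B] is enlarged slightly;
   the 1 in the denominator covers a vanishing constant. *)
apply/lee_addgt0Pr => e e0; have K0 : 0 < C `^ q^-1 + 1 by rewrite ltr_wpDl ?powR_ge0.
have d0 : 0 < e / (C `^ q^-1 + 1) by rewrite divr_gt0.
apply: (le_trans (S (B + e / (C `^ q^-1 + 1)) _ _)); first by rewrite ltr_wpDl.
  by rewrite lerDl ltW.
rewrite -EFinD lee_fin mulrDr lerD2l mulrCA ler_piMr ?(ltW e0)//.
by rewrite ler_pdivrMr// mul1r lerDl.
Qed.

End riesz_bounds.

(** * Convolution and its transposition onto test functions *)

Section convolution.
Context {R : realType}.
Local Notation mR := (measurableTypeR R).
Local Notation T := (mR * mR)%type.
Local Notation mu := (@leb2 R).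
Implicit Types (k F : T -> R) (phi : R * R -> R).

(** Real valued: the value is 0 at points where the integral is infinite, so that identities between
    convolutions are claimed almost everywhere or under an integral. *)
Definition convol k F (x : R * R) : R := \int[mu]_y (k (x - y : R * R) * F y).

Lemma measurable_Rintegral (h : T * T -> R) : measurable_fun setT h ->
  measurable_fun setT (fun x : T => \int[mu]_y h (x, y)).
Proof.
move=> mh; have {}mh : measurable_fun setT (EFin \o h) by exact/measurable_EFinP.
apply: (measurableT_comp (@fine_measurable R setT measurableT)).
have -> : (fun x : T => \int[mu]_y (h (x, y))%:E)%E =
    (fun x : T => \int[mu]_y (EFin \o h)^\+ (x, y) - \int[mu]_y (EFin \o h)^\- (x, y))%E.
  apply/funext => x; rewrite [LHS]integralE.
  by congr (_ - _)%E; apply: eq_integral => y _; rewrite ?funeposE ?funenegE.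
apply: emeasurable_funB; apply: measurable_fun_fubini_tonelli_F => //.
  exact: measurable_funepos.
exact: measurable_funeneg.
Qed.

Lemma measurable_convolution k F : measurable_fun setT k -> measurable_fun setT F ->
  measurable_fun setT (convol k F : T -> R).
Proof. by move=> mk mF; exact: (measurable_Rintegral (measurable_convol mk mF)). Qed.

Lemma convol_le k F x : kernel_like k -> measurable_fun setT F ->
  (`|convol k F x|%:E <= riesz (fun y => `|F y|%R) x)%E.
Proof.
move=> [mk hk] mF; rewrite /convol /Rintegral.
set J := (\int[mu]_y _)%E; apply: (@le_trans _ _ `|J|%E).
  by case: J => [r||] //=; rewrite normr0 leey.
apply: le_trans (le_abse_integral _ _ _) _ => //.
  by apply/measurable_EFinP; exact: measurable_convol1.
apply: ge0_integral_mono => y _ //=; rewrite lee_fin normrM; exact: ler_wpM2r.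
Qed.

(** What Fubini needs from the Hardy-Littlewood-Sobolev bound: the potential of [|F|] is finite
    almost everywhere and integrable against test functions. *)
Definition riesz_finite F := measurable_fun setT F /\
  exists2 q : R, 1 <= q & (\int[mu]_x (riesz (fun y => `|F y|%R) x `^ q) < +oo)%E.

Lemma riesz_finite_ae F : riesz_finite F ->
  {ae mu, forall x : T, (riesz (fun y => `|F y|%R) x < +oo)%E}.
Proof.
move=> [mF [q q1 hq]]; have q0 : q != 0 by lra.
have mA : measurable_fun setT (fun y => `|F y|) by exact: measurableT_comp.
have mr := measurable_riesz mA (fun=> normr_ge0 _).
have : mu.-integrable setT (fun x : T => riesz (fun y => `|F y|%R) x `^ q)%E.
  apply/integrableP; split; first exact: (measurableT_comp (measurable_poweR q)).
  under eq_integral => z _ do rewrite gee0_abs ?poweR_ge0//; exact: hq.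
move=> /integrable_ae => /(_ measurableT); apply: filterS => x /(_ I).
have : (0 <= riesz (fun y => `|F y|%R) x)%E by exact: riesz_ge0.
by case: (riesz _ x) => [r _ _||] //=; rewrite ?ltry// (negbTE q0).
Qed.

Lemma convol_integrable k F : kernel_like k -> riesz_finite F ->
  {ae mu, forall x : T, mu.-integrable setT (fun y : T => (k (x - y : R * R) * F y)%:E)}.
Proof.
move=> [mk hk] rF; have [mF _] := rF; have := riesz_finite_ae rF; apply: filterS => x hx.
apply/integrableP; split.
  by apply/measurable_EFinP; exact: measurable_convol1.
apply: le_lt_trans hx; apply: ge0_integral_mono => y _ //=; rewrite lee_fin normrM.
exact: ler_wpM2r.
Qed.

Lemma riesz_mul_test_lty F phi : riesz_finite F -> test_function setT phi ->
  (\int[mu]_x (riesz (fun y => `|F y|%R) x * `|phi x|%:E) < +oo)%E.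
Proof.
move=> [mF [q q1 hq]] tp; have [M M0 [HB HM]] := test_bound tp.
have mA : measurable_fun setT (fun y => `|F y|) by exact: measurableT_comp.
have mr := measurable_riesz mA (fun=> normr_ge0 _).
have r0 x : (0 <= riesz (fun y => `|F y|%R) x)%E by exact: riesz_ge0.
have mB := @measurable_ball2 R M.
apply: (@le_lt_trans _ _ (\int[mu]_x (M%:E * ((\1_[set z : R * R | `|z| < M] x)%:E +
    riesz (fun y => `|F y|%R) x `^ q)))%E).
  apply: ge0_integral_mono => x _; first by rewrite mule_ge0.
  have [xM|xM] := leP M `|x|; first by rewrite HM// normr0 mule0 mule_ge0 ?lee_fin ?(ltW M0)// adde_ge0 ?poweR_ge0.
  rewrite muleC; apply: lee_pmul => //; first by rewrite lee_fin.
  rewrite indicE mem_set//=; have := r0 x; case: (riesz _ x) => [r|_|] //=; last first.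
    by rewrite gt_eqF ?(lt_le_trans _ q1)// addey// leey.
  by rewrite lee_fin => r_ge0; rewrite -EFinD lee_fin; exact: powR_lin_bound.
have mi : measurable_fun setT (fun x : T => (\1_([set z : R * R | `|z| < M] : set T) x : R)%:E).
  by apply/measurable_EFinP; exact: measurable_indic.
have mp : measurable_fun setT (fun x : T => riesz (fun y => `|F y|%R) x `^ q)%E.
  exact: (measurableT_comp (measurable_poweR q)).
rewrite ge0_integralZl_EFin ?(ltW M0)//; last 2 first.
- by move=> x _; rewrite adde_ge0 ?poweR_ge0 ?lee_fin.
- exact: emeasurable_funD.
rewrite lte_mul_pinfty ?lee_fin ?(ltW M0)//.
rewrite ge0_integralD//; try by move=> x _; rewrite ?poweR_ge0 ?lee_fin.
apply: lte_add_pinfty => //; rewrite integral_indic// setIT.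
by apply: (@le_lt_trans _ _ (4 * M ^+ 2)%:E); rewrite ?ltry//; rewrite le_eqVlt; apply/orP; left; apply/eqP/leb2_ball/ltW.
Qed.

Lemma measurable_corr_integrand k F phi : measurable_fun setT k -> measurable_fun setT F ->
  continuous phi ->
  measurable_fun setT (fun z : T * T => (k (z.1 - z.2 : R * R) * F z.2 * phi z.1)%:E).
Proof.
move=> mk mF cp; apply/measurable_EFinP; apply: measurable_funM; first exact: measurable_convol.
apply: (measurableT_comp _ measurable_fst); exact: continuous_measurable2.
Qed.

(** After domination of [k] by [rk], integrating in [y] first leaves the potential of [|F|] against
    [|phi|]. *)
Lemma corr_integrand_integrable k F phi : kernel_like k -> riesz_finite F ->
  test_function setT phi ->
  (mu \x mu)%E.-integrable setT (fun z : T * T => (k (z.1 - z.2 : R * R) * F z.2 * phi z.1)%:E).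
Proof.
move=> kk rF tp; have [mk hk] := kk; have [mF _] := rF.
have mA : measurable_fun setT (fun y => `|F y|) by exact: measurableT_comp.
have m := measurable_corr_integrand mk mF (smooth_continuous (test_smooth tp)).
apply/(integrable12ltyP mu mu m); apply: le_lt_trans (riesz_mul_test_lty rF tp).
apply: ge0_integral_mono => x _; first exact: integral_ge0.
rewrite muleC /riesz -ge0_integralZl_EFin//; last 2 first.
- by move=> y _; rewrite lee_fin mulr_ge0 ?rk_ge0.
- by apply/measurable_EFinP; apply: measurable_convol1 => //; exact: measurable_rk.
apply: ge0_integral_mono => y _ //=; rewrite -EFinM lee_fin !normrM mulrC.
by apply: ler_wpM2l => //; exact: ler_wpM2r.
Qed.

Lemma corr_shift k phi y : kernel_like k -> test_function setT phi ->
  (\int[mu]_x (k (x - y : R * R) * phi x)%:E = (corr k phi y)%:E)%E.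
Proof.
move=> kk tp; have ki := corr_integrable y kk tp; have [mk hk] := kk.
have mphi := continuous_measurable2 (smooth_continuous (test_smooth tp)).
have mg : measurable_fun setT (fun x : T => (k (x - y : R * R) * phi x)%:E).
  apply/measurable_EFinP; apply: measurable_funM => //.
  exact: (measurableT_comp mk (mpres_shift (- y)).1).
rewrite -(mpres_integral (mpres_shift y) mg).
under eq_integral => x _ do rewrite addrK (addrC x y).
by rewrite /corr /Rintegral fineK//; exact: integrable_fin_num.
Qed.

Lemma convol_corr k F phi : kernel_like k -> riesz_finite F -> test_function setT phi ->
  mu.-integrable setT (fun y : T => (F y * corr k phi y)%:E) /\
  \int[mu]_x (convol k F x * phi x) = \int[mu]_y (F y * corr k phi y).
Proof.
move=> kk rF tp; have [mk hk] := kk; have [mF _] := rF.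
have ii := corr_integrand_integrable kk rF tp.
have GE y : (\int[mu]_x (k (x - y : R * R) * F y * phi x)%:E = (F y * corr k phi y)%:E)%E.
  rewrite EFinM -(corr_shift y kk tp) -integralZl//; last first.
    have [_ h] := mpres_shift y; have ki := corr_integrable y kk tp.
    have := mpres_integrable (mpres_shift (- y)) ki; apply: eq_integrable => // x _ /=.
    by rewrite addrCA subrr addr0.
  by apply: eq_integral => x _; rewrite -EFinM mulrCA mulrA.
split.
  have mG := measurable_fubini_G ii; rewrite /fubini_G in mG.
  have mh := measurable_corr_integrand mk mF (smooth_continuous (test_smooth tp)).
  have lt := (integrable21ltyP mu mu mh).1 ii.
  under eq_fun do rewrite -GE; apply/integrableP; split => //.
  apply: le_lt_trans lt; apply: ge0_integral_mono => y _ //.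
  apply: le_abse_integral => //.
  exact: (measurableT_comp mh (measurable_fun_pair (@measurable_id _ _ setT) (measurable_cst y))).
(* The inner integral of Fubini is extended real valued; it agrees with the real [convol] only where
   the convolution integral converges, that is almost everywhere. *)
rewrite /Rintegral; congr fine; under [RHS]eq_integral do rewrite -GE.
rewrite -[RHS](Fubini ii); apply: ae_eq_integral => //.
- apply/measurable_EFinP/measurable_funM; first exact: measurable_convolution.
  by apply: continuous_measurable2; exact: smooth_continuous (test_smooth tp).
- exact: measurable_fubini_F ii.
apply: filterS (convol_integrable kk rF) => x hx _.
rewrite mulrC EFinM /convol /Rintegral fineK; last exact: integrable_fin_num.
by rewrite -integralZl//; apply: eq_integral => y _; rewrite -EFinM mulrC.
Qed.

End convolution.

(** * Cutoffs at infinity and at the boundary *)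

Section dilated_cutoff.
Context {R : realType}.

(** Dilation by [n + 1] makes the gradient of order [eps n], so it disappears in the limit. *)
Definition dilated_cutoff (n : nat) : R * R -> R :=
  @plane_cutoff R \o scale2 (eps n, eps n) (0, 0).

Lemma smooth_dilated_cutoff n : smooth (dilated_cutoff n).
Proof. by apply: smooth_scale2; exact: test_smooth (@test_plane_cutoff R). Qed.

Lemma dilated_cutoff_bound : exists2 M : R, 0 < M & forall n z,
  `|dilated_cutoff n z| <= M /\ forall i, `|partial i (dilated_cutoff n) z| <= eps n * M.
Proof.
have [M0 M00 [H0 _]] := test_bound (@test_plane_cutoff R).
have [M1 M10 [H1 _]] := test_bound (test_partial false (@test_plane_cutoff R)).
have [M2 M20 [H2 _]] := test_bound (test_partial true (@test_plane_cutoff R)).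
exists (M0 + M1 + M2) => [|n z]; first by rewrite !addr_gt0.
split; first by apply: le_trans (H0 _) _; lra.
move=> i; rewrite /dilated_cutoff partial_scale2; last first.
  by apply: smooth_derivable; exact: test_smooth (@test_plane_cutoff R).
have -> : pcoord i (@eps R n, @eps R n) = eps n by case: i.
rewrite normrM (ger0_norm (ltW (eps_gt0 n))); apply: (ler_wpM2l (ltW (eps_gt0 n))).
case: i; first by apply: le_trans (H2 _) _; lra.
by apply: le_trans (H1 _) _; lra.
Qed.

Lemma dilated_cutoff_out n z : n.+1%:R <= `|z| -> dilated_cutoff n z = 0.
Proof.
rewrite normr2E le_max /dilated_cutoff /plane_cutoff /= !addr0.
have n0 : 0 < n.+1%:R :> R by rewrite ltr0Sn.
have h1 (t : R) : n.+1%:R <= `|t| -> 1 <= `|eps n * t|.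
  by move=> h; rewrite normrM (ger0_norm (ltW (eps_gt0 n))) /eps ler_pdivlMl ?mulr1.
by move=> /orP[/h1 h|/h1 h]; rewrite (cutoff_out h) ?mul0r ?mulr0.
Qed.

Lemma dilated_cutoff_cvg z : dilated_cutoff n z @[n --> \oo] --> (1 : R).
Proof.
have E (t : R) : cutoff (eps n * t + 0) @[n --> \oo] --> (1 : R).
  have C : eps n * t + 0 @[n --> \oo] --> (0 : R).
    rewrite -[X in _ --> X](addr0 (0 : R)) -[X in _ --> X + _](mul0r t).
    by apply: cvgD; [apply: cvgM; [exact: eps_cvg|exact: cvg_cst]|exact: cvg_cst].
  rewrite -(@cutoff0 R); apply: continuous_cvg => //; exact: continuous_cutoff.
by rewrite -[X in _ --> X](mulr1 1); apply: cvgM; exact: E.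
Qed.

(** Zero within [eps n] of the boundary and tending to 1 inside. Its normal derivative is unbounded
    in [n], but its tangential derivative is zero. *)
Definition boundary_cutoff (n : nat) (z : R * R) : R := flat 0 (n.+1%:R * pcoord true z + - 1).

Lemma smooth_boundary_cutoff n : smooth (boundary_cutoff n).
Proof. exact: smooth_flat_affine. Qed.

Lemma boundary_cutoff_bound n z : `|boundary_cutoff n z| <= 1.
Proof. by rewrite ger0_norm ?flat_ge0//; exact: flat0_le1. Qed.

Lemma boundary_cutoff_out n z : z.2 < eps n -> boundary_cutoff n z = 0.
Proof.
move=> h; apply: flat_le0; rewrite subr_le0 /= mulrC -ler_pdivlMr ?ltr0Sn// mul1r; exact: ltW.
Qed.

Lemma partial_boundary_cutoff n z : partial false (boundary_cutoff n) z = 0.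
Proof.
rewrite partial_ins /boundary_cutoff /ins/=.
by rewrite derive1E (_ : (fun t : R => _) = cst (flat 0 (n.+1%:R * z.2 - 1)))// derive_cst.
Qed.

Lemma boundary_cutoff_cvg z : halfplane z -> boundary_cutoff n z @[n --> \oo] --> (1 : R).
Proof.
move=> z0; have z0' : 0 < z.2 by [].
have C : expR (- (eps n * (z.2 - eps n)^-1)) @[n --> \oo] --> (1 : R).
  rewrite -expR0; apply: continuous_cvg; first exact: continuous_expR.
  rewrite -[X in _ --> X]oppr0; apply: cvgN; rewrite -[X in _ --> X](mul0r z.2^-1).
  apply: cvgM; first exact: eps_cvg.
  apply: cvgV; first by rewrite gt_eqF.
  by rewrite -[X in _ --> X]subr0; apply: cvgB; [exact: cvg_cst|exact: eps_cvg].
apply: cvg_trans C; apply: near_eq_cvg; near=> n.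
have en : eps n < z.2.
  by near: n; have /cvgrPdist_lt/(_ _ z0') := @eps_cvg R; apply: filterS => n; rewrite sub0r normrN; apply: le_lt_trans; exact: ler_norm.
have E : n.+1%:R * z.2 + - 1 = n.+1%:R * (z.2 - eps n).
  by rewrite mulrBr /eps mulfV// lt0r_neq0// ltr0Sn.
by rewrite /boundary_cutoff /flat /= E mulr_gt0 ?ltr0Sn ?subr_gt0// expr0 mul1r invfM.
Unshelve. all: end_near. Qed.

End dilated_cutoff.

(** * Weak derivatives against functions without compact support *)

Section weak_partial_extension.
Context {R : realType}.
Local Notation mR := (measurableTypeR R).
Local Notation T := (mR * mR)%type.
Local Notation mu := (@leb2 R).
Local Notation H := (@halfplane R).
Implicit Types (f g : R * R -> R).

(** The booleans are read as numbers: the multi-index is [(1, 0)] for [false] and [(0, 1)] for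
    [true]. *)
Definition weak_partial i f g := is_weak_deriv H (~~ i) i f g.

Lemma weak_partialE i f g phi : weak_partial i f g -> test_function H phi ->
  \int[mu]_x ((f \_ H) x * partial i phi x) = - \int[mu]_x ((g \_ H) x * phi x).
Proof.
move=> [_ _ W] tp; have := W _ tp; rewrite !Rintegral_halfplane.
by case: i {W} => /=; rewrite expr1 mulN1r.
Qed.

Lemma mul_bounded_integrable (F h : T -> R) (M : R) : mu.-integrable setT (EFin \o F) ->
  measurable_fun setT h -> (forall x, `|h x| <= M) ->
  mu.-integrable setT (EFin \o (fun x => F x * h x)).
Proof.
move=> iF mh hM; have /integrableP[/measurable_EFinP mF _] := iF.
apply: (le_integrable (mu := mu) measurableT (f := fun x : T => (F x * h x)%:E)
  (g := fun x : T => (M%:E * (F x)%:E)%E)).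
- by apply/measurable_EFinP; exact: measurable_funM.
- move=> x _ /=; rewrite lee_fin !normrM mulrC; apply: ler_wpM2r => //.
  by apply: le_trans (hM x) _; exact: ler_norm.
- exact: integrableZl.
Qed.

(** Multiplying [Psi] by a dilated cutoff yields a test function, thanks to the gap. The extra term
    with the derivative of the cutoff carries a factor [eps n] and is dominated by a multiple of
    [|f * Psi|]. *)
Lemma weak_partial_gap i f g (Psi : R * R -> R) (c : R) : weak_partial i f g ->
  0 < c -> smooth Psi -> (forall y, y.2 < c -> Psi y = 0) ->
  mu.-integrable setT (EFin \o (fun y : T => (f \_ H) y * Psi y)) ->
  mu.-integrable setT (EFin \o (fun y : T => (f \_ H) y * partial i Psi y)) ->
  mu.-integrable setT (EFin \o (fun y : T => (g \_ H) y * Psi y)) ->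
  \int[mu]_y ((f \_ H) y * partial i Psi y) = - \int[mu]_y ((g \_ H) y * Psi y).
Proof.
move=> W c0 sP gap i1 i2 i3; have [lf lg _] := W.
have mf0 := restrict_measurable (loc_integrable_measurable lf).
have mg0 := restrict_measurable (loc_integrable_measurable lg).
have mP := continuous_measurable2 (smooth_continuous sP).
have [M M0 HM] := @dilated_cutoff_bound R.
have sc := @smooth_dilated_cutoff R.
have mc n := continuous_measurable2 (smooth_continuous (sc n)).
have tn n : test_function H (fun y => dilated_cutoff n y * Psi y).
  pose K : set (R * R) := `[- n.+1%:R, n.+1%:R]%classic `*` `[c, n.+1%:R]%classic.
  apply: (@test_intro _ _ K); first exact: smoothM.
  - exact: compact_box.
  - by move=> z [_]; rewrite /= in_itv/= => /andP[h _]; exact: lt_le_trans h.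
  move=> z nK; have [z2|z2] := ltP z.2 c; first by rewrite gap ?mulr0.
  have [zn|zn] := leP n.+1%:R `|z|; first by rewrite dilated_cutoff_out ?mul0r.
  exfalso; apply: nK; move: zn; rewrite normr2E gt_max !ltr_norml => /andP[/andP[h1 h2] /andP[_ h3]].
  by split; rewrite /= in_itv/= ?z2 ?(ltW h1) ?(ltW h2) ?(ltW h3).
have pE n y : partial i (fun y => dilated_cutoff n y * Psi y) y =
    dilated_cutoff n y * partial i Psi y + Psi y * partial i (dilated_cutoff n) y.
  by apply: partialM; exact: smooth_derivable.
have E n := weak_partialE W (tn n).
have mdP := continuous_measurable2 (smooth_continuous (smooth_partial i sP)).
have mdc n := continuous_measurable2 (smooth_continuous (smooth_partial i (sc n))).
have [] := @Rintegral_dominated_cvg _ _ _ mu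
  (fun n (y : T) => (f \_ H) y * partial i (fun y => dilated_cutoff n y * Psi y) y)
  (fun y => (f \_ H) y * partial i Psi y)
  (fun y => M * `|(f \_ H) y * partial i Psi y| + M * `|(f \_ H) y * Psi y|).
- move=> n; apply: measurable_funM => //.
  exact: continuous_measurable2 (smooth_continuous (smooth_partial i (test_smooth (tn n)))).
- move=> y; under eq_fun do rewrite pE; apply: cvgM; first exact: cvg_cst.
  rewrite -[X in _ --> X]addr0 -[X in _ --> X + _]mul1r -[X in _ --> _ + X](mulr0 (Psi y)).
  apply: cvgD; apply: cvgM; try exact: cvg_cst; first exact: dilated_cutoff_cvg.
  apply: (@norm_cvg0 R R); apply: (@squeeze_cvgr _ _ _ _ (fun=> 0) (fun n => eps n * M)).
  + by apply: nearW => n; rewrite normr_ge0 (HM n y).2.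
  + exact: cvg_cst.
  + by rewrite -[X in _ --> X](mul0r M); apply: cvgM; [exact: eps_cvg|exact: cvg_cst].
- have := integrableD measurableT (integrableZl measurableT M (integrable_norm i2))
    (integrableZl measurableT M (integrable_norm i1)).
  by apply: eq_integrable.
- move=> n y; rewrite pE mulrDr; apply: le_trans (ler_normD _ _) _; apply: lerD.
    rewrite mulrCA normrM; apply: ler_wpM2r => //; exact: (HM n y).1.
  rewrite mulrA normrM mulrC; apply: ler_wpM2r => //.
  apply: le_trans ((HM n y).2 i) _; rewrite ler_piMl ?(ltW M0)//.
  by rewrite invf_le1 ?ltr0Sn// ler1n.
move=> _ C1.
have [] := @Rintegral_dominated_cvg _ _ _ mu
  (fun n (y : T) => (g \_ H) y * (dilated_cutoff n y * Psi y))
  (fun y => (g \_ H) y * Psi y)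
  (fun y => M * `|(g \_ H) y * Psi y|).
- by move=> n; apply: measurable_funM => //; exact: measurable_funM.
- move=> y; apply: cvgM; first exact: cvg_cst; rewrite -[X in _ --> X]mul1r.
  by apply: cvgM; [exact: dilated_cutoff_cvg|exact: cvg_cst].
- exact: (integrableZl measurableT M (integrable_norm i3)).
- by move=> n y; rewrite mulrCA normrM; apply: ler_wpM2r => //; exact: (HM n y).1.
move=> _ C2; have C3 := cvgN C2.
have EE : (fun n => \int[mu]_y ((f \_ H) y * partial i (fun y => dilated_cutoff n y * Psi y) y)) =
    (fun n => - \int[mu]_y ((g \_ H) y * (dilated_cutoff n y * Psi y))).
  by apply/funext => n; exact: E.
by rewrite EE in C1; move: C1 => /cvg_unique; apply => //; exact: C3.
Qed.

(* No gap from the boundary is needed: a cutoff depending on the normal variable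
   only commutes with the tangential derivative. *)
Lemma weak_partial_tangential f g (Psi : R * R -> R) : weak_partial false f g -> smooth Psi ->
  mu.-integrable setT (EFin \o (fun y : T => (f \_ H) y * Psi y)) ->
  mu.-integrable setT (EFin \o (fun y : T => (f \_ H) y * partial false Psi y)) ->
  mu.-integrable setT (EFin \o (fun y : T => (g \_ H) y * Psi y)) ->
  \int[mu]_y ((f \_ H) y * partial false Psi y) = - \int[mu]_y ((g \_ H) y * Psi y).
Proof.
move=> W sP i1 i2 i3.
have sb := @smooth_boundary_cutoff R.
have mb n := continuous_measurable2 (smooth_continuous (sb n)).
have bb := @boundary_cutoff_bound R.
have pE n y : partial false (fun y => Psi y * boundary_cutoff n y) y =
    partial false Psi y * boundary_cutoff n y.
  rewrite partialM; [|exact: smooth_derivable|exact: smooth_derivable].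
  by rewrite partial_boundary_cutoff mulr0 add0r mulrC.
have E n : \int[mu]_y ((f \_ H) y * partial false Psi y * boundary_cutoff n y) =
    - \int[mu]_y ((g \_ H) y * Psi y * boundary_cutoff n y).
  have e1 : \int[mu]_y ((f \_ H) y * partial false Psi y * boundary_cutoff n y) =
      \int[mu]_y ((f \_ H) y * partial false (fun y => Psi y * boundary_cutoff n y) y).
    by apply: eq_Rintegral => y _; rewrite pE mulrA.
  have e2 : \int[mu]_y ((g \_ H) y * Psi y * boundary_cutoff n y) =
      \int[mu]_y ((g \_ H) y * (Psi y * boundary_cutoff n y)).
    by apply: eq_Rintegral => y _; rewrite mulrA.
  rewrite e1 e2; apply: (@weak_partial_gap false f g _ (eps n) W (eps_gt0 n)).
  - exact: smoothM.
  - by move=> y h; rewrite boundary_cutoff_out ?mulr0.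
  - have := mul_bounded_integrable i1 (mb n) (bb n).
    by apply: eq_integrable => // y _ /=; rewrite mulrA.
  - have := mul_bounded_integrable i2 (mb n) (bb n).
    by apply: eq_integrable => // y _ /=; rewrite pE mulrA.
  - have := mul_bounded_integrable i3 (mb n) (bb n).
    by apply: eq_integrable => // y _ /=; rewrite mulrA.
have L (F : T -> R) : (forall y, ~ H y -> F y = 0) -> mu.-integrable setT (EFin \o F) ->
    \int[mu]_y (F y * boundary_cutoff n y) @[n --> \oo] --> \int[mu]_y F y.
  move=> F0 iF; have /integrableP[/measurable_EFinP mF _] := iF.
  have [] := @Rintegral_dominated_cvg _ _ _ mu
    (fun n (y : T) => F y * boundary_cutoff n y) F (fun y => `|F y|).
  - by move=> n; exact: measurable_funM.
  - move=> y; have [Hy|nH] := pselect (H y).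
      by rewrite -[X in _ --> X]mulr1; apply: cvgM; [exact: cvg_cst|exact: boundary_cutoff_cvg].
    by rewrite F0//; under eq_fun do rewrite mul0r; exact: cvg_cst.
  - exact: integrable_norm.
  - by move=> n y; rewrite normrM ler_piMr.
  by [].
have out (h : T -> R) (K : T -> R) y : ~ H y -> (h \_ H) y * K y = 0.
  by move=> nH; rewrite patchE memNset ?mul0r.
have C1 := L _ (out f (partial false Psi)) i2.
have C2 := cvgN (L _ (out g Psi) i3).
have EE := funext E; rewrite EE in C1.
by move: C1 => /cvg_unique; apply => //; exact: C2.
Qed.

End weak_partial_extension.

(** * Derivatives of convolutions with the odd extension *)

Section odd_extension.
Context {R : realType}.
Local Notation mR := (measurableTypeR R).
Local Notation T := (mR * mR)%type.
Local Notation mu := (@leb2 R).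
Local Notation H := (@halfplane R).
Implicit Types (f g : R * R -> R) (k F : T -> R) (phi : R * R -> R).

Lemma reflect2K : involutive (@reflect2 R).
Proof. by case=> a b; rewrite /reflect2 /= opprK. Qed.

Lemma reflect2_scale : @reflect2 R = scale2 (1, -1) (0, 0).
Proof. by apply/funext => z; rewrite /reflect2 /scale2 /= mul1r mulN1r !addr0. Qed.

(* The image term of the kernel is absorbed by extending the vorticity oddly
   across the boundary, after which only full-plane convolutions remain. *)
Definition odd_ext f (y : R * R) : R := (f \_ H) y - (f \_ H) (reflect2 y).

Lemma Lp_bounded_reflect p B F : 0 < p -> Lp_bounded mu p B F ->
  Lp_bounded mu p B (F \o @reflect2 R).
Proof.
move=> p0 hF; have B0 := Lp_bounded_ge0 hF; case: hF => mF hN.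
have h := (Lnorm_le_integral mu (EFin \o F) p0 B0).1 hN.
have [mr _] := @mpres_reflect R.
have mFr : measurable_fun setT (F \o @reflect2 R : T -> R) by exact: measurableT_comp.
split=> //; apply/(Lnorm_le_integral mu _ p0 B0); apply: le_trans h.
rewrite le_eqVlt; apply/orP; left; apply/eqP.
apply: (mpres_ge0_integral (f := fun x : T => (`|(F x)%:E| `^ p)%E) (@mpres_reflect R)).
  by apply: measurable_abse_poweR; exact/measurable_EFinP.
by move=> x; exact: poweR_ge0.
Qed.

Lemma Lp_bounded_odd_ext p B f : 1 <= p -> Lp_bounded mu p B (f \_ H) ->
  Lp_bounded mu p (B + B) (odd_ext f).
Proof.
move=> p1 hf; have p0 : 0 < p by lra.
have h := Lp_boundedZ (-1) p0 (Lp_bounded_reflect p0 hf).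
have := Lp_boundedD p1 hf h; rewrite normrN1 mul1r.
by under [X in Lp_bounded _ _ _ X -> _]eq_fun do rewrite mulN1r.
Qed.

Lemma Lp_bounded_riesz_finite p B F : 1 < p -> p < 2 -> Lp_bounded mu p B F -> riesz_finite F.
Proof.
move=> p1 p2 hF; have [mF _] := hF; split => //.
have [C C0 HC] := hls_Lnorm p1 p2 erefl.
have q1 : 2 < 2 * p / (2 - p) by rewrite ltr_pdivlMr; lra.
exists (2 * p / (2 - p)); first lra.
have q0 : 0 < 2 * p / (2 - p) by lra.
have h := (Lnorm_le_integral mu _ q0 (mulr_ge0 C0 (Lp_bounded_ge0 hF))).1 (HC _ _ hF).
apply: le_lt_trans (ltry ((C * B) `^ (2 * p / (2 - p)))); apply: le_trans h.
apply: ge0_integral_mono => x _; first exact: poweR_ge0.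
by rewrite gee0_abs// riesz_ge0.
Qed.

Lemma mul_reflect_integrable F (h : T -> R) :
  mu.-integrable setT (fun y : T => (F (reflect2 y) * h y)%:E) ->
  mu.-integrable setT (fun y : T => (F y * h (reflect2 y))%:E).
Proof.
move=> i; have := mpres_integrable (@mpres_reflect R) i.
by apply: eq_integrable => // y _ /=; rewrite reflect2K.
Qed.

Lemma Rintegral_mul_odd_ext f (h : T -> R) :
  mu.-integrable setT (fun y : T => ((f \_ H) y * h y)%:E) ->
  mu.-integrable setT (fun y : T => ((f \_ H) (reflect2 y) * h y)%:E) ->
  \int[mu]_y (odd_ext f y * h y) =
  \int[mu]_y ((f \_ H) y * h y) - \int[mu]_y ((f \_ H) y * h (reflect2 y)).
Proof.
move=> i1 i2.
have -> : \int[mu]_y (odd_ext f y * h y) =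
    \int[mu]_y ((f \_ H) y * h y - (f \_ H) (reflect2 y) * h y).
  by apply: eq_Rintegral => y _; rewrite /odd_ext mulrBl.
rewrite RintegralB//; congr (_ - _).
have /integrableP[/measurable_EFinP m2 _] := mul_reflect_integrable i2.
rewrite -(mpres_Rintegral (@mpres_reflect R) m2).
by apply: eq_Rintegral => y _; rewrite reflect2K.
Qed.

Context (p : R) (p_gt1 : 1 < p) (p_lt2 : p < 2).

(** Reflection leaves tangential derivatives unchanged, so the two halves of [odd_ext] are treated
    separately, each by [weak_partial_tangential]. In the normal direction a jump of the extension
    would add a term on the boundary. *)
Lemma convol_tangential k f g (Bf Bg : R) phi : kernel_like k ->
  weak_partial false f g -> Lp_bounded mu p Bf (f \_ H) -> Lp_bounded mu p Bg (g \_ H) ->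
  test_function setT phi ->
  \int[mu]_x (convol k (odd_ext f) x * partial false phi x) =
  - \int[mu]_x (convol k (odd_ext g) x * phi x).
Proof.
move=> kk W hf hg tp; have p1 := ltW p_gt1; have p0 := lt_trans ltr01 p_gt1.
have fin B F := @Lp_bounded_riesz_finite p B F p_gt1 p_lt2.
have tq := test_partial false tp.
have [_ ->] := convol_corr kk (fin _ _ (Lp_bounded_odd_ext p1 hf)) tq.
have [_ ->] := convol_corr kk (fin _ _ (Lp_bounded_odd_ext p1 hg)) tp.
have [i1 _] := convol_corr kk (fin _ _ hf) tq.
have [i2 _] := convol_corr kk (fin _ _ (Lp_bounded_reflect p0 hf)) tq.
have [i3 _] := convol_corr kk (fin _ _ hg) tp.
have [i4 _] := convol_corr kk (fin _ _ (Lp_bounded_reflect p0 hg)) tp.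
have [i5 _] := convol_corr kk (fin _ _ hf) tp.
have [i6 _] := convol_corr kk (fin _ _ (Lp_bounded_reflect p0 hf)) tp.
rewrite (Rintegral_mul_odd_ext i1 i2) (Rintegral_mul_odd_ext i3 i4) opprB.
have i2' := mul_reflect_integrable i2.
have i4' := mul_reflect_integrable i4.
have i6' := mul_reflect_integrable i6.
have sC := corr_smooth kk tp.
have pE y := partial_corr false y kk tp.
rewrite addrC; congr (_ + _).
  have sr : smooth (corr k phi \o @reflect2 R) by rewrite reflect2_scale; exact: smooth_scale2.
  have pr y : partial false (corr k phi \o @reflect2 R) y = corr k (partial false phi) (reflect2 y).
    rewrite reflect2_scale partial_scale2; last exact: smooth_derivable.
    by rewrite mul1r pE.
  have := weak_partial_tangential W sr i6' _ i4'.
  under [X in (_ -> X = _) -> _]eq_Rintegral do rewrite pr.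
  move=> ->; first by rewrite opprK.
  by apply: eq_integrable i2' => // y _ /=; rewrite pr.
have := weak_partial_tangential W sC i5 _ i3.
under [X in (_ -> X = _) -> _]eq_Rintegral do rewrite pE.
by apply; apply: eq_integrable i1 => // y _ /=; rewrite pE.
Qed.

Lemma shift_scale2 (y z : R * R) : y + z = scale2 (1, 1) y z.
Proof. by rewrite /scale2 /= !mul1r (addrC z.1) (addrC z.2); case: y z => ? ? []. Qed.

Lemma test_shift y phi : test_function setT phi -> test_function setT (fun z => phi (y + z)).
Proof.
move=> tp; have [M M0 [_ HM]] := test_bound tp.
apply: (@test_intro_bound _ _ (M + `|y|)); last by move=> z; exact: shift_out.
have := smooth_scale2 (1, 1) y (test_smooth tp); congr smooth; apply/funext => z.
by rewrite [RHS]/= shift_scale2.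
Qed.

Lemma partial_shift i y phi z : smooth phi ->
  partial i (fun z => phi (y + z)) z = partial i phi (y + z).
Proof.
move=> sp; have E : (fun z => phi (y + z)) = phi \o scale2 (1, 1) y.
  by apply/funext => w /=; rewrite shift_scale2.
rewrite E partial_scale2; last exact: smooth_derivable.
rewrite (_ : pcoord i (1, 1) = 1) ?mul1r; last by case: i.
by rewrite shift_scale2.
Qed.

(** The velocity is a multiple of [(kern true, - kern false)] convolved with [F]; its vanishing
    divergence is the vanishing curl of [z / |z|^2]. *)
Lemma convol_div_free F phi : riesz_finite F -> test_function setT phi ->
  \int[mu]_x (convol (kern true) F x * partial false phi x) =
  \int[mu]_x (convol (kern false) F x * partial true phi x).
Proof.
move=> rF tp.
have [_ ->] := convol_corr (kern_like true) rF (test_partial false tp).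
have [_ ->] := convol_corr (kern_like false) rF (test_partial true tp).
have sp := test_smooth tp.
have E i j y : corr (kern j) (partial i phi) y =
    \int[mu]_z (kern j z * partial i (fun z => phi (y + z)) z).
  by apply: eq_Rintegral => z _; rewrite (partial_shift i y z sp).
have E2 y : corr (kern true) (partial false phi) y = corr (kern false) (partial true phi) y.
  by rewrite E flux_perp ?E//; exact: test_shift.
by apply: eq_Rintegral => y _; rewrite E2.
Qed.

(** The curl of the velocity is the divergence of [z / |z|^2] convolved with [F], hence a multiple
    of [F] by [radial_flux_linear]. *)
Lemma convol_curl F phi : riesz_finite F -> test_function setT phi ->
  \int[mu]_x (convol (kern false) F x * partial false phi x) +
  \int[mu]_x (convol (kern true) F x * partial true phi x) =
  @radial_flux R false (@plane_cutoff R) * \int[mu]_x (F x * phi x).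
Proof.
move=> rF tp.
have [i1 ->] := convol_corr (kern_like false) rF (test_partial false tp).
have [i2 ->] := convol_corr (kern_like true) rF (test_partial true tp).
set c := radial_flux _ _.
have E y : corr (kern false) (partial false phi) y + corr (kern true) (partial true phi) y = phi y * c.
  have := radial_flux_linear false (test_shift y tp); rewrite addr0 => <-.
  rewrite /radial_flux /corr -RintegralD//; last 2 first.
  - exact: corr_integrable (kern_like _) (test_partial _ tp).
  - exact: corr_integrable (kern_like _) (test_partial _ tp).
  by apply: eq_Rintegral => z _; rewrite /half_weight mul1r !partial_shift//; exact: test_smooth tp.
rewrite -RintegralD; [|exact: measurableT|exact: i1|exact: i2].
have -> : \int[mu]_x (F x * corr (kern false) (partial false phi) x + F x * corr (kern true) (partial true phi) x) =
    \int[mu]_x (c * (F x * phi x)).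
  by apply: eq_Rintegral => y _; rewrite -mulrDr E mulrA mulrC.
(* Integrability of [F * phi] is read off from that of [c * F * phi] by dividing; as the value of
   [c] is not computed, the trivial case is split off. *)
have [c0|c0] := eqVneq c 0.
  rewrite c0 mul0r; under eq_Rintegral do rewrite mul0r.
  by rewrite Rintegral_cst// mul0r.
apply: RintegralZl; first exact: measurableT.
have := integrableZl measurableT c^-1 (integrableD measurableT i1 i2).
apply: eq_integrable; first exact: measurableT.
move=> y _ /=; move: (corr _ _ y) (corr _ _ y) (E y) => a b Ey.
by rewrite -EFinD -EFinM -mulrDr Ey mulrCA (mulrC (phi y)) mulKf.
Qed.

Lemma Rintegral_odd_ext_test f (B : R) phi : Lp_bounded mu p B (f \_ H) -> test_function H phi ->
  \int[mu]_y (odd_ext f y * phi y) = \int[mu]_y ((f \_ H) y * phi y).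
Proof.
move=> hf tp; apply: eq_Rintegral => y _; rewrite /odd_ext.
have [Hy|nH] := pselect (H y); last by rewrite (test_out tp nH) !mulr0.
rewrite [X in _ - X](_ : _ = 0) ?subr0// patchE memNset//.
by rewrite /halfplane /= => h; move: Hy; rewrite /halfplane /=; lra.
Qed.

End odd_extension.

(** * Recovering a function on the half-plane from its gradient *)

Section half_plane_representation.
Context {R : realType}.
Local Notation mR := (measurableTypeR R).
Local Notation T := (mR * mR)%type.
Local Notation mu := (@leb2 R).
Local Notation H := (@halfplane R).
Implicit Types (f g : R * R -> R) (k F : T -> R) (phi : R * R -> R).

(* Supported in the lower half-plane, so that correlating with a test function of
   the upper half-plane stays away from the boundary. *)
Definition lower_kern i (z : R * R) : R := half_weight true (- z) * kern i (- z).

Lemma lower_kern_like i : kernel_like (lower_kern i : T -> R).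
Proof.
have [mk hk] := half_kernel_like true (@kern_like R i); split.
  exact: (measurableT_comp mk (@mpres_opp R).1).
by move=> z; rewrite /rk -(normrN z); exact: hk.
Qed.

Lemma corr_lower_kern_out i phi (c : R) y : (forall x, x.2 < c -> phi x = 0) -> y.2 < c ->
  corr (lower_kern i) phi y = 0.
Proof.
move=> phi0 yc; transitivity (\int[mu]_(z in (setT : set T)) (0 : R)); last by rewrite Rintegral_cst// mul0r.
apply: eq_Rintegral => z _; have [z0|z0] := ltP 0 (- z.2); first by rewrite phi0 ?mulr0//= ; lra.
by rewrite /lower_kern /half_weight ltNge z0 !mul0r.
Qed.

Lemma test_reflect_shift y phi : test_function setT phi -> test_function setT (fun z => phi (y - z)).
Proof.
move=> tp; have [M M0 [_ HM]] := test_bound tp.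
apply: (@test_intro_bound _ _ (M + `|y|)); last first.
  by move=> z h; apply: (shift_out HM); rewrite normrN.
have := smooth_scale2 (-1, -1) y (test_smooth tp); congr smooth; apply/funext => z.
by rewrite [LHS]/= /scale2 /= !mulN1r (addrC _ y.1) (addrC _ y.2); case: y z => ? ? [].
Qed.

Lemma partial_reflect_shift i y phi z : smooth phi ->
  partial i (fun z => phi (y - z)) z = - partial i phi (y - z).
Proof.
have S w : y - w = scale2 (-1, -1) y w.
  by rewrite /scale2 /= !mulN1r (addrC _ y.1) (addrC _ y.2); case: y w => ? ? [].
move=> sp; have E : (fun z => phi (y - z)) = phi \o scale2 (-1, -1) y.
  by apply/funext => w /=; rewrite S.
rewrite E partial_scale2; last exact: smooth_derivable.
rewrite (_ : pcoord i (-1, -1) = -1) ?mulN1r; last by case: i.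
by rewrite -S.
Qed.

Lemma corr_lower_kernE i phi y : test_function setT phi ->
  corr (lower_kern i) (partial i phi) y =
  - \int[mu]_z (half_weight true z * kern i z * partial i (fun z => phi (y - z)) z).
Proof.
move=> tp; have sp := test_smooth tp; have tq := test_partial i tp.
have I0 := corr_integrable y (lower_kern_like i) tq.
have /integrableP[/measurable_EFinP m _] := I0.
rewrite /corr -(mpres_Rintegral (@mpres_opp R) m).
have I1 := kernel_test_integrable (half_kernel_like true (@kern_like R i))
  (test_partial i (test_reflect_shift y tp)).
rewrite -[RHS]mulN1r -RintegralZl//; apply: eq_Rintegral => z _.
rewrite (partial_reflect_shift i y z sp) /lower_kern opprK.
by move: (partial _ _ _) => a; rewrite mulrN mulN1r opprK.
Qed.

(** The substitution of [- z] for [z] turns this into the half-plane flux of [z |-> phi (y - z)],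
    which only sees [phi y]. *)
Lemma lower_kern_divergence phi y : test_function setT phi ->
  corr (lower_kern false) (partial false phi) y + corr (lower_kern true) (partial true phi) y =
  - (phi y * @radial_flux R true (@plane_cutoff R)).
Proof.
move=> tp; have tpy := test_reflect_shift y tp.
have := radial_flux_linear true tpy; rewrite subr0 => <-.
rewrite !corr_lower_kernE// -opprD; congr (- _); rewrite -RintegralD//.
- apply: eq_Rintegral => z _; rewrite /radial_flux.
  by move: (partial false _ _) (partial true _ _) => a b; rewrite mulrDr !mulrA.
- exact: kernel_test_integrable (half_kernel_like true (kern_like _)) (test_partial _ tpy).
- exact: kernel_test_integrable (half_kernel_like true (kern_like _)) (test_partial _ tpy).
Qed.

Context (p : R) (p_gt1 : 1 < p) (p_lt2 : p < 2).

(** The correlation at [y] only evaluates [phi] below [y], so it inherits the gap of [phi] from the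
    boundary and [weak_partial_gap] applies in both directions. *)
Lemma convol_lower_kern i f g (Bf Bg : R) phi : weak_partial i f g ->
  Lp_bounded mu p Bf (f \_ H) -> Lp_bounded mu p Bg (g \_ H) -> test_function H phi ->
  mu.-integrable setT (fun y : T => ((f \_ H) y * corr (lower_kern i) (partial i phi) y)%:E) /\
  \int[mu]_y ((f \_ H) y * corr (lower_kern i) (partial i phi) y) =
  - \int[mu]_x (convol (lower_kern i) (g \_ H) x * phi x).
Proof.
move=> W hf hg tH; have [c c0 gap] := test_halfplane_gap tH.
have tp := test_sub (@subsetT _ _) tH.
have rf := Lp_bounded_riesz_finite p_gt1 p_lt2 hf.
have rg := Lp_bounded_riesz_finite p_gt1 p_lt2 hg.
have kk := lower_kern_like i.
have [i1 _] := convol_corr kk rf (test_partial i tp).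
have [i2 ->] := convol_corr kk rg tp.
have [i3 _] := convol_corr kk rf tp.
have pE y := partial_corr i y kk tp.
split=> //; have := weak_partial_gap W c0 (corr_smooth kk tp) _ i3 _ i2.
under [X in (_ -> _ -> X = _) -> _]eq_Rintegral do rewrite pE.
apply; first by move=> y yc; exact: corr_lower_kern_out gap yc.
by apply: eq_integrable i1 => // y _ /=; rewrite pE.
Qed.

Lemma half_plane_representation f g1 g2 (B B1 B2 : R) phi :
  weak_partial false f g1 -> weak_partial true f g2 ->
  Lp_bounded mu p B (f \_ H) -> Lp_bounded mu p B1 (g1 \_ H) -> Lp_bounded mu p B2 (g2 \_ H) ->
  test_function H phi ->
  @radial_flux R true (@plane_cutoff R) * \int[mu]_y ((f \_ H) y * phi y) =
  \int[mu]_x (convol (lower_kern false) (g1 \_ H) x * phi x) +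
  \int[mu]_x (convol (lower_kern true) (g2 \_ H) x * phi x).
Proof.
move=> W1 W2 hf h1 h2 tH; have tp := test_sub (@subsetT _ _) tH.
have [i1 E1] := convol_lower_kern W1 hf h1 tH.
have [i2 E2] := convol_lower_kern W2 hf h2 tH.
apply: oppr_inj; rewrite opprD -E1 -E2 -RintegralD; [|exact: measurableT|exact: i1|exact: i2].
have D y := lower_kern_divergence y tp.
set c := radial_flux _ _ in D *.
rewrite -mulNr -RintegralZl.
- apply: eq_Rintegral => y _; rewrite -mulrDr D.
  by move: (phi y) ((f \_ H) y) => a b; ring.
- exact: measurableT.
have [lf _ _] := W1; exact: loc_integrable_test_bound.
Qed.

Lemma loc_integrable_patch f : loc_integrable H (f \_ H) <-> loc_integrable H f.
Proof.
split=> h K cK KH; apply: eq_integrable (h K cK KH) => //.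
- exact: compact_measurable2.
- by move=> x /set_mem/KH Hx /=; rewrite patchE mem_set.
- exact: compact_measurable2.
- by move=> x /set_mem/KH Hx /=; rewrite patchE mem_set.
Qed.

Lemma Lp_bounded_loc_integrable (q B : R) F : 1 <= q -> Lp_bounded mu q B F -> loc_integrable H F.
Proof.
move=> q1 hF K cK _; apply: (Lp_bounded_integrable q1 hF); first exact: compact_measurable2.
exact: leb2_compact_fin.
Qed.

Lemma du_bois_reymond_eq f g : loc_integrable H f -> loc_integrable H g ->
  (forall phi, test_function H phi ->
    \int[mu]_x ((f \_ H) x * phi x) = \int[mu]_x ((g \_ H) x * phi x)) ->
  {ae mu, forall x : T, H x -> f x = g x}.
Proof.
move=> lf lg E; have lfg : loc_integrable H (fun x => f x - g x).
  move=> K cK KH; have mK := compact_measurable2 cK.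
  have := integrableB mK (lf K cK KH) (lg K cK KH).
  by apply: eq_integrable.
have : {ae mu, forall x : T, H x -> f x - g x = 0}.
  apply: du_bois_reymond => // phi tp; rewrite Rintegral_halfplane.
  have -> : \int[mu]_x (((fun x => f x - g x) \_ H) x * phi x) =
      \int[mu]_x ((f \_ H) x * phi x - (g \_ H) x * phi x).
    by apply: eq_Rintegral => x _; rewrite !patchE; case: ifP => _; rewrite ?mulrBl// mul0r subrr.
  rewrite RintegralB; [|exact: measurableT|exact: loc_integrable_test_bound|exact: loc_integrable_test_bound].
  by rewrite E// subrr.
by apply: filterS => x h Hx; apply/eqP; rewrite -subr_eq0 h.
Qed.

End half_plane_representation.

(** * The Sobolev embedding of the half-plane *)

Section half_plane_sobolev.
Context {R : realType}.
Local Notation mR := (measurableTypeR R).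
Local Notation T := (mR * mR)%type.
Local Notation mu := (@leb2 R).
Local Notation H := (@halfplane R).

Lemma convol_Lp (p q : R) : 1 < p -> p < 2 -> q = 2 * p / (2 - p) ->
  exists2 C : R, 0 <= C & forall (k F : T -> R) (B : R), kernel_like k ->
    Lp_bounded mu p B F -> Lp_bounded mu q (C * B) (convol k F).
Proof.
move=> p1 p2 qE; have [C C0 HC] := hls_Lnorm p1 p2 qE; exists C => // k F B kk hF.
have [mF _] := hF; have [mk _] := kk.
have q0 : 0 < q by rewrite qE divr_gt0; lra.
have mA : measurable_fun setT (fun y => `|F y|) by exact: measurableT_comp.
split; first exact: measurable_convolution.
apply: le_trans (HC _ _ hF); apply: Lnorm_le_ae => //.
- by apply/measurable_EFinP; exact: measurable_convolution.
- by apply: measurable_riesz.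
apply: aeW => x /=; rewrite gee0_abs; last exact: riesz_ge0.
exact: convol_le.
Qed.

Lemma Lp_bounded_patch (q B : R) (F : T -> R) : 0 < q -> Lp_bounded mu q B F ->
  Lp_bounded mu q B (F \_ H).
Proof.
move=> q0 hF; have [mF _] := hF; apply: Lp_bounded_ae hF _ => //.
  by apply: restrict_measurable; exact: measurable_funTS.
by apply: aeW => x; rewrite patchE; case: ifP => // _; rewrite normr0.
Qed.

(** Dividing the representation by the nonzero flux constant identifies [f] almost everywhere with
    convolutions of its gradient, to which the Hardy-Littlewood-Sobolev bound applies. *)
Lemma half_plane_sobolev (p q : R) : 1 < p -> p < 2 -> q = 2 * p / (2 - p) ->
  exists2 C : R, 0 <= C & forall f g1 g2 B, weak_partial false f g1 -> weak_partial true f g2 ->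
    Lp_bounded mu p B (f \_ H) -> Lp_bounded mu p B (g1 \_ H) -> Lp_bounded mu p B (g2 \_ H) ->
    Lp_bounded mu q (C * B) (f \_ H).
Proof.
move=> p1 p2 qE; have [C C0 HC] := convol_Lp p1 p2 qE.
have q0 : 0 < q by rewrite qE divr_gt0; lra.
have q1 : 1 <= q by rewrite qE ler_pdivlMr; lra.
have K0 := @radial_flux_plane_cutoff_lt0 R; set K := radial_flux _ _ in K0.
exists (`|K^-1| * (C + C)) => [|f g1 g2 B W1 W2 hf h1 h2].
  by rewrite mulr_ge0// addr_ge0.
have l1 := HC _ _ _ (lower_kern_like false) h1.
have l2 := HC _ _ _ (lower_kern_like true) h2.
have := Lp_boundedZ K^-1 q0 (Lp_boundedD q1 l1 l2).
set G := (X in Lp_bounded _ _ _ X) => hG; rewrite -mulrA mulrDl.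
have [mG _] := hG; have [mf _] := hf.
apply: (Lp_bounded_ae q0 mf (Lp_bounded_patch q0 hG)).
have lf : loc_integrable H f by case: W1.
have lG := Lp_bounded_loc_integrable q1 hG.
have : {ae mu, forall x : T, H x -> f x = G x}.
  apply: du_bois_reymond_eq => // phi tH; have tp := test_sub (@subsetT _ _) tH.
  have E := half_plane_representation p1 p2 W1 W2 hf h1 h2 tH.
  have i1 := loc_integrable_test_bound (Lp_bounded_loc_integrable q1 l1) tH.
  have i2 := loc_integrable_test_bound (Lp_bounded_loc_integrable q1 l2) tH.
  have z (F : T -> R) : \int[mu]_x (F x * phi x) = \int[mu]_x ((F \_ H) x * phi x).
    apply: eq_Rintegral => x _; have [Hx|nH] := pselect (H x).
      by rewrite patchE mem_set.
    by rewrite (test_out tH nH) !mulr0.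
  rewrite (z (convol (lower_kern false) (g1 \_ H))) (z (convol (lower_kern true) (g2 \_ H))) -/K in E.
  have -> : \int[mu]_x ((G \_ H) x * phi x) = \int[mu]_x (K^-1 *
      (((convol (lower_kern false) (g1 \_ H)) \_ H) x * phi x + ((convol (lower_kern true) (g2 \_ H)) \_ H) x * phi x)).
    apply: eq_Rintegral => x _; rewrite !patchE /G; case: ifP => _; last by rewrite !mul0r addr0 mulr0.
    by rewrite -mulrDl mulrA.
  rewrite RintegralZl//; last first.
    by have := integrableD measurableT i1 i2; apply: eq_integrable.
  by rewrite RintegralD// -E mulKf// lt_eqF.
apply: filterS => x h; rewrite !patchE; case: ifP => // /set_mem Hx.
by rewrite h.
Qed.

End half_plane_sobolev.

(** * Composition and uniqueness of weak derivatives *)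

Section weak_derivatives.
Context {R : realType}.
Local Notation mR := (measurableTypeR R).
Local Notation T := (mR * mR)%type.
Local Notation mu := (@leb2 R).
Local Notation H := (@halfplane R).
Implicit Types (f g u v w : R * R -> R) (F : T -> R) (phi : R * R -> R).

Lemma is_weak_derivE a b f g : loc_integrable H f -> loc_integrable H g ->
  (forall phi, test_function H phi ->
    \int[mu]_x ((f \_ H) x * multi_partial a b phi x) =
    (-1) ^+ (a + b) * \int[mu]_x ((g \_ H) x * phi x)) ->
  is_weak_deriv H a b f g.
Proof. by move=> lf lg E; split => // phi tp; rewrite !Rintegral_halfplane; exact: E. Qed.

Lemma is_weak_deriv_test a b f g phi : is_weak_deriv H a b f g -> test_function H phi ->
  \int[mu]_x ((f \_ H) x * multi_partial a b phi x) =
  (-1) ^+ (a + b) * \int[mu]_x ((g \_ H) x * phi x).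
Proof. by move=> [_ _ E] tp; rewrite -!Rintegral_halfplane; exact: E. Qed.

Lemma Rintegral_mul_test F phi : test_function H phi ->
  \int[mu]_x (F x * phi x) = \int[mu]_x ((F \_ H) x * phi x).
Proof.
move=> tp; apply: eq_Rintegral => x _; have [Hx|nH] := pselect (H x).
  by rewrite patchE mem_set.
by rewrite (test_out tp nH) !mulr0.
Qed.

Lemma multi_partial_in i a b phi : smooth phi ->
  multi_partial a b (partial i phi) = multi_partial (~~ i + a) (i + b) phi.
Proof.
by move=> sp; case: i; [exact: multi_partial_in2|exact: multi_partial_in1].
Qed.

Lemma signr_mulK n (x : R) : (-1) ^+ n * ((-1) ^+ n * x) = x.
Proof. by rewrite mulrA -exprD addnn -mul2n exprM sqrrN expr1n expr1n mul1r. Qed.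

(** Two weak derivatives of the same [f] one order apart are related: the lower one is tested on
    [partial i phi]. *)
Lemma weak_partial_of_weak_deriv i a b f g h : is_weak_deriv H a b f g ->
  is_weak_deriv H (~~ i + a) (i + b) f h -> weak_partial i g h.
Proof.
move=> Wg Wh; have [_ lg _] := Wg; have [_ lh _] := Wh; apply: is_weak_derivE => // phi tp.
have sp := test_smooth tp; have := is_weak_deriv_test Wg (test_partial i tp).
rewrite (multi_partial_in i a b sp) (is_weak_deriv_test Wh tp).
have -> : (~~ i + a + (i + b) = (a + b).+1)%N by case: i {Wh lh}; rewrite /= ?addSn ?addnS ?add0n.
have -> : multi_partial (~~ i) i phi = partial i phi by case: i {Wh lh}.
have -> : (-1) ^+ (~~ i + i) = -1 :> R by case: i {Wh lh}; rewrite expr1.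
by move=> E; rewrite -[LHS](signr_mulK (a + b)) -E exprS mulN1r mulNr mulrN signr_mulK mulN1r.
Qed.

Lemma weak_deriv_trans i a b u v w : is_weak_deriv H a b u v -> loc_integrable H w ->
  (forall phi, test_function H phi ->
    \int[mu]_x ((v \_ H) x * partial i phi x) = - \int[mu]_x ((w \_ H) x * phi x)) ->
  is_weak_deriv H (~~ i + a) (i + b) u w.
Proof.
move=> W lw E; have [lu _ _] := W; apply: is_weak_derivE => // phi tp.
rewrite -(multi_partial_in i a b (test_smooth tp)).
rewrite (is_weak_deriv_test W (test_partial i tp)) E//.
have -> : (~~ i + a + (i + b) = (a + b).+1)%N by case: i {E}; rewrite /= ?addSn ?addnS ?add0n.
by rewrite exprS mulN1r mulNr mulrN.
Qed.

Lemma is_weak_deriv_unique a b f g h : is_weak_deriv H a b f g -> is_weak_deriv H a b f h ->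
  {ae mu, forall x : T, H x -> g x = h x}.
Proof.
move=> Wg Wh; have [_ lg _] := Wg; have [_ lh _] := Wh.
apply: du_bois_reymond_eq => // phi tp.
by rewrite -[LHS](signr_mulK (a + b)) -(is_weak_deriv_test Wg tp) (is_weak_deriv_test Wh tp) signr_mulK.
Qed.

Lemma loc_integrableZ c f : loc_integrable H f -> loc_integrable H (fun x => c * f x).
Proof.
move=> lf K cK KH; have := integrableZl (compact_measurable2 cK) c (lf K cK KH).
by apply: eq_integrable => //; exact: compact_measurable2.
Qed.

Lemma loc_integrableD f g : loc_integrable H f -> loc_integrable H g ->
  loc_integrable H (fun x => f x + g x).
Proof.
move=> lf lg K cK KH; have mK := compact_measurable2 cK.
by have := integrableD mK (lf K cK KH) (lg K cK KH); apply: eq_integrable.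
Qed.

Lemma is_weak_deriv_scale a b c f f' g : is_weak_deriv H a b f g -> loc_integrable H f' ->
  {ae mu, forall x : T, H x -> f' x = c * f x} -> is_weak_deriv H a b f' (fun x => c * g x).
Proof.
move=> W lf' ff'; have [lf lg _] := W; apply: is_weak_derivE => //; first exact: loc_integrableZ.
move=> phi tp; have tq := test_multi_partial a b tp.
have i1 := loc_integrable_test_bound lf tq.
have i2 := loc_integrable_test_bound lg tp.
have -> : \int[mu]_x ((f' \_ H) x * multi_partial a b phi x) =
    \int[mu]_x (c * ((f \_ H) x * multi_partial a b phi x)).
  rewrite /Rintegral; congr fine; apply: ae_eq_integral => //.
  - by have /integrableP[] := loc_integrable_test_bound lf' tq.
  - by have /integrableP[] := integrableZl measurableT c i1.
  apply: filterS ff' => x h _; rewrite !patchE; case: ifP => [/set_mem Hx|_]; last by rewrite !mul0r mulr0.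
  by rewrite h// mulrA.
have -> : \int[mu]_x (((fun x => c * g x) \_ H) x * phi x) =
    \int[mu]_x (c * ((g \_ H) x * phi x)).
  by apply: eq_Rintegral => x _; rewrite !patchE; case: ifP => _; rewrite mulrA// mulr0.
by rewrite !RintegralZl// (is_weak_deriv_test W tp) mulrCA.
Qed.

Lemma patchD f g : (fun x => f x + g x) \_ H = (fun x => (f \_ H) x + (g \_ H) x).
Proof. by apply/funext => x; rewrite !patchE; case: ifP => // _; rewrite addr0. Qed.

Lemma patchZ c f : (fun x => c * f x) \_ H = (fun x => c * (f \_ H) x).
Proof. by apply/funext => x; rewrite !patchE; case: ifP => // _; rewrite mulr0. Qed.

(** A choice of all weak derivatives up to order [m] with one common bound. At order 0 it is [f]
    itself, not merely a function equal to it almost everywhere. *)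
Definition sobolev_family (m : nat) (p B : R) f (g : nat -> nat -> R * R -> R) :=
  g 0%N 0%N = f /\ forall a b, (a + b <= m)%N ->
    is_weak_deriv H a b f (g a b) /\ Lp_bounded mu p B (g a b \_ H).

Lemma sobolev_family_partial m p B f (g : nat -> nat -> R * R -> R) i a b : sobolev_family m p B f g -> (a + b < m)%N ->
  weak_partial i (g a b) (g (~~ i + a)%N (i + b)%N).
Proof.
move=> [_ G] ab; apply: weak_partial_of_weak_deriv; [apply: (G a b _).1|apply: (G _ _ _).1].
  exact: ltnW.
by case: i; rewrite /= ?addSn ?addnS ?add0n.
Qed.

End weak_derivatives.

(** * Weak derivatives of the full-plane velocity *)

Section velocity_derivatives.
Context {R : realType}.
Local Notation mR := (measurableTypeR R).
Local Notation T := (mR * mR)%type.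
Local Notation mu := (@leb2 R).
Local Notation H := (@halfplane R).

(** Induction on the number [b] of normal derivatives, for all [a] and both components at once: each
    normal derivative of one component becomes a tangential derivative of the other, which moves
    [(a, b + 1)] to [(a + 1, b)] at the same total order. *)
Lemma velocity_weak_derivs (p q : R) (m b : nat) : 1 < p -> p < 2 -> q = 2 * p / (2 - p) ->
  exists2 C : R, 0 <= C & forall f g B, sobolev_family m p B f g ->
    forall a, (a + b <= m)%N -> forall j, exists2 w,
      is_weak_deriv H a b (convol (kern j) (odd_ext f)) w & Lp_bounded mu q (C * B) (w \_ H).
Proof.
move=> p1 p2 qE; have q0 : 0 < q by rewrite qE divr_gt0; lra.
have q1 : 1 <= q by rewrite qE ler_pdivlMr; lra.
have [Cc Cc0 Hc] := convol_Lp p1 p2 qE.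
have [Cs Cs0 Hs] := half_plane_sobolev p1 p2 qE.
have cB (f : R * R -> R) B j : Lp_bounded mu p B (f \_ H) ->
    Lp_bounded mu q ((Cc + Cc) * B) (convol (kern j) (odd_ext f)).
  move=> hf; have := Hc _ _ _ (kern_like j) (Lp_bounded_odd_ext (ltW p1) hf).
  by rewrite mulrDl mulrDr.
elim: b => [|b [C C0 IH]].
  exists (Cc + Cc) => [|f g B fam a]; first by rewrite addr_ge0.
  have [gf G] := fam; rewrite addn0 => am j.
  (* Purely tangential derivatives pass through the convolution onto the vorticity. *)
  exists (convol (kern j) (odd_ext (g a 0%N))); last first.
    by apply: Lp_bounded_patch => //; apply: cB; apply: (G a 0%N _).2; rewrite addn0.
  elim: a am => [|a IHa] am.
    have l : loc_integrable H (convol (kern j) (odd_ext (g 0%N 0%N))).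
      by apply: (Lp_bounded_loc_integrable q1 (cB _ B j _)); exact: (G 0%N 0%N isT).2.
    by rewrite -gf; apply: is_weak_derivE => // phi tp; rewrite expr0 mul1r.
  have am' : (a + 0 < m)%N by rewrite addn0.
  have Lg : Lp_bounded mu p B (g a 0%N \_ H) by apply: (G _ _ _).2; rewrite ltnW.
  have Lg' : Lp_bounded mu p B (g a.+1 0%N \_ H) by apply: (G _ _ _).2; rewrite addn0.
  apply: (@weak_deriv_trans _ false a 0 _ _ _ (IHa (ltnW am))).
    exact: (Lp_bounded_loc_integrable q1 (cB _ B j Lg')).
  move=> phi tp; rewrite -!Rintegral_mul_test//; last exact: test_partial.
  apply: (convol_tangential p1 p2 (kern_like j) (sobolev_family_partial false fam am') Lg Lg').
  exact: test_sub tp.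
set K := @radial_flux R false (@plane_cutoff R).
have K0 : 0 <= `|- K| * Cs by rewrite mulr_ge0.
exists (C + `|- K| * Cs) => [|f g B fam a ab]; first by rewrite addr_ge0.
have [gf G] := fam; have Lf : Lp_bounded mu p B (f \_ H) by rewrite -gf; exact: (G _ _ _).2.
have B0 := Lp_bounded_ge0 Lf.
have rF := Lp_bounded_riesz_finite p1 p2 (Lp_bounded_odd_ext (ltW p1) Lf).
have lV j : loc_integrable H (convol (kern j) (odd_ext f)).
  exact: (Lp_bounded_loc_integrable q1 (cB _ B j Lf)).
have ab' : (a.+1 + b <= m)%N by rewrite addSn -addnS.
have [w1 W1 L1] := IH f g B fam a.+1 ab' true.
have [w2 W2 L2] := IH f g B fam a.+1 ab' false.
have [_ l1 _] := W1; have [_ l2 _] := W2.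
have part i phi : smooth phi -> partial i (multi_partial a b phi) = multi_partial (~~ i + a) (i + b) phi.
  by move=> sp; case: i; [rewrite -multi_partial_S2|rewrite -multi_partial_S1].
have E12 phi : test_function H phi ->
    \int[mu]_x (((convol (kern false) (odd_ext f)) \_ H) x * multi_partial a b.+1 phi x) =
    \int[mu]_x (((convol (kern true) (odd_ext f)) \_ H) x * multi_partial a.+1 b phi x).
  move=> tH; have tab := test_multi_partial a b tH.
  have := convol_div_free rF (test_sub (@subsetT _ _) tab).
  rewrite (Rintegral_mul_test _ (test_partial false tab)) (Rintegral_mul_test _ (test_partial true tab)).
  by rewrite !part//; exact: test_smooth tH.
have E21 phi : test_function H phi ->
    \int[mu]_x (((convol (kern true) (odd_ext f)) \_ H) x * multi_partial a b.+1 phi x) =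
    K * \int[mu]_x ((f \_ H) x * multi_partial a b phi x) -
    \int[mu]_x (((convol (kern false) (odd_ext f)) \_ H) x * multi_partial a.+1 b phi x).
  move=> tH; have tab := test_multi_partial a b tH.
  have := convol_curl rF (test_sub (@subsetT _ _) tab).
  rewrite (Rintegral_mul_test _ (test_partial false tab)) (Rintegral_mul_test _ (test_partial true tab)).
  rewrite (Rintegral_odd_ext_test Lf tab) !part; try exact: test_smooth tH.
  by move=> <-; rewrite addrC addKr.
case.
  have am : (a + b < m)%N by rewrite -addnS.
  have [Wab Lab] := G a b (ltnW am).
  have S := Hs _ _ _ B (sobolev_family_partial false fam am) (sobolev_family_partial true fam am)
    Lab (G _ _ ab').2 (G _ _ ab).2.
  have [_ lab _] := Wab.
  (* From the curl identity [E21]. The vorticity term has order [a + b < m], which leaves one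
     derivative for [half_plane_sobolev] to put it in [L^q]. *)
  exists (fun x => (-1) * w2 x + (- K) * g a b x); last first.
    rewrite patchD !patchZ mulrDl -[X in X * B]mul1r -[X in (X * _) * _](@normrN1 R) -!mulrA.
    by apply: Lp_boundedD => //; apply: Lp_boundedZ.
  apply: is_weak_derivE => //; first by apply: loc_integrableD; exact: loc_integrableZ.
  move=> phi tH; rewrite E21// (is_weak_deriv_test Wab tH) (is_weak_deriv_test W2 tH).
  have i1 := loc_integrable_test_bound lab tH; have i2 := loc_integrable_test_bound l2 tH.
  rewrite patchD !patchZ addSn addnS exprS.
  have -> : \int[mu]_x ((-1 * (w2 \_ H) x + - K * (g a b \_ H) x) * phi x) =
      \int[mu]_x (-1 * ((w2 \_ H) x * phi x) + - K * ((g a b \_ H) x * phi x)).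
    by apply: eq_Rintegral => x _; rewrite mulrDl !mulrA.
  rewrite RintegralD//; last 2 first.
  - by have := integrableZl measurableT (-1) i2; apply: eq_integrable.
  - by have := integrableZl measurableT (- K) i1; apply: eq_integrable.
  by rewrite !RintegralZl//; ring.
exists w1; last first.
  by apply: Lp_bounded_le L1; rewrite mulrDl lerDl mulr_ge0.
apply: is_weak_derivE => // phi tH; rewrite E12// (is_weak_deriv_test W1 tH).
by rewrite addSn addnS.
Qed.

End velocity_derivatives.

(** * From the convolution to the Biot-Savart integral *)

Section biot_savart_law.
Context {R : realType}.
Local Notation mR := (measurableTypeR R).
Local Notation T := (mR * mR)%type.
Local Notation mu := (@leb2 R).
Local Notation H := (@halfplane R).
Implicit Types (omega : R * R -> R) (j : bool).

(** Here [true] selects the first component, opposite to [pcoord]: rotation by [perp] makes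
    component [j] of the kernel equal to [kern j] up to sign. *)
Definition component j (v : R * R) : R := if j then v.1 else v.2.
Definition component_sign j : R := if j then 1 else -1.

Lemma component_bs_kernel j (x y : R * R) : component j (bs_kernel x y) =
  component_sign j * (kern j (x - y) - kern j (x - reflect2 y)).
Proof.
rewrite /bs_kernel /kern /component_sign; case: j => /=.
  by rewrite mul1r mulrC [X in _ - X]mulrC.
by rewrite /GRing.scale /=; ring.
Qed.

Lemma component_biot_savart j omega x : component j (biot_savart omega x) =
  (2 * pi)^-1 * Rintegral mu H (fun y => component j (bs_kernel x y) * omega y).
Proof. by case: j. Qed.

Lemma measurable_biot_savart j omega : measurable_fun setT (omega \_ H : T -> R) ->
  measurable_fun setT (fun x : T => component j (biot_savart omega x)).
Proof.
move=> mo; under eq_fun do rewrite component_biot_savart.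
apply: measurable_funM => //.
pose h (z : T * T) := component_sign j * (kern j (z.1 - z.2) - kern j (z.1 - reflect2 z.2)) * (omega \_ H) z.2.
have mk := (@kern_like R j).1.
have mh : measurable_fun setT h.
  apply: measurable_funM; last exact: (measurableT_comp mo measurable_snd).
  apply: measurable_funM => //; apply: measurable_funB.
    exact: (measurableT_comp mk (@measurable_sub2 R)).
  have mr : measurable_fun setT (fun z : T * T => (z.1, reflect2 z.2 : T)).
    apply: measurable_fun_pair; first exact: measurable_fst.
    exact: (measurableT_comp (@mpres_reflect R).1 measurable_snd).
  exact: (measurableT_comp mk (measurableT_comp (@measurable_sub2 R) mr)).
apply: eq_measurable_fun (measurable_Rintegral mh) => x _.
rewrite [RHS]Rintegral_mkcond; apply: eq_Rintegral => y _; rewrite /h !patchE component_bs_kernel.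
by case: ifP => // _; rewrite mulr0.
Qed.

(** Reflecting the variable of integration in the image term makes it the second half of [odd_ext].
    Convergence holds where the potentials of the vorticity and of its reflection are both
    finite. *)
Lemma biot_savart_convol (p B : R) omega : 1 < p -> p < 2 -> Lp_bounded mu p B (omega \_ H) ->
  forall j, {ae mu, forall x : T,
    mu.-integrable H (fun y => (component j (bs_kernel x y) * omega y)%:E) /\
    component j (biot_savart omega x) =
      (2 * pi)^-1 * component_sign j * convol (kern j) (odd_ext omega) x}.
Proof.
move=> p1 p2 hf j; have p0 := lt_trans ltr01 p1; have kk := @kern_like R j.
have h1 := convol_integrable kk (Lp_bounded_riesz_finite p1 p2 hf).
have h2 := convol_integrable kk (Lp_bounded_riesz_finite p1 p2 (Lp_bounded_reflect p0 hf)).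
apply: filterS2 h1 h2 => x i1 i2.
have i3 : mu.-integrable setT (fun y : T => (kern j (x - reflect2 y : R * R) * (omega \_ H) y)%:E).
  have := mpres_integrable (@mpres_reflect R) i2.
  by apply: eq_integrable => // y _ /=; rewrite reflect2K.
have patchK y : ((fun y => component j (bs_kernel x y) * omega y) \_ H) y =
    component_sign j * (kern j (x - y) * (omega \_ H) y - kern j (x - reflect2 y) * (omega \_ H) y).
  rewrite !patchE component_bs_kernel; case: ifP => _; last by rewrite !mulr0 subrr mulr0.
  by rewrite -mulrBl mulrA.
split.
  apply/(integrable_mkcond _ measurable_halfplane).
  have := integrableZl measurableT (component_sign j) (integrableB measurableT i1 i3).
  by apply: eq_integrable => // y _; rewrite restrict_EFin /= patchK.
rewrite component_biot_savart -mulrA; congr (_ * _).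
rewrite Rintegral_mkcond; under eq_Rintegral do rewrite patchK.
rewrite RintegralZl//; last by have := integrableB measurableT i1 i3; apply: eq_integrable.
congr (_ * _); rewrite RintegralB//.
have /integrableP[/measurable_EFinP m2 _] := i2.
have -> : \int[mu]_y (kern j (x - reflect2 y) * (omega \_ H) y) =
    \int[mu]_y (kern j (x - y : R * R) * (omega \_ H) (reflect2 y)).
  rewrite -(mpres_Rintegral (@mpres_reflect R) m2).
  by apply: eq_Rintegral => y _ /=; rewrite reflect2K.
rewrite /convol -RintegralB//; apply: eq_Rintegral => y _.
by rewrite /odd_ext mulrBr.
Qed.

Lemma biot_savart_weak_derivs (p q : R) (m : nat) : 1 < p -> p < 2 -> q = 2 * p / (2 - p) ->
  exists2 C : R, 0 <= C & forall omega g B, sobolev_family m p B omega g ->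
    forall j a b, (a + b <= m)%N -> exists2 w,
      is_weak_deriv H a b (component j \o biot_savart omega) w & Lp_bounded mu q (C * B) (w \_ H).
Proof.
move=> p1 p2 qE; have q0 : 0 < q by rewrite qE divr_gt0; lra.
have q1 : 1 <= q by rewrite qE ler_pdivlMr; lra.
have /choice[C HC] : forall b, exists C : R, 0 <= C /\ forall f g B, sobolev_family m p B f g ->
    forall a, (a + b <= m)%N -> forall j, exists2 w,
      is_weak_deriv H a b (convol (kern j) (odd_ext f)) w & Lp_bounded mu q (C * B) (w \_ H).
  by move=> b; have [C C0 HC] := @velocity_weak_derivs R p q m b p1 p2 qE; exists C.
pose c : R := (2 * pi)^-1.
(* The induction gives one constant for each number of normal derivatives; their sum dominates all
   those with [b <= m]. *)
exists (`|c| * \sum_(b < m.+1) C b) => [|omega g B fam j a b ab].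
  by rewrite mulr_ge0// sumr_ge0// => b _; exact: (HC b).1.
have [gf G] := fam; have [W0 L0] := G 0%N 0%N isT; rewrite gf in L0.
have B0 := Lp_bounded_ge0 L0.
have [w W L] := (HC b).2 omega g B fam a ab j.
have ae := biot_savart_convol p1 p2 L0 j.
have Lv : Lp_bounded mu q (`|c * component_sign j| * (C 0%N * B))
    ((fun x => c * component_sign j * convol (kern j) (odd_ext omega) x) \_ H).
  (* A weak derivative of order 0 is the function itself almost everywhere, so the bound on [v]
     passes to the convolution. *)
  have [v Wv Lv] := (HC 0%N).2 omega g B fam 0%N isT j.
  rewrite patchZ; apply: Lp_boundedZ => //; apply: Lp_bounded_ae Lv _ => //.
    by apply: restrict_measurable; apply: loc_integrable_measurable; case: Wv.
  have Wvv : is_weak_deriv H 0 0 (convol (kern j) (odd_ext omega)) (convol (kern j) (odd_ext omega)).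
    by case: Wv => l _ _; apply: is_weak_derivE => // phi tp; rewrite expr0 mul1r.
  apply: filterS (is_weak_deriv_unique Wv Wvv) => x h; rewrite !patchE.
  by case: ifP => // /set_mem Hx; rewrite h.
have [mo _] := L0; have mu_j := measurable_biot_savart j mo.
have lu : loc_integrable H (component j \o biot_savart omega).
  apply/loc_integrable_patch/(Lp_bounded_loc_integrable q1 (Lp_bounded_ae q0 _ Lv _)).
    by apply: restrict_measurable; exact: measurable_funTS.
  by apply: filterS ae => x [_ h]; rewrite !patchE; case: ifP => // _; rewrite /= h.
exists (fun x => c * component_sign j * w x).
  by apply: is_weak_deriv_scale W lu _; apply: filterS ae => x [_ h] _.
rewrite patchZ; apply: Lp_bounded_le (Lp_boundedZ _ q0 L).
rewrite normrM (_ : `|component_sign j| = 1) ?mulr1; last first.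
  by rewrite /component_sign; case: (j); rewrite ?normrN normr1.
rewrite -mulrA; apply: ler_wpM2l => //; apply: ler_wpM2r => //.
have bm : (b < m.+1)%N by rewrite ltnS (leq_trans _ ab)// leq_addl.
rewrite (bigD1 (Ordinal bm))//= lerDl sumr_ge0// => i _; exact: (HC i).1.
Qed.

End biot_savart_law.

(** * Translation between families of bounds and Sobolev norms *)

Section sobolev_norms.
Context {R : realType}.
Local Notation mR := (measurableTypeR R).
Local Notation T := (mR * mR)%type.
Local Notation mu := (@leb2 R).
Local Notation H := (@halfplane R).
Implicit Types (f g : R * R -> R).

Lemma Lp_normE p f : Lp_norm H p f = 'N[mu]_(p%:E)[EFin \o (f \_ H)]%E.
Proof. by rewrite /Lp_norm -restrict_EFin. Qed.

Lemma weak_derivP a b f g : is_weak_deriv H a b f g ->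
  is_weak_deriv H a b f (weak_deriv H a b f).
Proof. by move=> W; rewrite /weak_deriv; apply: (xgetPex (fun=> 0)); exists g. Qed.

Lemma is_weak_deriv_measurable a b f g : is_weak_deriv H a b f g ->
  measurable_fun setT (g \_ H : T -> R).
Proof. by move=> [_ lg _]; apply: restrict_measurable; exact: loc_integrable_measurable. Qed.

Lemma is_weak_deriv_Lp_bounded p B a b f g h : 0 < p -> is_weak_deriv H a b f g ->
  is_weak_deriv H a b f h -> Lp_bounded mu p B (g \_ H) -> Lp_bounded mu p B (h \_ H).
Proof.
move=> p0 Wg Wh Lg; apply: Lp_bounded_ae Lg _ => //; first exact: is_weak_deriv_measurable Wh.
apply: filterS (is_weak_deriv_unique Wg Wh) => x e; rewrite !patchE.
by case: ifP => // /set_mem Hx; rewrite e.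
Qed.

Lemma poweR_root_le (q c B : R) (X : \bar R) : 0 < q -> 0 <= c -> 0 <= B -> (0 <= X)%E ->
  (X <= (c * B `^ q)%:E)%E -> (X `^ q^-1 <= (c `^ q^-1 * B)%:E)%E.
Proof.
move=> q0 c0 B0 X0 h; have q0' : 0 <= q^-1 by rewrite invr_ge0 ltW.
have := gt0_ler_poweR q0' _ _ h => /(_ (ge0_in_itv X0)).
rewrite poweR_EFin powRM ?powR_ge0// -powRrM mulfV ?gt_eqF// powRr1//; apply.
by apply: ge0_in_itv; rewrite lee_fin mulr_ge0 ?powR_ge0.
Qed.

Lemma sobolev_norm_le (m : nat) (q B : R) f : 0 < q -> 0 <= B ->
  (forall a b, (a + b <= m)%N -> (Lp_norm H q (weak_deriv H a b f) <= B%:E)%E) ->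
  (sobolev_norm H m q f <= (((m.+1 * m.+1)%:R : R) `^ q^-1 * B)%:E)%E.
Proof.
move=> q0 B0 h; apply: poweR_root_le => //.
  by apply: sume_ge0 => a _; apply: sume_ge0 => b _; exact: poweR_ge0.
have hB a b : (a + b <= m)%N -> (Lp_norm H q (weak_deriv H a b f) `^ q <= (B `^ q)%:E)%E.
  move=> ab; rewrite -poweR_EFin; apply: (gt0_ler_poweR (ltW q0)) (h a b ab).
    by apply: ge0_in_itv; exact: Lnorm_ge0.
  by apply: ge0_in_itv; rewrite lee_fin.
apply: (@le_trans _ _ (\sum_(a < m.+1) \sum_(b < m.+1) (B `^ q)%:E)%E).
  apply: lee_sum => a _; rewrite big_mkcond; apply: lee_sum => b _.
  by case: ifP => ab; [exact: hB|rewrite lee_fin powR_ge0].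
under eq_bigr do rewrite sumEFin; rewrite sumEFin lee_fin !sumr_const !card_ord.
by rewrite -mulrnA -[leLHS]mulr_natl lexx.
Qed.

Lemma Lp_norm_le_sobolev_norm (m a b : nat) (p : R) f : 0 < p -> (a + b <= m)%N ->
  (Lp_norm H p (weak_deriv H a b f) <= sobolev_norm H m p f)%E.
Proof.
move=> p0 ab; have p0' : 0 <= p^-1 by rewrite invr_ge0 ltW.
have N0 : (0 <= Lp_norm H p (weak_deriv H a b f))%E by exact: Lnorm_ge0.
rewrite -[leLHS]poweRe1// -(mulfV (lt0r_neq0 p0)) poweRrM.
have am : (a < m.+1)%N by rewrite ltnS (leq_trans _ ab)// leq_addr.
have bm : (b < m.+1)%N by rewrite ltnS (leq_trans _ ab)// leq_addl.
have s0 (P : pred 'I_m.+1) (F : 'I_m.+1 -> \bar R) : (forall i, 0 <= F i)%E -> (0 <= \sum_(i | P i) F i)%E.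
  by move=> h; exact: sume_ge0.
apply: (gt0_ler_poweR p0').
- by apply: ge0_in_itv; exact: poweR_ge0.
- by apply: ge0_in_itv; apply: (s0) => i; apply: (s0) => k; exact: poweR_ge0.
rewrite (bigD1 (Ordinal am))//= (bigD1 (Ordinal bm))//= -addeA leeDl//.
by apply: adde_ge0; [apply: (s0)|apply: (s0) => i; apply: (s0)] => k; exact: poweR_ge0.
Qed.

Lemma sobolev_norm_lty (m : nat) (p : R) f : 1 <= p -> in_sobolev H m p f ->
  (sobolev_norm H m p f < +oo)%E.
Proof.
move=> p1 [_ h]; have p0 : 0 < p by lra.
apply: poweR_lty; apply: lte_sum_pinfty => a _; apply: lte_sum_pinfty => b ab.
apply: poweR_lty; have [g W [mg]] := h a b ab; rewrite !Lp_normE => Ng.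
have gfin : 'N[mu]_p%:E[EFin \o g \_ H]%E \is a fin_num by rewrite ge0_fin_numE ?Lnorm_ge0.
have Lg : Lp_bounded mu p (fine 'N[mu]_p%:E[EFin \o g \_ H]%E) (g \_ H).
  by split; [exact: restrict_measurable|rewrite fineK].
have [_ hw] := is_weak_deriv_Lp_bounded p0 W (weak_derivP W) Lg.
exact: le_lt_trans hw (ltry _).
Qed.

Lemma in_sobolev_family (m : nat) (p : R) f : 1 <= p -> in_sobolev H m p f ->
  exists g : nat -> nat -> R * R -> R, sobolev_family m p (fine (sobolev_norm H m p f)) f g.
Proof.
move=> p1 Sf; have p0 : 0 < p by lra.
have Nfin : sobolev_norm H m p f \is a fin_num.
  by rewrite ge0_fin_numE ?poweR_ge0//; exact: sobolev_norm_lty.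
have [[mf Nf] h] := Sf.
have D a b : (a + b <= m)%N -> is_weak_deriv H a b f (weak_deriv H a b f) /\
    Lp_bounded mu p (fine (sobolev_norm H m p f)) (weak_deriv H a b f \_ H).
  move=> ab; have [g W _] := h a b ab; have Ww := weak_derivP W; split => //.
  split; first exact: is_weak_deriv_measurable Ww.
  by rewrite fineK// -Lp_normE; exact: Lp_norm_le_sobolev_norm.
(* The selected derivative of order 0 need only equal [f] almost everywhere, so it is replaced by
   [f]. *)
exists (fun a b => if (a == 0%N) && (b == 0%N) then f else weak_deriv H a b f); split => // a b ab.
case: ifP => [/andP[/eqP a0 /eqP b0]|_]; last exact: D.
have [W L] := D a b ab; rewrite a0 b0 in W L *; have [lf _ _] := W.
have Wf : is_weak_deriv H 0 0 f f by apply: is_weak_derivE => // phi _; rewrite expr0 mul1r.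
by split => //; exact: is_weak_deriv_Lp_bounded W Wf L.
Qed.

Lemma in_sobolev_intro (m : nat) (q B : R) f : 0 < q ->
  (forall a b, (a + b <= m)%N ->
     exists2 w, is_weak_deriv H a b f w & Lp_bounded mu q B (w \_ H)) ->
  in_sobolev H m q f /\
  (sobolev_norm H m q f <= (((m.+1 * m.+1)%:R : R) `^ q^-1 * B)%:E)%E.
Proof.
move=> q0 h; have inLp w : loc_integrable H w -> Lp_bounded mu q B (w \_ H) -> in_Lp H q w.
  move=> l [_ L]; split; first exact: loc_integrable_measurable.
  by rewrite Lp_normE; exact: le_lt_trans L (ltry _).
have [w0 W0 L0] := h 0%N 0%N isT; have [lf _ _] := W0.
have Wf : is_weak_deriv H 0 0 f f by apply: is_weak_derivE => // phi _; rewrite expr0 mul1r.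
split; first split.
- exact: inLp lf (is_weak_deriv_Lp_bounded q0 W0 Wf L0).
- by move=> a b ab; have [w W L] := h a b ab; exists w => //; case: (W) => _ lw _; exact: inLp.
apply: sobolev_norm_le => //; first exact: Lp_bounded_ge0 L0.
move=> a b ab; have [w W L] := h a b ab.
by have [_] := is_weak_deriv_Lp_bounded q0 W (weak_derivP W) L; rewrite Lp_normE.
Qed.

End sobolev_norms.

Theorem proposition3p1 (R : realType) (m : nat) (p : R) (p_gt1 : 1 < p)
    (p_lt2 : p < 2) :
  exists C : R, forall omega : R * R -> R,
    in_sobolev (@halfplane R) m p omega ->
    [/\ {ae @lebesgue2 R, forall x, halfplane x ->
          (@lebesgue2 R).-integrable (@halfplane R)
            (fun y => ((bs_kernel x y).1 * omega y)%:E) /\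
          (@lebesgue2 R).-integrable (@halfplane R)
            (fun y => ((bs_kernel x y).2 * omega y)%:E)},
        in_sobolev2 (@halfplane R) m (2 * p / (2 - p)) (biot_savart omega) &
        (sobolev_norm2 (@halfplane R) m (2 * p / (2 - p)) (biot_savart omega)
          <= C%:E * sobolev_norm (@halfplane R) m p omega)%E].
Proof.
have [C C0 HC] := @biot_savart_weak_derivs R p _ m p_gt1 p_lt2 erefl.
set q := 2 * p / (2 - p) in HC *; have q0 : 0 < q by rewrite /q divr_gt0; lra.
pose K := ((m.+1 * m.+1)%:R : R) `^ q^-1.
have K0 : 0 <= K by exact: powR_ge0.
(* [C] bounds each derivative of each component, [K] accounts for the at most [(m + 1) ^ 2]
   multi-indices, and the power of 2 for the two components. *)
exists (2 `^ q^-1 * (K * C)) => omega Somega.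
have [g fam] := in_sobolev_family (ltW p_gt1) Somega.
have Nfin : sobolev_norm (@halfplane R) m p omega \is a fin_num.
  by rewrite ge0_fin_numE ?poweR_ge0//; exact: sobolev_norm_lty (ltW p_gt1) Somega.
have [gf G] := fam; have [W0 L0] := G 0%N 0%N isT; rewrite gf in L0.
have B0 := Lp_bounded_ge0 L0.
set B := fine _ in fam G W0 L0 B0.
have I j := in_sobolev_intro q0 (HC omega g B fam j).
have [S1 N1] := I true; have [S2 N2] := I false.
split; [|by split; [exact: S1|exact: S2]|].
  have a1 := biot_savart_convol p_gt1 p_lt2 L0 true.
  have a2 := biot_savart_convol p_gt1 p_lt2 L0 false.
  by apply: filterS2 a1 a2 => x [h1 _] [h2 _] _.
rewrite -(fineK Nfin) -/B -EFinM -!mulrA.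
have N0 f : (0 <= sobolev_norm (@halfplane R) m q f)%E by exact: poweR_ge0.
have KB0 : 0 <= K * (C * B) by rewrite !mulr_ge0.
apply: poweR_root_le => //; first by rewrite adde_ge0 ?poweR_ge0.
have h f : (sobolev_norm (@halfplane R) m q f <= (K * (C * B))%:E)%E ->
    (sobolev_norm (@halfplane R) m q f `^ q <= ((K * (C * B)) `^ q)%:E)%E.
  move=> Nf; rewrite -poweR_EFin; apply: (gt0_ler_poweR (ltW q0)) Nf; apply: ge0_in_itv.
    exact: N0.
  exact: KB0.
rewrite mulr_natl mulr2n EFinD; apply: leeD; apply: h; [exact: N1|exact: N2].
Qed.
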